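(* Let $\Gamma$ be a regular ciliated ribbon graph with vertex set $V$ and edge set $E$. The formula $$X\lhd(\delta\otimes z)_v=\mathrm{Hol}_{p_v}(S(z_{(2)})\otimes1)\cdot\mathrm{Hol}_{p_{f(v)}}(1\otimes S(\delta_{(1)}))\cdot X\cdot\mathrm{Hol}_{p_{f(v)}}(1\otimes\delta_{(2)})\cdot\mathrm{Hol}_{p_v}(z_{(1)}\otimes1),$$ for $X\in\mathcal H(H)^{\otimes E}$, $v\in V$, $\delta\in H^*$, $z\in H$ (equivalently $X\lhd d_v=\tau_v(S(d_{(2)}))\cdot X\cdot\tau_v(d_{(1)})$ for $d\in D(H)$), defines a right $D(H)^{\otimes V}$-module structure on $\mathcal H(H)^{\otimes E}$ which makes the opposite algebra $\mathcal H(H)^{op\otimes E}$ a right $D(H)^{\otimes V}$-module algebra, i.e. $(X\cdot_{op}Y)\lhd d=(X\lhd d_{(1)})\cdot_{op}(Y\lhd d_{(2)})$ and $1\lhd d=\epsilon(d)1$.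
   Context: $\mathbb F$ is a field of characteristic zero and $H$ is a finite-dimensional semisimple Hopf algebra over $\mathbb F$ with dual $H^*$; $S$ denotes the antipodes of $H$ and $H^*$ ($S^2=\mathrm{id}$), $\epsilon$ the counits, Sweedler notation without summation sign; $\{x_i\}$ is a basis of $H$, $\{\alpha^i\}$ the dual basis. The Drinfeld double $D(H)$ is the Hopf algebra on $H^*\otimes H$ with multiplication $(\alpha\otimes h)(\alpha'\otimes h')=\langle\alpha'_{(3)},h_{(1)}\rangle\langle S^{-1}(\alpha'_{(1)}),h_{(3)}\rangle\,\alpha\alpha'_{(2)}\otimes h_{(2)}h'$, unit $1\otimes1$, comultiplication $\Delta(\alpha\otimes h)=(\alpha_{(2)}\otimes h_{(1)})\otimes(\alpha_{(1)}\otimes h_{(2)})$, counit $\epsilon(\alpha)\epsilon(h)$, antipode $S(\alpha\otimes h)=\langle\alpha_{(1)},h_{(3)}\rangle\langle S^{-1}(\alpha_{(3)}),h_{(1)}\rangle S(\alpha_{(2)})\otimes S(h_{(2)})$. For a vertex $v$ and $d\in D(H)$, $(d)_v\in D(H)^{\otimes V}$ is $d$ in the factor $v$ and $1$ elsewhere. $D(H)^*$ is the Hopf algebra on $H\otimes H^*$ with multiplication $(y\otimes\gamma)(z\otimes\delta)=zy\otimes\gamma\delta$, unit $1\otimes1$, counit $\epsilon(y)\epsilon(\gamma)$, comultiplication $\Delta_D(y\otimes\gamma)=\sum_{i,j}(y_{(1)}\otimes\alpha^i\gamma_{(1)}\alpha^j)\otimes(S(x_j)y_{(2)}x_i\otimes\gamma_{(2)})$,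 antipode $S_D(y\otimes\gamma)=\sum_{i,j}x_iS^{-1}(y)x_j\otimes S(\alpha^j)S(\gamma)\alpha^i$. The Heisenberg double $\mathcal H(H)$ is the algebra on $H\otimes H^*$ with unit $1\otimes1$ and multiplication $(h\otimes\alpha)\cdot(h'\otimes\alpha')=\langle\alpha_{(1)},h'_{(2)}\rangle\,hh'_{(1)}\otimes\alpha_{(2)}\alpha'$; $\mathcal H(H)^{op\otimes E}$ is $\mathcal H(H)^{\otimes E}$ with opposite multiplication $X\cdot_{op}Y=Y\cdot X$. For a finite set $X$ and an algebra $A$, $A^{\otimes X}$ is the tensor product of copies of $A$ indexed by $X$; $(a)_x$ denotes the pure tensor with $a$ in the factor $x$ and $1$ elsewhere. Graphs: a ribbon graph is a finite directed graph with a cyclic ordering of the edge ends at each vertex; $e^{-1}$ is the reversed edge. A ciliated vertex carries a linear ordering of its incident edge ends inducing the cyclic one (indicated by a cilium placed before the edge end of lowest order). Paths are written as words read right to left ($e_1^{\epsilon_1}\circ\cdots\circ e_n^{\epsilon_n}$ traverses $e_n^{\epsilon_n}$ first). A ciliated face is a closed path turning maximally right at each vertex passed, including the start (the outgoing edge end comes directly after the incoming one in the cyclic ordering), and traversing each edge at most once in each direction. $\Gamma$ is a regular ciliated ribbon graph if all vertices are ciliated, there are no loops or multiple edges, each face traverses each edge at most once and each face contains exactly one cilium. For a vertex $v$ of such $\Gamma$, $f(v)=e_1^{\epsilon_1}\circ\cdots\circ e_n^{\epsilon_n}$ denotes the unique ciliated face starting and ending at $v$ and passing the cilium of $v$, i.e.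 $e_n$ is the edge end of lowest and $e_1$ the edge end of highest order at $v$. Thickening: $\Gamma_D$ has, for each edge $e$ of $\Gamma$, the four edges $r(e),l(e),r(\bar e),l(\bar e)$: $r(e),l(e)$ run parallel to $e$ on its right resp. left, $r(\bar e)$ crosses $e$ near its target end from right to left, $l(\bar e)$ crosses $e$ near its starting end from right to left; vertices of $\Gamma_D$ are the corners of $\Gamma$. For reversed edges $r(e^{-1})=l(e)^{-1}$, $l(e^{-1})=r(e)^{-1}$, $r(\overline{e^{-1}})=l(\bar e)^{-1}$, $l(\overline{e^{-1}})=r(\bar e)^{-1}$. Holonomy: with the convolution product $\phi\bullet\psi=m'\circ(\phi\otimes\psi)\circ\Delta_D$ on $\mathrm{Hom}_{\mathbb F}(H\otimes H^*,(H\otimes H^* )^{\otimes E})$, $m'$ the multiplication of the tensor product algebra $D(H)^{*\otimes E}$, $\mathrm{Hol}$ is the functor on the path groupoid of $\Gamma_D$ with $\mathrm{Hol}_{p\circ q}=\mathrm{Hol}_p\bullet\mathrm{Hol}_q$ determined by $\mathrm{Hol}_{r(e)}(y\otimes\gamma)=\epsilon(y)(1\otimes\gamma)_e$, $\mathrm{Hol}_{r(\bar e)}(y\otimes\gamma)=\epsilon(\gamma)(y\otimes1)_e$, $\mathrm{Hol}_{l(e)}(y\otimes\gamma)=\epsilon(y)\sum_{i,j}(x_iS(x_j)\otimes\alpha^j\gamma\alpha^i)_e$, $\mathrm{Hol}_{l(\bar e)}(y\otimes\gamma)=\epsilon(\gamma)\sum_{i,j}(x_iyS(x_j)\otimes\alpha^j\alpha^i)_e$,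 $\mathrm{Hol}_{x^{-1}}=\mathrm{Hol}_x\circ S_D$. Products $\cdot$ are taken in $\mathcal H(H)^{\otimes E}$. Vertex and face loops: if $v$ has incident edges $e_1,\dots,e_n$ numbered by the ordering at $v$ and $e_k^{\epsilon_k}$ is incoming at $v$, the vertex loop is $p_v=r(\overline{e_1^{\epsilon_1}})\circ\cdots\circ r(\overline{e_n^{\epsilon_n}})$. For a ciliated face $f=e_1^{\epsilon_1}\circ\cdots\circ e_n^{\epsilon_n}$ the face loop is $p_f=r(e_1^{\epsilon_1})\circ\cdots\circ r(e_n^{\epsilon_n})$. $\tau_v:D(H)\to\mathcal H(H)^{\otimes E}$ is $\tau_v(\delta\otimes z)=\mathrm{Hol}_{p_{f(v)}}(1\otimes\delta)\cdot\mathrm{Hol}_{p_v}(z\otimes1)$. *)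

(* Defs.v *)
(* Finite-dimensional Hopf algebras are given by structure
   constants in a basis; tensor products / tensor powers are represented in
   coordinates on product bases. *)
From HB Require Import structures.
From mathcomp Require Import all_boot all_order all_algebra.
Set Implicit Arguments. Unset Strict Implicit. Unset Printing Implicit Defensive.
Import GRing.Theory.
Local Open Scope ring_scope.

(* vectors with coordinates in the basis B (F^o is F as an F-module) *)
Notation vec F B := {ffun B -> F^o}.

Section Coord.
Variable F : fieldType.
Local Notation vec B := (vec F B).
Definition mkv (A : finType) (g : A -> F) : vec A := finfun g.
Definition bvec (B : finType) (b : B) : vec B := [ffun b' => (b' == b)%:R].
Definition tens (A B : finType) (x : vec A) (y : vec B) : vec (A * B)%type :=
  [ffun p => x p.1 * y p.2].
Definition linext (B : finType) (W : lmodType F) (g : B -> W) (x : vec B) : W :=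
  \sum_b x b *: g b.
Definition linext2 (A B : finType) (W : lmodType F) (g : A -> B -> W)
  (x : vec A) (y : vec B) : W := \sum_a \sum_b (x a * y b) *: g a b.
(* Sweedler-type sums: sw2 D x g = sum g(x_(1), x_(2)) where D x = Delta x *)
Definition sw2 (B : finType) (W : lmodType F) (D : vec B -> vec (B * B)%type)
  (x : vec B) (g : vec B -> vec B -> W) : W :=
  \sum_(p : B * B) D x p *: g (bvec p.1) (bvec p.2).
Definition sw3 (B : finType) (W : lmodType F) (D3 : vec B -> vec (B * B * B)%type)
  (x : vec B) (g : vec B -> vec B -> vec B -> W) : W :=
  \sum_(t : B * B * B) D3 x t *: g (bvec t.1.1) (bvec t.1.2) (bvec t.2).

(* tensor power A^{(x) X}: basis {ffun X -> B};
   tpow w is the pure tensor (x)_{x in X} w x *)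
Definition tpow (X B : finType) (w : X -> vec B) : vec {ffun X -> B} :=
  [ffun f : {ffun X -> B} => \prod_x w x (f x)].
Definition tmul (X B : finType) (mulA : vec B -> vec B -> vec B)
  (x y : vec {ffun X -> B}) : vec {ffun X -> B} :=
  linext2 (fun f g : {ffun X -> B} => tpow (fun i => mulA (bvec (f i)) (bvec (g i)))) x y.
Definition tone (X B : finType) (one : vec B) : vec {ffun X -> B} :=
  tpow (fun _ : X => one).
Definition tat (X B : finType) (one : vec B) (x0 : X) (a : vec B) : vec {ffun X -> B} :=
  tpow (fun x => if x == x0 then a else one).
End Coord.
Notation "[ 'vec' x => E ]" := (mkv (fun x => E)) (x name).
Notation "[ 'vec' x : T => E ]" := (mkv (fun x : T => E)) (x name).

(* H has basis x_0, ..., x_{n-1}; H^* has the dual basis alpha^0, ...       *)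
Record hopfData (F : fieldType) (n : nat) := HopfData {
  hm : 'I_n -> 'I_n -> 'I_n -> F;   (* x_i x_j = sum_k hm i j k x_k *)
  hu : 'I_n -> F;                   (* 1 = sum_i hu i x_i *)
  hc : 'I_n -> 'I_n -> 'I_n -> F;   (* Delta x_i = sum_{j,k} hc i j k x_j (x) x_k *)
  he : 'I_n -> F;                   (* epsilon x_i *)
  hs : 'I_n -> 'I_n -> F            (* S x_i = sum_j hs i j x_j *)
}.

Section Hopf.
Variables (F : fieldType) (n : nat) (H : hopfData F n).
Local Notation B := 'I_n.
Local Notation vB := (vec F B).
Local Notation vBB := (vec F (B * B)%type).

Definition mulH (x y : vB) : vB := linext2 (fun i j => [vec k => hm H i j k]) x y.
Definition oneH : vB := [vec i => hu H i].
Definition DeltaH (x : vB) : vBB :=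
  linext (fun i => [vec p : B * B => hc H i p.1 p.2]) x.
Definition epsH (x : vB) : F := \sum_i x i * he H i.
Definition SH (x : vB) : vB := linext (fun i => [vec j => hs H i j]) x.
Definition Delta3H (x : vB) : vec F (B * B * B)%type :=
  [vec t => \sum_(p : B) DeltaH x (p, t.2) * DeltaH (bvec F p) t.1].

(* --- H^* (coordinates in the dual basis) --- *)
Definition pairing (a h : vB) : F := \sum_i a i * h i.
Definition mulHd (a b : vB) : vB := linext2 (fun i j => [vec k => hc H k i j]) a b.
Definition oneHd : vB := [vec i => he H i].
Definition DeltaHd (a : vB) : vBB :=
  linext (fun k => [vec p : B * B => hm H p.1 p.2 k]) a.
Definition epsHd (a : vB) : F := \sum_i a i * hu H i.
Definition SHd (a : vB) : vB := linext (fun i => [vec j => hs H j i]) a.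
Definition Delta3Hd (a : vB) : vec F (B * B * B)%type :=
  [vec t => \sum_(p : B) DeltaHd a (p, t.2) * DeltaHd (bvec F p) t.1].

Definition mulHH (x y : vBB) : vBB :=
  linext2 (fun p q : B * B => tens (mulH (bvec F p.1) (bvec F q.1))
                                   (mulH (bvec F p.2) (bvec F q.2))) x y.

Definition isHopf : Prop :=
  [/\ (forall x y z, mulH (mulH x y) z = mulH x (mulH y z))
      /\ (forall x, mulH oneH x = x /\ mulH x oneH = x),
      (forall x, [vec t : B * B * B => \sum_p DeltaH x (p, t.2) * DeltaH (bvec F p) t.1]
               = [vec t : B * B * B => \sum_p DeltaH x (t.1.1, p) * DeltaH (bvec F p) (t.1.2, t.2)]),
      (forall x, ([vec j => \sum_i DeltaH x (i, j) * he H i] = x)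
              /\ ([vec i => \sum_j DeltaH x (i, j) * he H j] = x)),
      (forall x y, DeltaH (mulH x y) = mulHH (DeltaH x) (DeltaH y)
                /\ epsH (mulH x y) = epsH x * epsH y)
      /\ (DeltaH oneH = tens oneH oneH /\ epsH oneH = 1) &
      (forall x, sw2 DeltaH x (fun a b => mulH (SH a) b) = epsH x *: oneH
              /\ sw2 DeltaH x (fun a b => mulH a (SH b)) = epsH x *: oneH)].

(* semisimplicity of the algebra H: every left ideal has a complementary
   left ideal.  Subspaces of H = F^n are row spaces of n x n matrices;
   left multiplication by x_i acts on row vectors by Lmat i. *)
Definition Lmat (i : B) : 'M[F]_n := \matrix_(j, k) hm H i j k.
Definition leftIdeal (U : 'M[F]_n) : Prop := forall i, (U *m Lmat i <= U)%MS.
Definition semisimpleH : Prop :=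
  forall U, leftIdeal U ->
    exists W, [/\ leftIdeal W, (U :&: W <= (0 : 'M[F]_n))%MS & (1%:M <= U + W)%MS].

(* --- Drinfeld double D(H) = H^* (x) H; basis (i,j) = alpha^i (x) x_j --- *)
(* S^{-1} = S since S^2 = id for semisimple H in characteristic 0 *)
Definition mulDpure (a h a' h' : vB) : vBB :=
  sw3 Delta3Hd a' (fun a1 a2 a3 => sw3 Delta3H h (fun h1 h2 h3 =>
    (pairing a3 h1 * pairing (SHd a1) h3) *: tens (mulHd a a2) (mulH h2 h'))).
Definition mulD (x y : vBB) : vBB :=
  linext2 (fun p q : B * B => mulDpure (bvec F p.1) (bvec F p.2) (bvec F q.1) (bvec F q.2)) x y.
Definition oneD : vBB := tens oneHd oneH.
Definition epsD (x : vBB) : F := \sum_p x p * (epsHd (bvec F p.1) * epsH (bvec F p.2)).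
Definition DeltaD (x : vBB) : vec F ((B * B) * (B * B))%type :=
  linext (fun p : B * B => sw2 DeltaHd (bvec F p.1) (fun a1 a2 =>
            sw2 DeltaH (bvec F p.2) (fun h1 h2 => tens (tens a2 h1) (tens a1 h2)))) x.

(* --- D(H)^* = H (x) H^*; basis (i,j) = x_i (x) alpha^j --- *)
Definition mulDs (x y : vBB) : vBB :=
  linext2 (fun p q : B * B => tens (mulH (bvec F q.1) (bvec F p.1))
                                   (mulHd (bvec F p.2) (bvec F q.2))) x y.
Definition oneDs : vBB := tens oneH oneHd.
Definition epsDs (x : vBB) : F := \sum_p x p * (epsH (bvec F p.1) * epsHd (bvec F p.2)).
Definition DeltaDs (x : vBB) : vec F ((B * B) * (B * B))%type :=
  linext (fun p : B * B => sw2 DeltaH (bvec F p.1) (fun y1 y2 =>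
     sw2 DeltaHd (bvec F p.2) (fun g1 g2 => \sum_i \sum_j
       tens (tens y1 (mulHd (mulHd (bvec F i) g1) (bvec F j)))
            (tens (mulH (mulH (SH (bvec F j)) y2) (bvec F i)) g2)))) x.
Definition SDs (x : vBB) : vBB :=
  linext (fun p : B * B => \sum_i \sum_j
     tens (mulH (mulH (bvec F i) (SH (bvec F p.1))) (bvec F j))
          (mulHd (mulHd (SHd (bvec F j)) (SHd (bvec F p.2))) (bvec F i))) x.

(* --- Heisenberg double H(H) = H (x) H^*; basis (i,j) = x_i (x) alpha^j --- *)
Definition mulHeis (x y : vBB) : vBB :=
  linext2 (fun p q : B * B => sw2 DeltaHd (bvec F p.2) (fun a1 a2 =>
     sw2 DeltaH (bvec F q.1) (fun h1 h2 =>
       pairing a1 h2 *: tens (mulH (bvec F p.1) h1) (mulHd a2 (bvec F q.2))))) x y.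
Definition oneHeis : vBB := tens oneH oneHd.

End Hopf.

(* Edge ends are pairs (e, b): b = false is the starting end of e, b = true
   its target end.  cord v lists the edge ends at v in increasing order
   (the cilium sits before the first one).
   A dart (e, true) is e, a dart (e, false) is e^{-1}; a dart d arrives
   at its end point through the edge end d itself and leaves through
   (d.1, ~~ d.2). *)
Record ribbon (V E : finType) := Ribbon {
  src : E -> V;
  tgt : E -> V;
  cord : V -> seq (E * bool)
}.

Section Graph.
Variables (V E : finType) (G : ribbon V E).

Definition endv (x : E * bool) : V := if x.2 then tgt G x.1 else src G x.1.

Definition ciliated : Prop :=
  forall v, uniq (cord G v) /\ forall x, (x \in cord G v) = (endv x == v).

(* turning maximally right: leave through the edge end following the
   incoming one in the cyclic ordering *)
Definition faceNext (d : E * bool) : E * bool :=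
  let o := next (cord G (endv d)) d in (o.1, ~~ o.2).

(* the first dart of the face passing the cilium of v (leaves v through
   the lowest edge end) *)
Definition cilDart (v : V) : option (E * bool) :=
  if cord G v is o :: _ then Some (o.1, ~~ o.2) else None.

Definition cilIn (v : V) (d : E * bool) : bool :=
  if cilDart v is Some d0 then d0 \in orbit faceNext d else false.

(* f(v) listed in traversal order (first traversed dart first) *)
Definition faceOf (v : V) : seq (E * bool) :=
  if cilDart v is Some d0 then orbit faceNext d0 else [::].

Definition regular : Prop :=
  [/\ (forall e, src G e != tgt G e),
      (forall e e', e != e' ->
         ~ ((src G e = src G e' /\ tgt G e = tgt G e') \/
            (src G e = tgt G e' /\ tgt G e = src G e'))),
      (forall d, uniq (map fst (orbit faceNext d))) &
      (forall d, #|[pred v | cilIn v d]| = 1%N)].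
End Graph.

Inductive tedge (E : Type) := tR of E | tL of E | tRbar of E | tLbar of E.
(* a step of a path in Gamma_D: a thickened edge, inverted iff the bool *)
Definition step (E : Type) := (tedge E * bool)%type.

(* r(d) for a dart d: r(e^{-1}) = l(e)^{-1} *)
Definition rstep (E : Type) (d : E * bool) : step E :=
  if d.2 then (tR d.1, false) else (tL d.1, true).
(* r(bar d): r(bar(e^{-1})) = l(bar e)^{-1} *)
Definition rbarstep (E : Type) (d : E * bool) : step E :=
  if d.2 then (tRbar d.1, false) else (tLbar d.1, true).

Section Holonomy.
Variables (F : fieldType) (n : nat) (H : hopfData F n) (E : finType).
Local Notation B := 'I_n.
Local Notation vBB := (vec F (B * B)%type).
Local Notation TE := (vec F {ffun E -> (B * B)%type}).

Definition oneHE : TE := tone E (oneHeis H).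
Definition mulHE (X Y : TE) : TE := tmul (mulHeis H) X Y.
Definition mulDsE (X Y : TE) : TE := tmul (mulDs H) X Y.
Definition oneDsE : TE := tone E (oneDs H).
Definition atE (e : E) (a : vBB) : TE := tat (oneDs H) e a.

Definition conv (phi psi : vBB -> TE) (x : vBB) : TE :=
  \sum_(pq : (B * B) * (B * B)) DeltaDs H x pq *: mulDsE (phi (bvec F pq.1)) (psi (bvec F pq.2)).
Definition convUnit (x : vBB) : TE := epsDs H x *: oneDsE.

Definition holpure (g : vec F B -> vec F B -> TE) (x : vBB) : TE :=
  \sum_(p : B * B) x p *: g (bvec F p.1) (bvec F p.2).

Definition hol_tedge (t : tedge E) : vBB -> TE :=
  match t with
  | tR e => holpure (fun y g => epsH H y *: atE e (tens (oneH H) g))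
  | tRbar e => holpure (fun y g => epsHd H g *: atE e (tens y (oneHd H)))
  | tL e => holpure (fun y g => epsH H y *: \sum_i \sum_j
        atE e (tens (mulH H (bvec F i) (SH H (bvec F j)))
                    (mulHd H (mulHd H (bvec F j) g) (bvec F i))))
  | tLbar e => holpure (fun y g => epsHd H g *: \sum_i \sum_j
        atE e (tens (mulH H (mulH H (bvec F i) y) (SH H (bvec F j)))
                    (mulHd H (bvec F j) (bvec F i))))
  end.

Definition hol_step (s : step E) : vBB -> TE :=
  if s.2 then fun x => hol_tedge s.1 (SDs H x) else hol_tedge s.1.

(* Hol of the path s_1 o s_2 o ... o s_k (word read right to left) *)
Fixpoint hol (w : seq (step E)) : vBB -> TE :=
  match w with
  | [::] => convUnit
  | [:: s] => hol_step s
  | s :: w' => conv (hol_step s) (hol w')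
  end.
End Holonomy.

Section Action.
Variables (F : fieldType) (n : nat) (H : hopfData F n) (V E : finType) (G : ribbon V E).
Local Notation B := 'I_n.
Local Notation vBB := (vec F (B * B)%type).
Local Notation TE := (vec F {ffun E -> (B * B)%type}).
Local Notation TV := (vec F {ffun V -> (B * B)%type}).

(* p_v = r(bar(e_1^eps_1)) o ... o r(bar(e_n^eps_n)); the incoming dart
   along the edge end o at v is o itself *)
Definition vloop (v : V) : seq (step E) := map (@rbarstep E) (cord G v).
(* p_{f(v)} = r(e_1^eps_1) o ... o r(e_n^eps_n), e_n traversed first *)
Definition floop (v : V) : seq (step E) := map (@rstep E) (rev (faceOf G v)).

Definition actv (v : V) (X : TE) (d : vBB) : TE :=
  linext (fun p : B * B => sw2 (DeltaHd H) (bvec F p.1) (fun d1 d2 =>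
    sw2 (DeltaH H) (bvec F p.2) (fun z1 z2 =>
      mulHE H (mulHE H (mulHE H (mulHE H
        (hol H (vloop v) (tens (SH H z2) (oneHd H)))
        (hol H (floop v) (tens (oneH H) (SHd H d1)))) X)
        (hol H (floop v) (tens (oneH H) d2)))
        (hol H (vloop v) (tens z1 (oneHd H)))))) d.

Definition mulDV (x y : TV) : TV := tmul (mulD H) x y.
Definition oneDV : TV := tone V (oneD H).
Definition atV (v : V) (d : vBB) : TV := tat (oneD H) v d.
Definition DeltaDV (x : TV) : vec F ({ffun V -> (B * B)%type} * {ffun V -> (B * B)%type})%type :=
  linext (fun f : {ffun V -> (B * B)%type} =>
     [vec pq : {ffun V -> (B * B)%type} * {ffun V -> (B * B)%type} =>
        \prod_v DeltaD H (bvec F (f v)) (pq.1 v, pq.2 v)]) x.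
Definition epsDV (x : TV) : F := \sum_f x f * \prod_v epsD H (bvec F (f v)).
End Action.

(* Main.v *)
(** The holonomies of the vertex loop and of the face loop at [v] are convolution products
    over the edges, because the edges of a vertex and of a face of a regular graph are
    distinct.  The edge factors act on [H] by left and right multiplication resp. by the
    two coregular actions of [H^*]; computing in this faithful representation of the
    Heisenberg double, the vertex and face holonomies at [v] represent [H] and [H^*] and
    satisfy the cross relation of [D(H)]: crossings at corners without cilium cancel in
    pairs and only the two crossings at the cilium survive.  For the same reason
    operators at different vertices commute.  Hence conjugation with antipodes gives
    commuting [D(H)]-module algebra structures, which assemble to one of [D(H)^{(x) V}].

    All of this uses [S^2 = id], which in characteristic zero follows from semisimplicity
    as in Larson and Radford: an integral [l] makes [h |-> tr (L_h S^2)] a nonzero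
    integral of the dual, Radford's formula makes [S^4] inner by a grouplike element,
    hence [S] of finite order, decomposing [1 - l] into primitive [S^2]-stable idempotents
    gives [tr S^2 > 0], and this forces first [S^4 = id] and then [S^2 = id]. *)
Require Import Defs.
From HB Require Import structures.
From Stdlib Require Classical_Prop.
From mathcomp Require Import all_boot all_order all_algebra all_field.
From mathcomp Require Import zify ring.
Set Implicit Arguments. Unset Strict Implicit. Unset Printing Implicit Defensive.
Import Order.TTheory GRing.Theory Num.Theory.
Local Open Scope ring_scope.

(** * Linear maps in coordinates *)

(** F need be neither algebraically closed nor ordered. Over such F the simple blocks of H are
    matrix rings over division algebras, and positivity of tr S^2 has no meaning in F. So Peirce
    corners of idempotents fixed by S^2 play the role of matrix units, the trace is written as an
    integer polynomial in a primitive root of unity of an extension of F, and a vanishing resultant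
    carries a zero of that polynomial to the complex algebraic numbers.

    S^2 = id is needed far beyond rewriting S^-1 as S: the cancellations of neighbouring Sweedler
    factors occur in the form x_(2) S(x_(1)) or S(x_(2)) x_(1), already in the proof that the
    representation of the Heisenberg double is faithful.

    On the graph the decisive condition is that a face contains exactly one cilium. Then f(v) and
    f(w) share no dart for v != w, so a common edge is traversed in opposite directions, where the
    two coregular actions commute; and f(w) never passes the cilium of v, so each of its visits to v
    crosses two edge ends that are neighbours in the linear order. *)

Section Linear.
Variable F : fieldType.

(** A predicate on plain functions rather than a bundled structure: most maps below are Sweedler
    sums in one of many variables, and [lint] derives their linearity from their syntax. *)
Definition lin (U W : lmodType F) (f : U -> W) : Prop :=
  forall a x y, f (a *: x + y) = a *: f x + f y.

Section Basics.
Variables U W W' : lmodType F.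
Implicit Types f : U -> W.

Lemma lin_id : lin (fun x : U => x). Proof. by []. Qed.

Lemma lin_ext f g : f =1 g -> lin f -> lin g.
Proof. by move=> e l a x y; rewrite -!e. Qed.

Lemma lin_const0 : lin (fun _ : U => 0 : W).
Proof. by move=> a x y; rewrite scaler0 addr0. Qed.

Lemma lin0 f : lin f -> f 0 = 0.
Proof. by move=> l; rewrite -[0 in LHS](addNr 0) -scaleN1r l scaleN1r addNr. Qed.

Lemma linD f x y : lin f -> f (x + y) = f x + f y.
Proof. by move=> l; rewrite -{1}[x]scale1r l scale1r. Qed.

Lemma linZ f a x : lin f -> f (a *: x) = a *: f x.
Proof. by move=> l; rewrite -[a *: x]addr0 l (lin0 l) addr0. Qed.

Lemma linN f x : lin f -> f (- x) = - f x.
Proof. by move=> l; rewrite -scaleN1r (linZ _ _ l) scaleN1r. Qed.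

Lemma linB f x y : lin f -> f (x - y) = f x - f y.
Proof. by move=> l; rewrite (linD _ _ l) (linN _ l). Qed.

Lemma lin_sum f (I : Type) (r : seq I) (P : pred I) (X : I -> U) :
  lin f -> f (\sum_(i <- r | P i) X i) = \sum_(i <- r | P i) f (X i).
Proof.
by move=> l; apply: (big_morph f (fun x y => linD x y l) (lin0 l)).
Qed.

Lemma lin_bigsum (I : Type) (r : seq I) (P : pred I) (f : I -> U -> W) :
  (forall i, lin (f i)) -> lin (fun x => \sum_(i <- r | P i) f i x).
Proof.
move=> l a x y; rewrite scaler_sumr -big_split /=.
by apply: eq_bigr => i _; rewrite l.
Qed.

Lemma lin_add f g : lin f -> lin g -> lin (fun x => f x + g x).
Proof. by move=> lf lg a x y; rewrite lf lg scalerDr addrACA. Qed.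

Lemma lin_scale c f : lin f -> lin (fun x => c *: f x).
Proof. by move=> l a x y; rewrite l scalerDr !scalerA mulrC. Qed.

Lemma lin_opp f : lin f -> lin (fun x => - f x).
Proof. by move=> l a x y; rewrite l opprD scalerN. Qed.

Lemma lin_scalel (f : U -> F) (w : W) :
  lin (f : U -> F^o) -> lin (fun x => f x *: w).
Proof. by move=> l a x y; rewrite l scalerDl scalerA. Qed.

Lemma lin_comp (g : W -> W') f : lin g -> lin f -> lin (fun x => g (f x)).
Proof. by move=> lg lf a x y; rewrite lf lg. Qed.

Lemma lin_mulFr (f : U -> F) c : lin (f : U -> F^o) ->
  lin ((fun x => f x * c) : U -> F^o).
Proof. by move=> l a x y; rewrite l mulrDl -mulrA. Qed.

Lemma lin_mulFl (f : U -> F) c : lin (f : U -> F^o) ->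
  lin ((fun x => c * f x) : U -> F^o).
Proof. by move=> l a x y; rewrite l mulrDr mulrCA. Qed.

End Basics.

Lemma lin_iter (U : lmodType F) (f : U -> U) k : lin f -> lin (iter k f).
Proof.
move=> l; elim: k => [|k IH] //=.
by move=> a x y /=; rewrite IH l.
Qed.

Section Vec.
Variable B : finType.
Local Notation vB := (vec F B).

Lemma vecD (x y : vB) b : (x + y) b = (x b : F) + (y b : F) :> F.
Proof. by rewrite ffunE. Qed.

Lemma vecZ a (x : vB) b : (a *: x) b = a * (x b : F) :> F.
Proof. by rewrite ffunE. Qed.

Lemma vec0 b : (0 : vB) b = 0 :> F.
Proof. by rewrite ffunE. Qed.

Lemma vec_sum (I : Type) (r : seq I) (P : pred I) (X : I -> vB) b :
  (\sum_(i <- r | P i) X i) b = \sum_(i <- r | P i) (X i b : F) :> F.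
Proof. by apply: (big_morph (fun x : vB => x b)) => [x y|]; rewrite ffunE. Qed.

Lemma bvecE (b b' : B) : bvec F b b' = (b' == b)%:R.
Proof. by rewrite ffunE. Qed.

Lemma mkvE (g : B -> F) b : mkv g b = g b.
Proof. by rewrite ffunE. Qed.

Lemma vec_expand (x : vB) : x = \sum_b x b *: bvec F b.
Proof.
apply/ffunP=> b; rewrite vec_sum (bigD1 b) //= vecZ bvecE eqxx mulr1.
rewrite big1 ?addr0 // => i ne; rewrite vecZ bvecE eq_sym (negbTE ne).
by rewrite mulr0.
Qed.

Lemma sum_coord (W : lmodType F) (b : B) (g : B -> W) :
  \sum_c bvec F b c *: g c = g b.
Proof.
rewrite (bigD1 b) //= bvecE eqxx scale1r big1 ?addr0 // => i ne.
by rewrite bvecE (negbTE ne) scale0r.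
Qed.

Lemma lin_expand (W : lmodType F) (f : vB -> W) x :
  lin f -> f x = \sum_b x b *: f (bvec F b).
Proof.
move=> l; rewrite {1}[x]vec_expand (lin_sum _ _ _ l).
by apply: eq_bigr => b _; rewrite linZ.
Qed.

Lemma lin_coord b : lin ((fun x : vB => x b) : vB -> F^o).
Proof. by move=> a x y; rewrite vecD vecZ. Qed.

Lemma eq_on_basis (W : lmodType F) (f g : vB -> W) :
  lin f -> lin g -> (forall b, f (bvec F b) = g (bvec F b)) -> f =1 g.
Proof.
move=> lf lg e x; rewrite (lin_expand _ lf) (lin_expand _ lg).
by apply: eq_bigr => b _; rewrite e.
Qed.

Lemma lin_linext (W : lmodType F) (g : B -> W) : lin (linext g).
Proof.
move=> a x y; rewrite /linext scaler_sumr -big_split /=.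
by apply: eq_bigr => b _; rewrite vecD vecZ scalerDl scalerA.
Qed.

Lemma linext_b (W : lmodType F) (g : B -> W) b : linext g (bvec F b) = g b.
Proof. exact: sum_coord. Qed.

End Vec.

Section Vec2.
Variables A B : finType.

Lemma linext2E (W : lmodType F) (g : A -> B -> W) x y :
  linext2 g x y = \sum_a x a *: \sum_b y b *: g a b.
Proof.
apply: eq_bigr => a _; rewrite scaler_sumr.
by apply: eq_bigr => b _; rewrite scalerA.
Qed.

Lemma lin_linext2l (W : lmodType F) (g : A -> B -> W) y :
  lin (fun x => linext2 g x y).
Proof.
apply: (lin_ext (f := linext (fun a => \sum_b y b *: g a b))).
  by move=> x; rewrite linext2E.
exact: lin_linext.
Qed.

Lemma lin_linext2r (W : lmodType F) (g : A -> B -> W) x :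
  lin (linext2 g x).
Proof.
apply: (lin_ext (f := fun y => \sum_a x a *: linext (g a) y)).
  by move=> y; rewrite linext2E.
by apply: lin_bigsum => a; apply: lin_scale; apply: lin_linext.
Qed.

Lemma linext2_b (W : lmodType F) (g : A -> B -> W) a b :
  linext2 g (bvec F a) (bvec F b) = g a b.
Proof.
by rewrite linext2E (sum_coord _ (fun a => _)) (sum_coord _ (fun b => _)).
Qed.

Lemma tensE (x : vec F A) (y : vec F B) p : tens x y p = x p.1 * y p.2.
Proof. by rewrite ffunE. Qed.

Lemma lin_tensl y : lin (fun x : vec F A => tens x y : vec F (A * B)%type).
Proof.
by move=> a x x'; apply/ffunP=> p; rewrite vecD vecZ !tensE vecD vecZ mulrDl mulrA.
Qed.

Lemma lin_tensr x : lin (fun y : vec F B => tens x y : vec F (A * B)%type).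
Proof.
by move=> a y y'; apply/ffunP=> p; rewrite vecD vecZ !tensE vecD vecZ mulrDr mulrCA.
Qed.

Lemma tens_b (a : A) (b : B) : tens (bvec F a) (bvec F b) = bvec F (a, b).
Proof.
apply/ffunP=> -[a' b']; rewrite tensE !bvecE /= -natrM mulnb.
by rewrite /eq_op /=.
Qed.

(** The map out of the tensor product induced by a bilinear [g], as [ev_tens] shows. A Sweedler sum
    [sw2 D x g] is [ev g (D x)] by conversion. *)
Definition ev (W : lmodType F) (g : vec F A -> vec F B -> W) (t : vec F (A * B)%type) : W :=
  \sum_p t p *: g (bvec F p.1) (bvec F p.2).

Lemma lin_ev (W : lmodType F) (g : vec F A -> vec F B -> W) : lin (ev g).
Proof.
move=> a x y; rewrite /ev scaler_sumr -big_split /=.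
by apply: eq_bigr => b _; rewrite vecD vecZ scalerDl scalerA.
Qed.

Lemma ev_tens (W : lmodType F) (g : vec F A -> vec F B -> W) x y :
  (forall y, lin (g ^~ y)) -> (forall x, lin (g x)) ->
  ev g (tens x y) = g x y.
Proof.
move=> l1 l2; transitivity
    (\sum_a \sum_b (x a * y b) *: g (bvec F a) (bvec F b)).
  by rewrite pair_bigA; apply: eq_bigr => p _; rewrite tensE.
rewrite (lin_expand x (l1 y)); apply: eq_bigr => a _.
rewrite (lin_expand y (l2 _)) scaler_sumr.
by apply: eq_bigr => b _; rewrite scalerA.
Qed.

Lemma ev_lin (W W' : lmodType F) (f : W -> W') (g : vec F A -> vec F B -> W) t :
  lin f -> f (ev g t) = ev (fun a b => f (g a b)) t.
Proof.
by move=> l; rewrite (lin_sum _ _ _ l); apply: eq_bigr => p _; rewrite linZ.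
Qed.

End Vec2.
End Linear.

Arguments lin {F U W} f.
Arguments ev {F A B W} g t.

Definition bil (F : fieldType) (U U' W : lmodType F) (g : U -> U' -> W) : Prop :=
  (forall y, lin (g ^~ y)) /\ (forall x, lin (g x)).

Local Notation sw H x g := (sw2 (DeltaH H) x g).

Section Structure.
Variables (F : fieldType) (n : nat) (H : hopfData F n).
Local Notation vB := (vec F 'I_n).
Variable U : lmodType F.
Implicit Types (f : U -> vB) (W : lmodType F).

Lemma lin_mulHl f c : lin f -> lin (fun x => mulH H (f x) c).
Proof. by move=> l; apply: (lin_comp (lin_linext2l _ _) l). Qed.

Lemma lin_mulHr f c : lin f -> lin (fun x => mulH H c (f x)).
Proof. by move=> l; apply: (lin_comp (lin_linext2r _ _) l). Qed.

Lemma lin_SH f : lin f -> lin (fun x => SH H (f x)).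
Proof. by move=> l; apply: (lin_comp (lin_linext _) l). Qed.

Lemma lin_DeltaH f : lin f -> lin (fun x => DeltaH H (f x)).
Proof. by move=> l; apply: (lin_comp (lin_linext _) l). Qed.

Lemma lin_epsH f : lin f -> lin ((fun x => epsH H (f x)) : U -> F^o).
Proof.
move=> l; apply: (@lin_ext _ _ _ (fun x => \sum_i (f x i : F^o) * he H i)) => //.
by apply: lin_bigsum => i; apply: lin_mulFr; apply: (lin_comp (lin_coord _) l).
Qed.

Lemma lin_at f i : lin f -> lin ((fun x => f x i) : U -> F^o).
Proof. exact: lin_comp (lin_coord _). Qed.

Lemma pairingC (a b : vB) : pairing a b = pairing b a.
Proof. by apply: eq_bigr => i _; rewrite mulrC. Qed.

Lemma lin_pairl f (c : vB) : lin f -> lin ((fun x => pairing (f x) c) : U -> F^o).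
Proof.
move=> l; apply: (@lin_ext _ _ _ (fun x => \sum_i (f x i : F^o) * c i)) => //.
by apply: lin_bigsum => i; apply: lin_mulFr; apply: (lin_comp (lin_coord _) l).
Qed.

Lemma lin_pairr f (c : vB) : lin f -> lin ((fun x => pairing c (f x)) : U -> F^o).
Proof.
by move=> l; apply: lin_ext (lin_pairl c l) => x; rewrite pairingC.
Qed.

Lemma lin_swx f W (g : vB -> vB -> W) : lin f -> lin (fun x => sw H (f x) g).
Proof. by move=> l; apply: (lin_comp (lin_ev g) (lin_DeltaH l)). Qed.

Lemma lin_swg W (g : U -> vB -> vB -> W) y :
  (forall a b, lin (fun x => g x a b)) -> lin (fun x => sw H y (g x)).
Proof. by move=> l; apply: lin_bigsum => p; apply: lin_scale. Qed.

Lemma lin_mulHdl f c : lin f -> lin (fun x => mulHd H (f x) c).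
Proof. by move=> l; apply: (lin_comp (lin_linext2l _ _) l). Qed.

Lemma lin_mulHdr f c : lin f -> lin (fun x => mulHd H c (f x)).
Proof. by move=> l; apply: (lin_comp (lin_linext2r _ _) l). Qed.

Lemma lin_SHd f : lin f -> lin (fun x => SHd H (f x)).
Proof. by move=> l; apply: (lin_comp (lin_linext _) l). Qed.

Lemma lin_epsHd f : lin f -> lin ((fun x => epsHd H (f x)) : U -> F^o).
Proof.
move=> l; apply: (@lin_ext _ _ _ (fun x => \sum_i (f x i : F^o) * hu H i)) => //.
by apply: lin_bigsum => i; apply: lin_mulFr; apply: (lin_comp (lin_coord _) l).
Qed.

Lemma lin_swdx f W (g : vB -> vB -> W) : lin f -> lin (fun x => sw2 (DeltaHd H) (f x) g).
Proof.
by move=> l; apply: (lin_comp (lin_ev g)); apply: (lin_comp (lin_linext _) l).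
Qed.

Lemma lin_swdg W (g : U -> vB -> vB -> W) y :
  (forall a b, lin (fun x => g x a b)) -> lin (fun x => sw2 (DeltaHd H) y (g x)).
Proof. by move=> l; apply: lin_bigsum => p; apply: lin_scale. Qed.

End Structure.

Ltac lint1 :=
  first
  [ assumption
  | match goal with |- lin (fun x => x) => exact: lin_id end
  | match goal with |- lin (fun _ => 0) => exact: lin_const0 end
  | match goal with h : lin _ |- _ => apply: (lin_comp h) end
  | match goal with h : bil _ |- _ => first [ apply: (lin_comp (h.1 _)) | apply: (lin_comp (h.2 _)) ] end
  | match goal with h : forall _, lin _ |- _ => apply: (lin_comp (h _)) end
  | apply: lin_at
  | apply: lin_mulHl
  | apply: lin_mulHr
  | apply: lin_SH
  | apply: lin_epsH
  | apply: lin_pairl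
  | apply: lin_pairr
  | apply: lin_swx
  | (apply: lin_swg; intros)
  | apply: lin_mulHdl
  | apply: lin_mulHdr
  | apply: lin_SHd
  | apply: lin_epsHd
  | apply: lin_swdx
  | (apply: lin_swdg; intros)
  | apply: lin_scale
  | apply: lin_scalel
  | apply: lin_mulFl
  | apply: lin_mulFr
  | (apply: lin_bigsum; intros)
  | apply: lin_add
  | apply: lin_opp
  | apply: (lin_comp (lin_tensl _))
  | apply: (lin_comp (lin_tensr _))
  | exact: lin_id ].
Ltac lint := intros; cbv beta; solve [repeat (lint1; cbv beta)].

(** * Hopf algebras and their duals *)

Section HopfTheory.
Variables (F : fieldType) (n : nat) (H : hopfData F n).
Local Notation vB := (vec F 'I_n).
Local Notation "x ** y" := (mulH H x y) (at level 40, left associativity).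
Local Notation S := (SH H).
Local Notation eps := (epsH H).
Local Notation one := (oneH H).
Local Notation sw x g := (sw2 (DeltaH H) x g).
Implicit Types (x y z : vB) (W : lmodType F).

Lemma eq_sw W x (g g' : vB -> vB -> W) :
  (forall a b, g a b = g' a b) -> sw x g = sw x g'.
Proof. by move=> e; apply: eq_bigr => p _; rewrite e. Qed.

Lemma swE W x (g : vB -> vB -> W) : sw x g = ev g (DeltaH H x).
Proof. by []. Qed.

Lemma sw_lin W W' (f : W -> W') x (g : vB -> vB -> W) :
  lin f -> f (sw x g) = sw x (fun a b => f (g a b)).
Proof. by move=> l; exact: (ev_lin g (DeltaH H x) l). Qed.

Lemma sw_exch W m (H' : hopfData F m) x (y : vec F 'I_m) (g : vB -> vB -> _ -> _ -> W) :
  sw x (fun a b => sw2 (DeltaH H') y (fun c d => g a b c d)) =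
  sw2 (DeltaH H') y (fun c d => sw x (fun a b => g a b c d)).
Proof.
rewrite /sw2; under eq_bigr do rewrite scaler_sumr.
rewrite exchange_big; apply: eq_bigr => p _; rewrite scaler_sumr.
by apply: eq_bigr => q _; rewrite !scalerA mulrC.
Qed.

Lemma sw_sum W x (I : Type) (r : seq I) (g : I -> vB -> vB -> W) :
  \sum_(i <- r) sw x (g i) = sw x (fun a b => \sum_(i <- r) g i a b).
Proof.
by rewrite exchange_big; apply: eq_bigr => p _; rewrite scaler_sumr.
Qed.

Lemma sw_scale W x c (g : vB -> vB -> W) :
  sw x (fun a b => c *: g a b) = c *: sw x g.
Proof. by rewrite (sw_lin _ _ (lin_scale c (@lin_id _ W))). Qed.

Lemma epsb i : eps (bvec F i) = he H i.
Proof.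
by rewrite /epsH -[RHS](sum_coord (W := F^o) i (he H)).
Qed.

(** The coefficients on the right are those of the iterated coproduct [Delta3H]; this links nested
    Sweedler sums with the coassociativity axiom and with [sw3]. *)
Lemma sw_left_sum W x (g : vB -> vB -> vB -> W) :
  sw x (fun a b => sw a (fun a1 a2 => g a1 a2 b)) =
  \sum_(t : 'I_n * 'I_n * 'I_n)
    (\sum_p DeltaH H x (p, t.2) * DeltaH H (bvec F p) t.1) *:
       g (bvec F t.1.1) (bvec F t.1.2) (bvec F t.2).
Proof.
pose D := DeltaH H.
rewrite -(pair_bigA _ (fun s c => (\sum_p D x (p, c) * D (bvec F p) s) *:
       g (bvec F s.1) (bvec F s.2) (bvec F c))) /=.
under [RHS]eq_bigr do under eq_bigr do rewrite scaler_suml.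
under [RHS]eq_bigr do rewrite exchange_big /=.
rewrite [RHS]exchange_big /=.
under [RHS]eq_bigr do rewrite exchange_big /=.
rewrite pair_bigA; apply: eq_bigr => -[p c] _ /=.
rewrite scaler_sumr; apply: eq_bigr => s _.
by rewrite scalerA.
Qed.

Hypothesis HH : isHopf H.

Lemma hmulA x y z : x ** y ** z = x ** (y ** z).
Proof. by case: HH => -[h _] _ _ _ _. Qed.

Lemma hmul1x x : one ** x = x.
Proof. by case: HH => -[_ h] _ _ _ _; case: (h x). Qed.

Lemma hmulx1 x : x ** one = x.
Proof. by case: HH => -[_ h] _ _ _ _; case: (h x). Qed.

Lemma eps_mul x y : eps (x ** y) = eps x * eps y.
Proof. by case: HH => _ _ _ [h _] _; case: (h x y). Qed.

Lemma eps_one : eps one = 1.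
Proof. by case: HH => _ _ _ [_ []]. Qed.

Lemma sw_coassoc W x (g : vB -> vB -> vB -> W) :
  sw x (fun a b => sw a (fun a1 a2 => g a1 a2 b)) =
  sw x (fun a b => sw b (fun b1 b2 => g a b1 b2)).
Proof.
pose D := DeltaH H; rewrite sw_left_sum -/D.
transitivity (\sum_(t : 'I_n * 'I_n * 'I_n)
    (\sum_p D x (t.1.1, p) * D (bvec F p) (t.1.2, t.2)) *:
       g (bvec F t.1.1) (bvec F t.1.2) (bvec F t.2)).
  apply: eq_bigr => t _; congr (_ *: _).
  case: HH => _ h _ _ _; move/ffunP: (h x) => /(_ t).
  by rewrite !mkvE.
rewrite -(pair_bigA _ (fun s c => (\sum_p D x (s.1, p) * D (bvec F p) (s.2, c)) *:
       g (bvec F s.1) (bvec F s.2) (bvec F c))) /=.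
rewrite -(pair_bigA _ (fun i j => \sum_c (\sum_p D x (i, p) * D (bvec F p) (j, c)) *:
       g (bvec F i) (bvec F j) (bvec F c))) /=.
transitivity (\sum_i \sum_p D x (i, p) *:
    \sum_(s : 'I_n * 'I_n) D (bvec F p) s *: g (bvec F i) (bvec F s.1) (bvec F s.2));
    last first.
  by rewrite pair_bigA; apply: eq_bigr => -[i p] _.
apply: eq_bigr => i _.
transitivity (\sum_(s : 'I_n * 'I_n) (\sum_p D x (i, p) * D (bvec F p) s) *:
     g (bvec F i) (bvec F s.1) (bvec F s.2)).
  by rewrite pair_bigA; apply: eq_bigr => -[j c] _.
under eq_bigr do rewrite scaler_suml.
rewrite exchange_big; apply: eq_bigr => p _; rewrite scaler_sumr.
by apply: eq_bigr => s _; rewrite scalerA.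
Qed.

Lemma sw_counitl W x (g : vB -> W) : lin g -> sw x (fun a b => eps a *: g b) = g x.
Proof.
move=> l; case: HH => _ _ h _ _; case: (h x) => {}h _.
rewrite -{2}h (lin_expand _ l) /sw2.
transitivity (\sum_i \sum_j (DeltaH H x (i, j) * he H i) *: g (bvec F j)).
  by rewrite pair_bigA; apply: eq_bigr => -[i j] _; rewrite scalerA epsb.
rewrite exchange_big; apply: eq_bigr => j _; rewrite mkvE scaler_suml.
by apply: eq_bigr.
Qed.

Lemma sw_counitr W x (g : vB -> W) : lin g -> sw x (fun a b => eps b *: g a) = g x.
Proof.
move=> l; case: HH => _ _ h _ _; case: (h x) => _ {}h.
rewrite -{2}h (lin_expand _ l) /sw2.
transitivity (\sum_i \sum_j (DeltaH H x (i, j) * he H j) *: g (bvec F i)).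
  by rewrite pair_bigA; apply: eq_bigr => -[i j] _; rewrite scalerA epsb.
by apply: eq_bigr => j _; rewrite mkvE scaler_suml.
Qed.

Lemma sw_mul W x y (g : vB -> vB -> W) : bil g ->
  sw (x ** y) g = sw x (fun a b => sw y (fun c d => g (a ** c) (b ** d))).
Proof.
move=> [l1 l2]; case: HH => _ _ _ [h _] _; case: (h x y) => {}h _.
rewrite swE h /mulHH linext2E (lin_sum _ _ _ (lin_ev g)).
apply: eq_bigr => p _; rewrite (linZ _ _ (lin_ev g)); congr (_ *: _).
rewrite (lin_sum _ _ _ (lin_ev g)); apply: eq_bigr => q _.
by rewrite (linZ _ _ (lin_ev g)) ev_tens.
Qed.

Lemma sw_one W (g : vB -> vB -> W) : bil g -> sw one g = g one one.
Proof.
move=> [l1 l2]; case: HH => _ _ _ [_ [h _]] _.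
by rewrite swE h ev_tens.
Qed.

Lemma sw_Sl W x (g : vB -> W) : lin g -> sw x (fun a b => g (S a ** b)) = eps x *: g one.
Proof.
move=> l; case: HH => _ _ _ _ h; case: (h x) => {}h _.
by rewrite -(sw_lin x _ l) h linZ.
Qed.

Lemma sw_Sr W x (g : vB -> W) : lin g -> sw x (fun a b => g (a ** S b)) = eps x *: g one.
Proof.
move=> l; case: HH => _ _ _ _ h; case: (h x) => _ {}h.
by rewrite -(sw_lin x _ l) h linZ.
Qed.

Lemma S_one : S one = one.
Proof.
have := sw_Sl one (@lin_id _ vB).
by rewrite sw_one ?hmulx1 ?eps_one ?scale1r //; split=> y; lint.
Qed.

Lemma S_eps x : eps (S x) = eps x.
Proof.
have := @sw_Sl F^o x eps (lin_epsH H (@lin_id _ vB)).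
rewrite eps_one /GRing.scale /= mulr1 => <-.
rewrite -[LHS](@sw_counitr F^o x (fun x => eps (S x))); last by lint.
by apply: (@eq_sw F^o) => a b; rewrite eps_mul /GRing.scale /= mulrC.
Qed.

(** Uniqueness of the convolution inverse: S(xy) and S(y) S(x) are both inverse to the product on H
    (x) H. The sum of [G] over three legs of x and of y is evaluated twice: cancelling b e S(f) S(c)
    leaves S(xy), cancelling S(a d) b e leaves S(y) S(x). *)
Lemma S_mul x y : S (x ** y) = S y ** S x.
Proof.
pose G a b c d e f := S (a ** d) ** ((b ** e) ** (S f ** S c)).
transitivity (sw x (fun a b' => sw b' (fun b c => sw y (fun d e' =>
    sw e' (fun e f => G a b c d e f))))).
  symmetry.
  transitivity (sw x (fun a b' => sw b' (fun b c => S (a ** y) ** (b ** S c)))).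
    apply: eq_sw => a b'; apply: eq_sw => b c.
    transitivity (sw y (fun d e' => eps e' *: (S (a ** d) ** (b ** S c)))).
      apply: eq_sw => d e'.
      rewrite -[in RHS](hmul1x (S c)).
      rewrite -(@sw_Sr _ e' (fun z => S (a ** d) ** (b ** (z ** S c)))); last by lint.
      by apply: eq_sw => e f; rewrite /G !hmulA.
    by rewrite (@sw_counitr _ y (fun d => S (a ** d) ** (b ** S c))); last by lint.
  transitivity (sw x (fun a b' => eps b' *: S (a ** y))).
    apply: eq_sw => a b'.
    rewrite (@sw_Sr _ b' (fun z => S (a ** y) ** z)); last by lint.
    by rewrite hmulx1.
  by rewrite (@sw_counitr _ x (fun z => S (z ** y))); last by lint.
transitivity (sw x (fun a c => sw y (fun d f => eps a *: (eps d *: (S f ** S c))))).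
  rewrite -sw_coassoc; apply: eq_sw => a' c.
  transitivity (sw a' (fun a b => sw y (fun d' f => sw d' (fun d e => G a b c d e f)))).
    by apply: eq_sw => a b; rewrite sw_coassoc.
  rewrite sw_exch; apply: eq_sw => d' f.
  rewrite scalerA -eps_mul -[S f ** S c](hmul1x).
  rewrite -(@sw_Sl _ (a' ** d') (fun z => z ** (S f ** S c))); last by lint.
  rewrite sw_mul; last by split; lint.
  by apply: eq_sw => a b; apply: eq_sw => d e; rewrite /G !hmulA.
transitivity (sw x (fun a c => eps a *: (S y ** S c))).
  apply: eq_sw => a c; rewrite sw_scale; congr (_ *: _).
  by rewrite (@sw_counitl _ y (fun f => S f ** S c)); last by lint.
by rewrite (@sw_counitl _ x (fun c => S y ** S c)); last by lint.
Qed.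

End HopfTheory.

Arguments sw_lin {F n H W W' f} x g.
Arguments sw_exch {F n H W m H'} x y g.
Arguments sw_sum {F n H W} x {I} r g.
Arguments sw_scale {F n H W} x c g.
Arguments swE {F n H W} x g.
Arguments eq_sw {F n H W x g g'}.
Arguments sw_counitl {F n H} HH {W x g}.
Arguments sw_counitr {F n H} HH {W x g}.
Arguments sw_Sl {F n H} HH {W x g}.
Arguments sw_Sr {F n H} HH {W x g}.
Arguments sw_left_sum {F n H W} x g.

Section Dual.
Variables (F : fieldType) (n : nat) (H : hopfData F n).
Local Notation vB := (vec F 'I_n).

(** With these structure constants the operations [mulHd], [DeltaHd], [SHd], [epsHd] are convertible
    to those of [dualH], so every lemma on Hopf algebras also speaks about the dual. *)
Definition dualH : hopfData F n :=
  HopfData (fun i j k => hc H k i j) (he H) (fun k i j => hm H i j k) (hu H)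
           (fun i j => hs H j i).

Lemma pairing_b (a : vB) i : pairing a (bvec F i) = a i.
Proof.
rewrite pairingC -[RHS](sum_coord (W := F^o) i a).
by apply: eq_bigr.
Qed.

Lemma pairing_inj (a b : vB) : (forall x, pairing a x = pairing b x) -> a = b.
Proof. by move=> e; apply/ffunP=> i; rewrite -!pairing_b e. Qed.

Lemma pairing_injr (a b : vB) : (forall x, pairing x a = pairing x b) -> a = b.
Proof. by move=> e; apply: pairing_inj => x; rewrite pairingC e pairingC. Qed.

Lemma DeltaHb i p : DeltaH H (bvec F i) p = hc H i p.1 p.2.
Proof. by rewrite /DeltaH linext_b mkvE. Qed.

Lemma mulHb i j k : mulH H (bvec F i) (bvec F j) k = hm H i j k.
Proof. by rewrite /mulH linext2_b mkvE. Qed.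

Lemma pairing_mulHd a b x :
  pairing (mulHd H a b) x =
  sw2 (W := F^o) (DeltaH H) x (fun y z => pairing a y * pairing b z).
Proof.
have l1 : lin ((fun x => pairing (mulHd H a b) x) : vB -> F^o) by lint.
have l2 : lin (fun x => sw2 (W := F^o) (DeltaH H) x (fun y z => pairing a y * pairing b z))
  by lint.
apply: (eq_on_basis l1 l2) => k; rewrite pairing_b.
rewrite /mulHd /linext2 vec_sum /sw2 /=.
under eq_bigr do rewrite vec_sum.
rewrite pair_bigA; apply: eq_bigr => -[i j] _ /=.
by rewrite !pairing_b vecZ mkvE DeltaHb /= [RHS]mulrC.
Qed.

Lemma pairing_mulH a x y :
  pairing a (mulH H x y) =
  sw2 (W := F^o) (DeltaHd H) a (fun b c => pairing b x * pairing c y).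
Proof.
have l1 : lin ((fun a => pairing a (mulH H x y)) : vB -> F^o) by lint.
have l2 : lin (fun a => sw2 (W := F^o) (DeltaH dualH) a (fun y' z => pairing y' x * pairing z y))
  by lint.
apply: (eq_on_basis l1 l2) => k; rewrite pairingC pairing_b.
rewrite /mulH /linext2 vec_sum /sw2 /=.
under eq_bigr do rewrite vec_sum.
rewrite pair_bigA; apply: eq_bigr => -[i j] _ /=.
rewrite pairingC pairing_b pairingC pairing_b vecZ mkvE.
by rewrite /DeltaH linext_b mkvE /= [RHS]mulrC.
Qed.

Lemma pairing_oneHd x : pairing (oneHd H) x = epsH H x.
Proof. by apply: eq_bigr => i _; rewrite mkvE mulrC. Qed.

Lemma pairing_oneH a : pairing a (oneH H) = epsHd H a.
Proof. by apply: eq_bigr => i _; rewrite mkvE. Qed.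

Lemma pairing_SHd a x : pairing (SHd H a) x = pairing a (SH H x).
Proof.
have l1 : lin ((fun x => pairing (SHd H a) x) : vB -> F^o) by lint.
have l2 : lin ((fun x => pairing a (SH H x)) : vB -> F^o) by lint.
apply: (eq_on_basis l1 l2) => k; rewrite pairing_b.
rewrite /SH linext_b /SHd /linext vec_sum; apply: eq_bigr => i _.
by rewrite vecZ !mkvE.
Qed.

Lemma DeltaHdE a i j : DeltaHd H a (i, j) = pairing a (mulH H (bvec F i) (bvec F j)).
Proof.
rewrite /DeltaHd /linext vec_sum /pairing; apply: eq_bigr => k _.
by rewrite vecZ mkvE mulHb.
Qed.

Hypothesis HH : isHopf H.

(** Each axiom is the transpose, under the pairing, of an axiom of H. *)
Lemma dual_isHopf : isHopf dualH.
Proof.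
have mulE a b : mulH dualH a b = mulHd H a b by [].
split.
- split=> [x y z|x].
    apply: pairing_inj => u; rewrite !mulE !pairing_mulHd.
    transitivity (sw2 (W := F^o) (DeltaH H) u (fun u1 u2 => sw2 (W := F^o) (DeltaH H) u1
       (fun u11 u12 => pairing x u11 * pairing y u12 * pairing z u2))).
      apply: (eq_sw (W := F^o)) => u1 u2; rewrite pairing_mulHd.
      rewrite (sw_lin (W := F^o) (W' := F^o) (f := fun s : F^o => s * pairing z u2)) //.
      by move=> a s s'; rewrite mulrDl -mulrA.
    rewrite (sw_coassoc HH (W := F^o)); apply: (eq_sw (W := F^o)) => u1 u2.
    rewrite pairing_mulHd.
    rewrite (sw_lin (W := F^o) (W' := F^o) (f := fun s : F^o => pairing x u1 * s)).
      by apply: (eq_sw (W := F^o)) => u11 u12; rewrite mulrA.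
    by move=> a s s'; rewrite mulrDr mulrCA.
  split; apply: pairing_inj => u; rewrite !mulE !pairing_mulHd.
    under (eq_sw (W := F^o)) do rewrite pairing_oneHd.
    by apply: (@sw_counitl _ _ _ HH F^o u (pairing x)); lint.
  under (eq_sw (W := F^o)) do rewrite pairing_oneHd mulrC.
  by apply: (@sw_counitr _ _ _ HH F^o u (pairing x)); lint.
- move=> a; apply/ffunP=> -[[i j] k]; rewrite !mkvE /=.
  transitivity (pairing a (mulH H (mulH H (bvec F i) (bvec F j)) (bvec F k))).
    rewrite (lin_expand (W := F^o) (f := fun z => pairing a (mulH H z (bvec F k)))); last by lint.
    by apply: eq_bigr => p _; rewrite !DeltaHdE [pairing (bvec F p) _]pairingC pairing_b [LHS]mulrC.
  rewrite (hmulA HH).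
  rewrite (lin_expand (W := F^o) (f := fun z => pairing a (mulH H (bvec F i) z))); last by lint.
  by apply: eq_bigr => p _; rewrite !DeltaHdE [pairing (bvec F p) _]pairingC pairing_b [RHS]mulrC.
- move=> a; split; apply/ffunP=> j; rewrite mkvE.
    transitivity (pairing a (mulH H (oneH H) (bvec F j))); last by rewrite (hmul1x HH) pairing_b.
    rewrite (lin_expand (W := F^o) (f := fun z => pairing a (mulH H z (bvec F j)))); last by lint.
    by apply: eq_bigr => p _; rewrite !DeltaHdE mkvE [LHS]mulrC.
  transitivity (pairing a (mulH H (bvec F j) (oneH H))); last by rewrite (hmulx1 HH) pairing_b.
  rewrite (lin_expand (W := F^o) (f := fun z => pairing a (mulH H (bvec F j) z))); last by lint.
  by apply: eq_bigr => p _; rewrite !DeltaHdE mkvE [LHS]mulrC.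
- split=> [a b|].
    split; last first.
      rewrite -[LHS]/(epsHd H (mulHd H a b)) -!pairing_oneH pairing_mulHd.
      by rewrite (@sw_one _ _ _ HH F^o (fun y z => pairing a y * pairing b z)) ?pairing_oneH //; split; lint.
    apply/ffunP=> -[i j]; rewrite [LHS]DeltaHdE pairing_mulHd.
    rewrite (@sw_mul _ _ _ HH F^o); last by split; lint.
    rewrite /mulHH linext2E vec_sum.
    under [RHS]eq_bigr do rewrite vecZ [X in _ * X]vec_sum big_distrr /=.
    under [RHS]eq_bigr do under eq_bigr do rewrite vecZ tensE /= mulE.
    have mE p q l : mulHd H (bvec F p) (bvec F q) l = hc H l p q.
      by rewrite /mulHd linext2_b mkvE.
    under [RHS]eq_bigr do under eq_bigr do rewrite !mE.
    under [RHS]eq_bigr => p _ do under eq_bigr => q _ do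
      rewrite -[DeltaH dualH a p]/(DeltaHd H a p) -[DeltaH dualH b q]/(DeltaHd H b q).
    transitivity (\sum_(u : 'I_n * 'I_n) \sum_(v : 'I_n * 'I_n)
        hc H i u.1 u.2 * hc H j v.1 v.2 *
        (DeltaHd H a (u.1, v.1) * DeltaHd H b (u.2, v.2))).
      rewrite /sw2; apply: eq_bigr => u _; rewrite DeltaHb /GRing.scale /= big_distrr /=.
      by apply: eq_bigr => v _; rewrite DeltaHb !DeltaHdE /= /GRing.scale /= mulrA.
    (* The bialgebra axiom is self-dual: both sides are this fourfold sum, with the two middle
       indices exchanged. *)
    pose T u1 u2 v1 v2 := hc H i u1 u2 * hc H j v1 v2 *
        (DeltaHd H a (u1, v1) * DeltaHd H b (u2, v2)).
    transitivity (\sum_u1 \sum_u2 \sum_v1 \sum_v2 T u1 u2 v1 v2).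
      rewrite [RHS]pair_bigA; apply: eq_bigr => u _; rewrite [RHS]pair_bigA.
      by apply: eq_bigr.
    transitivity (\sum_u1 \sum_v1 \sum_u2 \sum_v2 T u1 u2 v1 v2).
      by apply: eq_bigr => u1 _; rewrite exchange_big.
    rewrite pair_bigA; apply: eq_bigr => -[p1 p2] _ /=.
    rewrite pair_bigA; apply: eq_bigr => -[q1 q2] _ /=.
    rewrite /T [RHS]mulrA [RHS]mulrC.
    by congr (_ * _).
  split.
    apply/ffunP=> -[i j]; rewrite [LHS]DeltaHdE tensE /= pairing_oneHd.
    by rewrite (eps_mul HH) -!pairing_oneHd !pairing_b.
  by rewrite -[LHS]/(epsHd H (oneHd H)) -pairing_oneH pairing_oneHd (eps_one HH).
- move=> a; split; apply: pairing_inj => x;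
    rewrite (@linZ _ _ F^o (fun z => pairing z x)); try lint;
    rewrite -[oneH dualH]/(oneHd H) pairing_oneHd -[epsH dualH a]/(epsHd H a) -pairing_oneH;
    rewrite (@sw_lin _ _ dualH _ F^o (fun z => pairing z x)); try lint.
    transitivity (sw2 (W := F^o) (DeltaH H) x (fun y z => pairing a (mulH H (SH H y) z))).
      transitivity (sw2 (W := F^o) (DeltaH dualH) a (fun b c => sw2 (W := F^o) (DeltaH H) x (fun y z =>
           pairing b (SH H y) * pairing c z))).
        apply: (eq_sw (H := dualH) (W := F^o)) => b c; rewrite pairing_mulHd.
        by apply: (eq_sw (H := H) (W := F^o)) => y z; rewrite pairing_SHd.
      rewrite (@sw_exch _ _ dualH F^o _ H); apply: (eq_sw (H := H) (W := F^o)) => y z.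
      by rewrite pairing_mulH.
    rewrite (@sw_Sl _ _ _ HH F^o x (fun z => pairing a z)); last by lint.
    by rewrite /GRing.scale /= mulrC.
  transitivity (sw2 (W := F^o) (DeltaH H) x (fun y z => pairing a (mulH H y (SH H z)))).
    transitivity (sw2 (W := F^o) (DeltaH dualH) a (fun b c => sw2 (W := F^o) (DeltaH H) x (fun y z =>
           pairing b y * pairing c (SH H z)))).
      apply: (eq_sw (H := dualH) (W := F^o)) => b c; rewrite pairing_mulHd.
      by apply: (eq_sw (H := H) (W := F^o)) => y z; rewrite pairing_SHd.
    rewrite (@sw_exch _ _ dualH F^o _ H); apply: (eq_sw (H := H) (W := F^o)) => y z.
    by rewrite pairing_mulH.
  rewrite (@sw_Sr _ _ _ HH F^o x (fun z => pairing a z)); last by lint.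
  by rewrite /GRing.scale /= mulrC.
Qed.

End Dual.

Section Comul.
Variables (F : fieldType) (n : nat) (H : hopfData F n).
Hypothesis HH : isHopf H.
Local Notation vB := (vec F 'I_n).
Local Notation S := (SH H).
Local Notation sw x g := (sw2 (DeltaH H) x g).

(* Tensors in H (x) H are separated by the pairings with alpha (x) beta, so the
   comultiplicative properties of S are the multiplicative ones of its dual. *)
Lemma sw_pair_eq (W : lmodType F) (t t' : vec F ('I_n * 'I_n)%type)
  (g : vB -> vB -> W) :
  (forall a b, ev (W := F^o) (fun x y => pairing a x * pairing b y) t =
               ev (W := F^o) (fun x y => pairing a x * pairing b y) t') ->
  ev g t = ev g t'.
Proof.
move=> e; congr (ev g _); apply/ffunP=> -[i j].
have E s : ev (W := F^o) (fun x y => pairing (bvec F i) x * pairing (bvec F j) y) s = s (i, j).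
  rewrite /ev -[RHS](sum_coord (W := F^o) (i, j) (fun p => s p)).
  apply: eq_bigr => -[k l] _; rewrite /GRing.scale /= mulrC; congr (_ * _).
  by rewrite pairingC pairing_b pairingC pairing_b -tens_b tensE !bvecE /= ![_ == i]eq_sym ![_ == j]eq_sym.
by rewrite -!E e.
Qed.

Lemma sw_S (W : lmodType F) x (g : vB -> vB -> W) : bil g ->
  sw (S x) g = sw x (fun a b => g (S b) (S a)).
Proof.
move=> lg.
transitivity (ev g (sw x (fun a b => tens (S b) (S a)))); last first.
  rewrite (sw_lin _ _ (lin_ev g)); apply: eq_sw => a b.
  by rewrite ev_tens; [| exact: lg.1| exact: lg.2].
apply: sw_pair_eq => a b.
rewrite -[LHS]/(sw (S x) (fun x y => pairing a x * pairing b y : F^o)) -pairing_mulHd.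
rewrite -pairing_SHd -[SHd H _]/(SH (dualH H) (mulH (dualH H) a b)) (S_mul (dual_isHopf HH)).
rewrite -[SH (dualH H) b]/(SHd H b) -[SH (dualH H) a]/(SHd H a).
rewrite -[mulH _ _ _]/(mulHd H (SHd H b) (SHd H a)) pairing_mulHd.
rewrite (sw_lin _ _ (lin_ev (W := F^o) (fun x y => pairing a x * pairing b y))).
apply: (eq_sw (H := H) (W := F^o)) => y z; rewrite ev_tens; try by lint.
by rewrite !pairing_SHd mulrC.
Qed.

End Comul.

(** * Traces of linear endomorphisms *)

Section Trace.
Variables (F : fieldType) (n : nat).
Local Notation vB := (vec F 'I_n).
Implicit Types f g : vB -> vB.

Definition tr f : F := \sum_i f (bvec F i) i.

Lemma eq_tr f g : f =1 g -> tr f = tr g.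
Proof. by move=> e; apply: eq_bigr => i _; rewrite e. Qed.

Lemma tr_cyc f g : lin f -> lin g -> tr (fun x => f (g x)) = tr (fun x => g (f x)).
Proof.
move=> lf lg; rewrite /tr.
transitivity (\sum_i \sum_j (g (bvec F i) j : F) * f (bvec F j) i).
  apply: eq_bigr => i _; rewrite (lin_expand (g _) lf) vec_sum.
  by apply: eq_bigr => j _; rewrite vecZ.
rewrite exchange_big; apply: eq_bigr => j _.
rewrite (lin_expand (f _) lg) vec_sum.
by apply: eq_bigr => i _; rewrite vecZ mulrC.
Qed.

Lemma trD f g : tr (fun x => f x + g x) = tr f + tr g.
Proof. by rewrite -big_split; apply: eq_bigr => i _; rewrite vecD. Qed.

Lemma trZ c f : tr (fun x => c *: f x) = c * tr f.
Proof. by rewrite /tr big_distrr; apply: eq_bigr => i _; rewrite vecZ. Qed.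

Lemma tr_sum (I : Type) (r : seq I) (P : pred I) (f : I -> vB -> vB) :
  tr (fun x => \sum_(i <- r | P i) f i x) = \sum_(i <- r | P i) tr (f i).
Proof.
by rewrite exchange_big; apply: eq_bigr => i _; rewrite vec_sum.
Qed.

Lemma tr_rank1 (u : vB) (p : vB -> F) : lin (p : vB -> F^o) ->
  tr (fun x => p x *: u) = p u.
Proof.
move=> l; rewrite (lin_expand u l); apply: eq_bigr => i _.
by rewrite vecZ mulrC.
Qed.

(** Row convention: the matrix acts on row vectors, so [opmx_comp] reverses the order of
    composition. *)
Definition opmx f : 'M[F]_n := \matrix_(i, j) f (bvec F i) j.

Lemma opmx_tr f : \tr (opmx f) = tr f.
Proof. by apply: eq_bigr => i _; rewrite mxE. Qed.

Lemma opmx_comp f g : lin g -> opmx (fun x => g (f x)) = opmx f *m opmx g.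
Proof.
move=> lg; apply/matrixP=> i j; rewrite !mxE (lin_expand _ lg) vec_sum.
by apply: eq_bigr => k _; rewrite vecZ !mxE.
Qed.

Lemma opmx_inj f g : lin f -> lin g -> opmx f = opmx g -> f =1 g.
Proof.
move=> lf lg e; apply: eq_on_basis => // b; apply/ffunP=> j.
by move/matrixP: e => /(_ b j); rewrite !mxE.
Qed.

Lemma opmx_id : opmx id = 1%:M.
Proof. by apply/matrixP=> i j; rewrite !mxE bvecE eq_sym. Qed.

Lemma lin_inv f g : lin f -> lin g -> (forall x, f (g x) = x) -> forall x, g (f x) = x.
Proof.
move=> lf lg e; have : opmx g *m opmx f = 1%:M.
  by rewrite -opmx_comp // -opmx_id; apply/matrixP=> i j; rewrite !mxE e.
move/mulmx1C; rewrite -opmx_comp // -opmx_id.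
by apply: (@opmx_inj (fun x => g (f x)) id) => //; apply: lin_comp.
Qed.

(** A full rank factorisation M = C R of an idempotent satisfies R C = 1, so the trace of C R is
    that of an identity matrix of size the rank. *)
Lemma tr_idempotent f : lin f -> (forall x, f (f x) = f x) ->
  tr f = (\rank (opmx f))%:R.
Proof.
move=> lf e; rewrite -opmx_tr.
have eM : opmx f *m opmx f = opmx f.
  by rewrite -opmx_comp //; apply/matrixP=> i j; rewrite !mxE e.
set M := opmx f in eM *.
have [C [R [CR Rf [B BC]]]] : exists (C : 'M_(n, \rank M)) (R : 'M_(\rank M, n)),
    [/\ C *m R = M, row_free R & exists B, B *m C = 1%:M].
  exists (col_base M), (row_base M); split; first exact: mulmx_base.
    exact: row_base_free.
  by have /row_fullP [B BC] := col_base_full M; exists B.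
have RC : R *m C = 1%:M.
  apply: (row_free_inj Rf); rewrite mul1mx -[LHS]mul1mx -[in RHS](mul1mx R) -BC.
  by rewrite -!mulmxA; congr (_ *m _); rewrite CR mulmxA CR.
by rewrite -{1}CR mxtrace_mulC RC mxtrace1.
Qed.

End Trace.

(** * Trace forms on a Hopf algebra *)

Section TraceForm.
Variables (F : fieldType) (n : nat) (H : hopfData F n).
Hypothesis HH : isHopf H.
Local Notation vB := (vec F 'I_n).
Local Notation "x ** y" := (mulH H x y) (at level 40, left associativity).
Local Notation S := (SH H).
Local Notation eps := (epsH H).
Local Notation one := (oneH H).
Local Notation sw x g := (sw2 (DeltaH H) x g).
Implicit Types (x y z a b h : vB) (W : lmodType F).

Lemma sw_coordr W x d (L : vB -> W) :
  sw x (fun a b => b d *: L a) = \sum_c DeltaH H x (c, d) *: L (bvec F c).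
Proof.
transitivity (\sum_c \sum_d' DeltaH H x (c, d') *: (bvec F d' d *: L (bvec F c))).
  by rewrite pair_bigA; apply: eq_bigr => -[c d'] _.
apply: eq_bigr => c _.
rewrite -[RHS](sum_coord d (fun d' => DeltaH H x (c, d') *: L (bvec F c))).
by apply: eq_bigr => d' _; rewrite !bvecE !scalerA mulrC eq_sym.
Qed.

Lemma sw_coordl W x d (L : vB -> W) :
  sw x (fun a b => a d *: L b) = \sum_c DeltaH H x (d, c) *: L (bvec F c).
Proof.
transitivity (\sum_d' \sum_c DeltaH H x (d', c) *: (bvec F d' d *: L (bvec F c))).
  by rewrite pair_bigA; apply: eq_bigr => -[c d'] _.
rewrite exchange_big; apply: eq_bigr => c _.
rewrite -[RHS](sum_coord d (fun d' => DeltaH H x (d', c) *: L (bvec F c))).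
by apply: eq_bigr => d' _; rewrite !bvecE !scalerA mulrC eq_sym.
Qed.

(* Both lemmas move a coproduct from the input basis vector of a trace to the
   output: sum_i x_i(1) (x) x_i(2) (x) alpha^i = sum_ij x_i (x) x_j (x) alpha^i alpha^j. *)
Lemma trace_comulr W (f : vB -> vB) (K : vB -> vB -> W) : bil K ->
  \sum_i sw (bvec F i) (fun a b => sw (f b) (fun u v => v i *: K u a)) =
  \sum_d sw (f (bvec F d)) (fun u v => sw v (fun v1 v2 => v2 d *: K u v1)).
Proof.
move=> lK.
pose X i c d := sw (f (bvec F d)) (fun u v => v i *: K u (bvec F c)).
transitivity (\sum_d \sum_i \sum_c DeltaH H (bvec F i) (c, d) *: X i c d).
  rewrite [RHS]exchange_big; apply: eq_bigr => i _; rewrite [RHS]exchange_big [RHS]pair_bigA.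
  by apply: eq_bigr => -[c d] _.
apply: eq_bigr => d _.
transitivity (sw (f (bvec F d)) (fun u v => \sum_i \sum_c
   DeltaH H (bvec F i) (c, d) *: (v i *: K u (bvec F c)))).
  rewrite -sw_sum; apply: eq_bigr => i _; rewrite -sw_sum; apply: eq_bigr => c _.
  by rewrite sw_scale.
apply: eq_sw => u v; rewrite [RHS](lin_expand (f := fun v => sw v (fun v1 v2 => v2 d *: K u v1))); last by lint.
apply: eq_bigr => i _; rewrite sw_coordr scaler_sumr; apply: eq_bigr => c _.
by rewrite !scalerA mulrC.
Qed.

Lemma trace_comull W (f : vB -> vB) (K : vB -> vB -> W) : bil K ->
  \sum_i sw (bvec F i) (fun a b => sw (f a) (fun u v => u i *: K b v)) =
  \sum_d sw (f (bvec F d)) (fun u v => sw u (fun u1 u2 => u1 d *: K u2 v)).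
Proof.
move=> lK.
pose X i c d := sw (f (bvec F d)) (fun u v => u i *: K (bvec F c) v).
transitivity (\sum_d \sum_i \sum_c DeltaH H (bvec F i) (d, c) *: X i c d).
  rewrite [RHS]exchange_big; apply: eq_bigr => i _; rewrite [RHS]pair_bigA.
  by apply: eq_bigr => -[c d] _.
apply: eq_bigr => d _.
transitivity (sw (f (bvec F d)) (fun u v => \sum_i \sum_c
   DeltaH H (bvec F i) (d, c) *: (u i *: K (bvec F c) v))).
  rewrite -sw_sum; apply: eq_bigr => i _; rewrite -sw_sum; apply: eq_bigr => c _.
  by rewrite sw_scale.
apply: eq_sw => u v; rewrite [RHS](lin_expand (f := fun u => sw u (fun u1 u2 => u1 d *: K u2 v))); last by lint.
apply: eq_bigr => i _; rewrite sw_coordl scaler_sumr; apply: eq_bigr => c _.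
by rewrite !scalerA mulrC.
Qed.

Definition phi h : F := tr (fun x => h ** S (S x)).
Definition chi h : F := tr (fun x => h ** x).

Lemma lin_tr (U : lmodType F) (f : U -> vB -> vB) :
  (forall x, lin (f ^~ x)) -> lin ((fun u => tr (f u)) : U -> F^o).
Proof.
by move=> l; apply: lin_bigsum => i; apply: (lin_comp (lin_coord _)).
Qed.

Lemma lin_phi : lin (phi : vB -> F^o).
Proof. by apply: lin_tr => x; lint. Qed.

Lemma lin_chi : lin (chi : vB -> F^o).
Proof. by apply: lin_tr => x; lint. Qed.

Lemma sw_S2 W x (g : vB -> vB -> W) : bil g ->
  sw (S (S x)) g = sw x (fun a b => g (S (S a)) (S (S b))).
Proof.
move=> lg; rewrite (sw_S HH) // (sw_S HH); last by split; lint.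
by [].
Qed.

(** Inserting a trivial factor S(a S(b)) rewrites h_(1) tr(L_{h_(2)} S^2) as a trace of u S(a),
    where u is the first leg of f applied to the second leg of the basis vector. [trace_comulr]
    turns a into a leg of the output f(x_d), next to u, and u S(v1) collapses to a counit. *)
Theorem phi_integral h : sw h (fun a b => phi b *: a) = phi h *: one.
Proof.
pose f x := h ** S (S x).
pose K u v := u ** S v : vB.
have lK : bil K by split; rewrite /K; lint.
transitivity (\sum_i sw (bvec F i) (fun a b => sw (f b) (fun u v => v i *: K u a))).
  transitivity (\sum_i sw h (fun h1 h2 => (h2 ** S (S (bvec F i))) i *: h1)).
    by rewrite sw_sum; apply: eq_sw => h1 h2; rewrite scaler_suml.
  apply: eq_bigr => i _.
  transitivity (sw (bvec F i) (fun a b => sw h (fun h1 h2 => sw b (fun b1 b2 =>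
      (h2 ** S (S b2)) i *: (h1 ** S (S b1) ** S a))))); last first.
    apply: eq_sw => a b; rewrite /f (sw_mul HH); last by split; lint.
    apply: eq_sw => h1 h2; rewrite sw_S2; last by split; lint.
    by apply: eq_sw => b1 b2.
  rewrite sw_exch; apply: eq_sw => h1 h2.
  rewrite -(sw_coassoc HH).
  transitivity (sw (bvec F i) (fun c b => eps c *: ((h2 ** S (S b)) i *: h1))).
    by rewrite (sw_counitl HH (g := fun b => (h2 ** S (S b)) i *: h1)); last by lint.
  apply: eq_sw => c b.
  transitivity (sw c (fun a b1 => (h2 ** S (S b)) i *: (h1 ** S (a ** S b1)))).
    rewrite (sw_Sr HH (g := fun z => (h2 ** S (S b)) i *: (h1 ** S z))); last by lint.
    by rewrite (S_one HH) (hmulx1 HH).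
  by apply: eq_sw => a b1; rewrite (S_mul HH) !(hmulA HH).
rewrite trace_comulr //.
transitivity (\sum_d sw (f (bvec F d)) (fun u v => eps u *: (v d *: one))).
  apply: eq_bigr => d _; rewrite -(sw_coassoc HH); apply: eq_sw => u v.
  by rewrite (sw_Sr HH (g := fun z => v d *: z)); last by lint.
rewrite scaler_suml; apply: eq_bigr => d _.
by rewrite (sw_counitl HH (g := fun v => v d *: one)); last by lint.
Qed.

Lemma chiC x y : chi (x ** y) = chi (y ** x).
Proof.
rewrite /chi (eq_tr (g := fun z => x ** (y ** z))); last by move=> z; rewrite (hmulA HH).
rewrite (@tr_cyc _ _ (fun z => x ** z) (fun z => y ** z)); try by lint.
by apply: eq_tr => z; rewrite (hmulA HH).
Qed.

Lemma chi_one : chi one = n%:R.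
Proof.
rewrite /chi (eq_tr (g := id)); last by move=> z; rewrite (hmul1x HH).
by rewrite -opmx_tr opmx_id mxtrace1.
Qed.

(** The convolution square of chi is the character of the diagonal module H (x) H, which is free of
    rank n. The trace is computed as for [phi_integral], with the roles of the legs exchanged. *)
Lemma chi_chi h : sw2 (W := F^o) (DeltaH H) h (fun a b => chi a * chi b) = n%:R * chi h.
Proof.
pose f x := h ** x.
pose K u v : F^o := chi (v ** S u).
have lchi := lin_chi.
have lK : bil K by split; rewrite /K; lint.
transitivity (\sum_i sw (bvec F i) (fun a b => sw (f a) (fun u v => u i *: K b v))).
  transitivity (\sum_i sw h (fun h1 h2 => (h1 ** bvec F i) i *: (chi h2 : F^o))).
    rewrite sw_sum; apply: (eq_sw (W := F^o)) => h1 h2.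
    by rewrite -scaler_suml.
  apply: eq_bigr => i _.
  transitivity (sw (bvec F i) (fun a b => sw h (fun h1 h2 => sw a (fun a1 a2 =>
      (h1 ** a1) i *: K b (h2 ** a2))))); last first.
    apply: eq_sw => a b; rewrite /f (sw_mul HH); last by split; lint.
    by apply: eq_sw => h1 h2.
  rewrite sw_exch; apply: eq_sw => h1 h2.
  rewrite (sw_coassoc HH).
  transitivity (sw (bvec F i) (fun a c => eps c *: ((h1 ** a) i *: (chi h2 : F^o)))).
    by rewrite (sw_counitr HH (g := fun a => (h1 ** a) i *: (chi h2 : F^o))); last by lint.
  apply: eq_sw => a c.
  transitivity (sw c (fun a2 b => (h1 ** a) i *: (chi (h2 ** (a2 ** S b)) : F^o))).
    rewrite (sw_Sr HH (g := fun z => (h1 ** a) i *: (chi (h2 ** z) : F^o))); last by lint.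
    by rewrite (hmulx1 HH).
  by apply: eq_sw => a2 b; rewrite /K (hmulA HH).
rewrite trace_comull //.
transitivity (\sum_d sw (f (bvec F d)) (fun u v => eps v *: (u d *: (n%:R : F^o)))).
  apply: eq_bigr => d _; rewrite (sw_coassoc HH); apply: eq_sw => u v.
  rewrite -chi_one.
  rewrite -(sw_Sl HH (x := v) (g := fun z => u d *: (chi z : F^o))); last by lint.
  by apply: eq_sw => v1 v2; rewrite /K chiC.
rewrite /chi /tr big_distrr; apply: eq_bigr => d _.
rewrite (sw_counitr HH (g := fun u => u d *: (n%:R : F^o))); last by lint.
by rewrite /GRing.scale /= mulrC.
Qed.

End TraceForm.

(** * Integrals and Radford's formula *)

Definition integral (F : fieldType) n (H : hopfData F n) (l : vec F 'I_n) : Prop :=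
  (forall a, mulH H a l = epsH H a *: l) /\ epsH H l = 1.

Section Integral.
Variables (F : fieldType) (n : nat) (H : hopfData F n).
Hypothesis HH : isHopf H.
Local Notation vB := (vec F 'I_n).
Local Notation "x ** y" := (mulH H x y) (at level 40, left associativity).
Local Notation S := (SH H).
Local Notation eps := (epsH H).
Local Notation one := (oneH H).
Local Notation sw x g := (sw2 (DeltaH H) x g).
Local Notation phi := (phi H).
Implicit Types (x y z a b h : vB) (W : lmodType F).

Variable l : vB.
Hypothesis hl : integral H l.

Let lphi := lin_phi H.

Lemma int_l a : a ** l = eps a *: l. Proof. exact: hl.1. Qed.

Lemma int_eps : eps l = 1. Proof. exact: hl.2. Qed.

(** The tensor l_(1) (x) S(l_(2)) is a separability element. In the coproduct of x_(1) l the factor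
    S(x_(2)) x_(3) cancels, while x_(1) l = eps(x_(1)) l removes the other occurrence of x. *)
Lemma int_casimir W x (g : vB -> vB -> W) : bil g ->
  sw l (fun a b => g (x ** a) (S b)) = sw l (fun a b => g a (S b ** x)).
Proof.
move=> lg; transitivity (sw x (fun x1 x2 => sw (x1 ** l) (fun a b => g a (S b ** x2)))).
  under [RHS]eq_sw => x1 x2.
    rewrite (sw_mul HH); last by split; lint.
    over.
  rewrite (sw_coassoc HH).
  transitivity (sw x (fun u w => eps w *: sw l (fun a b => g (u ** a) (S b)))).
    by rewrite (sw_counitr HH (g := fun u => sw l (fun a b => g (u ** a) (S b)))); last by lint.
  apply: eq_sw => u w; rewrite sw_exch -sw_scale; apply: eq_sw => a b.
  rewrite -{1}[S b](hmulx1 HH).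
  rewrite -(sw_Sl HH (g := fun z => g (u ** a) (S b ** z))); last by lint.
  by apply: eq_sw => v x2; rewrite (S_mul HH) !(hmulA HH).
transitivity (sw x (fun x1 x2 => eps x1 *: sw l (fun a b => g a (S b ** x2)))).
  apply: eq_sw => x1 x2; rewrite int_l.
  by rewrite (linZ _ _ (f := fun z => sw z _)); last by lint.
by rewrite (sw_counitl HH (g := fun x2 => sw l (fun a b => g a (S b ** x2)))); last by lint.
Qed.

Lemma int_shift_right W x (g : vB -> vB -> W) : bil g ->
  sw l (fun a b => g a (x ** b)) = sw l (fun a b => g (S x ** a) b).
Proof.
move=> lg; transitivity (sw x (fun x1 x2 => sw (x2 ** l) (fun a b => g (S x1 ** a) b))).
  under [RHS]eq_sw => x1 x2.
    rewrite (sw_mul HH); last by split; lint.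
    over.
  rewrite -(sw_coassoc HH).
  transitivity (sw x (fun w v => eps w *: sw l (fun a b => g a (v ** b)))).
    by rewrite (sw_counitl HH (g := fun v => sw l (fun a b => g a (v ** b)))); last by lint.
  apply: eq_sw => w v; rewrite sw_exch -sw_scale; apply: eq_sw => a b.
  rewrite -{1}[a](hmul1x HH).
  rewrite -(sw_Sl HH (g := fun z => g (z ** a) (v ** b))); last by lint.
  by apply: eq_sw => v' x2; rewrite !(hmulA HH).
transitivity (sw x (fun x1 x2 => eps x2 *: sw l (fun a b => g (S x1 ** a) b))).
  apply: eq_sw => x1 x2; rewrite int_l.
  by rewrite (linZ _ _ (f := fun z => sw z _)); last by lint.
by rewrite (sw_counitr HH (g := fun x1 => sw l (fun a b => g (S x1 ** a) b))); last by lint.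
Qed.

Definition mxop (P : 'M[F]_n) (v : vB) : vB := \sum_i v i *: mkv (P i).

Lemma lin_mxop P : lin (mxop P).
Proof. by apply: lin_bigsum => i; apply: lin_scalel; apply: lin_coord. Qed.

Lemma opmx_mxop P : opmx (mxop P) = P.
Proof. by apply/matrixP=> i j; rewrite mxE /mxop sum_coord mkvE. Qed.

(* Maschke: averaging a linear generalised inverse of right multiplication by x
   over the integral makes it left H-linear. *)
Lemma vn_regular x : exists y, x ** y ** x = x.
Proof.
have lR : lin (fun v => v ** x) by lint.
pose X := opmx (fun v => v ** x).
pose q := mxop (pinvmx X).
have lq : lin q := lin_mxop _.
have qK v : q (v ** x) ** x = v ** x.
  apply: (@opmx_inj _ _ (fun v => q (v ** x) ** x) (fun v => v ** x)); try lint.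
  rewrite (@opmx_comp _ _ (fun v => q (v ** x)) (fun v => v ** x)) //.
  rewrite (@opmx_comp _ _ (fun v => v ** x) q) // opmx_mxop -/X.
  exact: mulmxKpV.
exists (sw l (fun a b => a ** q (S b))).
rewrite (sw_lin (f := fun z => x ** z)); last by lint.
rewrite (sw_lin (f := fun z => z ** x)); last by lint.
transitivity (sw l (fun a b => (x ** a) ** q (S b) ** x)).
  by apply: eq_sw => a b; rewrite !(hmulA HH).
rewrite (int_casimir x (g := fun u v => u ** q v ** x)); last by split; lint.
transitivity (sw l (fun a b => (a ** S b) ** x)).
  by apply: eq_sw => a b; rewrite !(hmulA HH) qK.
rewrite (sw_Sr HH (g := fun z => z ** x)); last by lint.
by rewrite int_eps scale1r (hmul1x HH).
Qed.

(** By von Neumann regularity z = z y z = eps(y) z z = eps(y) eps(z) z. This gives uniqueness of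
    normalised integrals without a dimension count. *)
Lemma int_zero z : (forall a, a ** z = eps a *: z) -> eps z = 0 -> z = 0.
Proof.
move=> hz ez; case: (vn_regular z) => y <-.
by rewrite (hmulA HH) hz (linZ (f := fun u => z ** u)) ?hz ?ez ?scale0r ?scaler0 //; lint.
Qed.

(** Unimodularity: l a - eps(a) l is a left integral of counit zero. *)
Lemma int_r a : l ** a = eps a *: l.
Proof.
apply/eqP; rewrite -subr_eq0; apply/eqP; apply: int_zero => [b|].
  rewrite (linB (f := fun u => b ** u)); last by lint.
  rewrite -(hmulA HH) int_l (linZ _ _ (f := fun u => u ** a)); last by lint.
  rewrite (linZ _ _ (f := fun u => b ** u)); last by lint.
  by rewrite int_l scalerBr !scalerA mulrC.
rewrite (linB (W := F^o) (f := eps)); last by lint.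
rewrite (eps_mul HH) (linZ (W := F^o) (f := eps)); last by lint.
by rewrite int_eps mul1r /GRing.scale /= mulr1 subrr.
Qed.

Lemma int_shift_left W x (g : vB -> vB -> W) : bil g ->
  sw l (fun a b => g (a ** x) b) = sw l (fun a b => g a (b ** S x)).
Proof.
move=> lg; transitivity (sw x (fun x1 x2 => sw (l ** x1) (fun a b => g a (b ** S x2)))).
  under [RHS]eq_sw => x1 x2.
    rewrite (sw_mul HH); last by split; lint.
    rewrite sw_exch; over.
  rewrite (sw_coassoc HH).
  transitivity (sw x (fun u w => eps w *: sw l (fun a b => g (a ** u) b))).
    by rewrite (sw_counitr HH (g := fun u => sw l (fun a b => g (a ** u) b))); last by lint.
  apply: eq_sw => u w; rewrite sw_exch -sw_scale; apply: eq_sw => a b.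
  rewrite -{1}[b](hmulx1 HH).
  rewrite -(sw_Sr HH (g := fun z => g (a ** u) (b ** z))); last by lint.
  by apply: eq_sw => v x2; rewrite !(hmulA HH).
transitivity (sw x (fun x1 x2 => eps x1 *: sw l (fun a b => g a (b ** S x2)))).
  apply: eq_sw => x1 x2; rewrite int_r.
  by rewrite (linZ _ _ (f := fun z => sw z _)); last by lint.
by rewrite (sw_counitl HH (g := fun x2 => sw l (fun a b => g a (b ** S x2)))); last by lint.
Qed.

Lemma phi_int : phi l = 1.
Proof.
rewrite -[phi l]/(tr (fun x => l ** S (S x))) (eq_tr (g := fun x => eps x *: l)).
  by rewrite tr_rank1 ?int_eps //; lint.
by move=> x; rewrite int_r !(S_eps HH).
Qed.

(** Left integrals of the dual, seen as functions on H and not normalised. *)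
Definition left_int (m : vB -> F) : Prop :=
  lin (m : vB -> F^o) /\ forall h, sw h (fun a b => m b *: a) = m h *: one.

Lemma phi_left : left_int phi.
Proof. by split=> [|h]; [exact: lphi | exact: phi_integral]. Qed.

Lemma left_int_mull m x : left_int m -> sw l (fun a b => m (x ** b) *: a) = m l *: S x.
Proof.
move=> [lm hm]; rewrite (int_shift_right x (g := fun a b => m b *: a)); last by split; lint.
transitivity (S x ** sw l (fun a b => m b *: a)).
  rewrite (sw_lin (f := fun z => S x ** z)); last by lint.
  apply: eq_sw => a b; rewrite (linZ _ _ (f := fun z => S x ** z)) //; lint.
rewrite hm (linZ _ _ (f := fun z => S x ** z)); last by lint.
by rewrite (hmulx1 HH).
Qed.

Lemma left_int_mulSr m x : left_int m -> sw l (fun a b => m (b ** S x) *: a) = m l *: x.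
Proof.
move=> [lm hm]; rewrite -(int_shift_left x (g := fun a b => m b *: a)); last by split; lint.
transitivity (sw l (fun a b => m b *: a) ** x).
  rewrite (sw_lin (f := fun z => z ** x)); last by lint.
  apply: eq_sw => a b; rewrite (linZ _ _ (f := fun z => z ** x)) //; lint.
rewrite hm (linZ _ _ (f := fun z => z ** x)); last by lint.
by rewrite (hmul1x HH).
Qed.

(** The Frobenius form [phi] inverts the antipode: contracting [phi] with l moves a right factor
    S(x) of the second leg onto the first leg as x, and [phi l = 1]. *)
Definition Sinv b := sw l (fun u v => phi (v ** b) *: u).

Lemma SinvK x : Sinv (S x) = x.
Proof. by rewrite /Sinv left_int_mulSr ?phi_int ?scale1r //; apply: phi_left. Qed.

Lemma lin_Sinv : lin Sinv.
Proof. by rewrite /Sinv; lint. Qed.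

Lemma SK x : S (Sinv x) = x.
Proof.
apply: (lin_inv (f := Sinv) (g := S)) => //; first exact: lin_Sinv.
  by lint.
exact: SinvK.
Qed.

Lemma S_inj : injective S. Proof. exact: can_inj SinvK. Qed.

Lemma int_S : S l = l.
Proof.
apply/eqP; rewrite -subr_eq0; apply/eqP; apply: int_zero => [b|].
  rewrite (linB (f := fun u => b ** u)); last by lint.
  rewrite -{1}(SK b) -(S_mul HH) int_r int_l (linZ (f := S)); last by lint.
  by rewrite -[in eps (Sinv b)](S_eps HH) SK scalerBr.
by rewrite (linB (W := F^o) (f := eps)) ?(S_eps HH) ?subrr //; lint.
Qed.

(** The contraction p |-> l_(1) p(l_(2)) has the right inverse x |-> phi(- S(x)); in finite
    dimension this makes it injective. *)
Lemma int_contraction_inj (p q : vB -> F) : lin (p : vB -> F^o) -> lin (q : vB -> F^o) ->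
  sw l (fun a b => p b *: a) = sw l (fun a b => q b *: a) -> p =1 q.
Proof.
move=> lp lq.
pose th (v : vB) := sw l (fun a b => pairing v b *: a).
pose ps x : vB := [ffun k => phi (bvec F k ** S x)].
have pairv (f : vB -> F) : lin (f : vB -> F^o) -> forall b, pairing [ffun k => f (bvec F k)] b = f b.
  move=> lf b; rewrite pairingC (lin_expand b lf).
  by apply: eq_bigr => i _; rewrite ffunE.
have lps : lin ps.
  have ll k : lin ((fun x => phi (bvec F k ** S x)) : vB -> F^o) by lint.
  by move=> a x y; apply/ffunP=> k; rewrite vecD vecZ !ffunE ll.
have lth : lin th by rewrite /th; lint.
have thps x : th (ps x) = x.
  rewrite -[RHS](SinvK x); apply: eq_sw => a b.
  by rewrite (pairv (fun z => phi (z ** S x))); last by lint.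
have psth := lin_inv lth lps thps.
have thp (f : vB -> F) : lin (f : vB -> F^o) ->
    th [ffun k => f (bvec F k)] = sw l (fun a b => f b *: a).
  by move=> lf; apply: eq_sw => a b; rewrite pairv.
move=> e b; rewrite -(pairv p) // -(pairv q) //.
suff -> : [ffun k => p (bvec F k)] = [ffun k => q (bvec F k)] :> vB by [].
by apply: (can_inj psth); rewrite (thp _ lp) (thp _ lq).
Qed.

(** S^2 is the Nakayama automorphism of [phi]: as functions of b, both sides contract with l to
    S(a). *)
Lemma phi_nak a b : phi (a ** b) = phi (b ** S (S a)).
Proof.
apply: (int_contraction_inj (p := fun b => phi (a ** b)) (q := fun b => phi (b ** S (S a)))); try by lint.
by rewrite left_int_mull ?left_int_mulSr //; apply: phi_left.
Qed.

Lemma phi_ndr a b : (forall x, phi (x ** a) = phi (x ** b)) -> a = b.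
Proof.
move=> e; rewrite -(SK a) -(SK b); congr (S _).
rewrite /Sinv; apply: eq_sw => u v; congr (_ *: _); exact: e.
Qed.

(** Both sides contract with l to the same multiple of 1. The factor [S one] only brings them into
    the shape of [left_int_mulSr]. *)
Lemma left_int_uniq m x : left_int m -> m x = m l * phi x.
Proof.
move=> hm; have [lm _] := hm.
have E := int_contraction_inj (p := fun b => m (b ** S one)) (q := fun b => m l * phi (b ** S one)).
have /E e : lin ((fun b => m (b ** S one)) : vB -> F^o) by lint.
have /e {}e : lin ((fun b => m l * phi (b ** S one)) : vB -> F^o) by lint.
suff: m (x ** S one) = m l * phi (x ** S one) by rewrite (S_one HH) !(hmulx1 HH).
apply: e; rewrite left_int_mulSr //.
under [RHS]eq_sw do rewrite -scalerA.
by rewrite sw_scale left_int_mulSr ?phi_int ?scale1r //; exact: phi_left.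
Qed.

(* The distinguished grouplike element. *)
Definition gl : vB := sw l (fun a b => phi a *: b).

(** Every coordinate of phi(h_(1)) h_(2) is a left integral as a function of h, hence a multiple of
    [phi]; its value at l gives the scalar. *)
Lemma phi_gl h : sw h (fun a b => phi a *: b) = phi h *: gl.
Proof.
apply: pairing_injr => c.
pose m x : F := sw2 (W := F^o) (DeltaH H) x (fun a b => phi a * pairing c b).
have mE x : pairing c (sw x (fun a b => phi a *: b)) = m x.
  rewrite (sw_lin (W' := F^o) (f := fun z => pairing c z)); last by lint.
  apply: (eq_sw (W := F^o)) => a b.
  by rewrite (linZ (W := F^o) (f := fun z => pairing c z)); last by lint.
have hm : left_int m.
  split=> [|x]; first by rewrite /m; lint.
  transitivity (sw x (fun a b => sw b (fun b1 b2 => phi b1 * pairing c b2 *: a))).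
    apply: eq_sw => a b.
    by rewrite -(sw_lin (W := F^o) (f := fun s => s *: a)); last by lint.
  rewrite -(sw_coassoc HH).
  transitivity (sw x (fun u b2 => pairing c b2 *: (phi u *: one))).
    apply: eq_sw => u b2; rewrite -(phi_integral HH) -sw_scale.
    by apply: eq_sw => a b1; rewrite scalerA mulrC.
  rewrite /m (sw_lin (W := F^o) (f := fun s => s *: one)); last by lint.
  by apply: eq_sw => a b; rewrite scalerA mulrC.
rewrite mE (left_int_uniq _ hm) -mE mulrC.
by rewrite (linZ (W := F^o) (f := fun z => pairing c z)); last by lint.
Qed.

Lemma gl_comul W (k : vB -> vB -> W) : bil k -> sw gl k = k gl gl.
Proof.
move=> lk; rewrite {1}/gl (sw_lin (f := fun z => sw z k)); last by lint.
transitivity (sw l (fun a b => sw b (fun b1 b2 => phi a *: k b1 b2))).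
  apply: eq_sw => a b; rewrite sw_scale.
  by rewrite (linZ _ _ (f := fun z => sw z k)); last by lint.
rewrite -(sw_coassoc HH).
transitivity (sw l (fun u b => k (phi u *: gl) b)).
  apply: eq_sw => u b; rewrite -phi_gl (sw_lin (f := fun z => k z b)); last by lint.
  by apply: eq_sw => a b1; rewrite (linZ _ _ (f := fun z => k z b)); last by lint.
transitivity (k gl (sw l (fun a b => phi a *: b))); last by [].
rewrite (sw_lin (f := fun z => k gl z)); last by lint.
apply: eq_sw => a b; rewrite (linZ _ _ (f := fun z => k z b)); last by lint.
by rewrite (linZ _ _ (f := fun z => k gl z)); last by lint.
Qed.

Lemma gl_eps : eps gl = 1.
Proof.
rewrite /gl (sw_lin (W' := F^o) (f := eps)); last by lint.
rewrite -[RHS]phi_int -[RHS](sw_counitr HH (W := F^o) (g := phi)); last by lint.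
apply: (eq_sw (W := F^o)) => a b.
by rewrite (linZ (W := F^o) (f := eps)) /GRing.scale /= 1?mulrC //; lint.
Qed.

Lemma gl_S : gl ** S gl = one.
Proof.
have := sw_Sr HH (x := gl) (g := id); rewrite gl_comul; last by split; lint.
by rewrite gl_eps scale1r; apply.
Qed.

Lemma S_gl : S gl ** gl = one.
Proof.
have := sw_Sl HH (x := gl) (g := id); rewrite gl_comul; last by split; lint.
by rewrite gl_eps scale1r; apply.
Qed.

Lemma SS_gl : S (S gl) = gl.
Proof.
by rewrite -[LHS](hmulx1 HH) -S_gl -(hmulA HH) -(S_mul HH) gl_S (S_one HH) (hmul1x HH).
Qed.

(** The left side is again a left integral: apply S to [phi_gl] for S(h) gl, using that S reverses
    the coproduct. Its value at l is 1, so uniqueness applies. *)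
Lemma phi_S h : phi (S h ** gl) = phi h.
Proof.
pose m x := phi (S x ** gl).
have hm : left_int m.
  split=> [|x]; first by rewrite /m; lint.
  apply: S_inj; rewrite (sw_lin (f := S)); last by lint.
  rewrite (linZ (f := S)) ?(S_one HH); last by lint.
  have e : sw (S x ** gl) (fun a b => phi a *: b) = m x *: gl by exact: phi_gl.
  rewrite (sw_mul HH) in e; last by split; lint.
  rewrite (sw_S HH) in e; last by split; lint.
  transitivity ((m x *: gl) ** S gl); last first.
    by rewrite (linZ _ _ (f := fun z => z ** S gl)) ?gl_S //; lint.
  rewrite -e (sw_lin (f := fun z => z ** S gl)); last by lint.
  apply: eq_sw => a b; rewrite gl_comul; last by split; lint.
  rewrite (linZ (f := S)); last by lint.
  rewrite (linZ _ _ (f := fun z => z ** S gl)); last by lint.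
  by rewrite (hmulA HH) gl_S (hmulx1 HH).
rewrite -/(m h) (left_int_uniq _ hm) /m int_S int_r gl_eps scale1r phi_int.
by rewrite mul1r.
Qed.

(* Radford's formula for S^4. *)
Lemma S4 b : gl ** S (S (S (S b))) ** S gl = b.
Proof.
apply/esym/phi_ndr => a.
pose c := gl ** S (S b) ** S gl.
have Sc : S c = gl ** S (S (S b)) ** S gl.
  by rewrite /c !(S_mul HH) SS_gl (hmulA HH).
have -> : gl ** S (S (S (S b))) ** S gl = S (S c).
  by rewrite Sc !(S_mul HH) SS_gl (hmulA HH).
(* Both sides become phi(S(a) gl S^3(b)): the left by [phi_S] followed by [phi_nak], the right by
   [phi_nak] followed by [phi_S]. *)
rewrite -phi_nak -(phi_S (a ** b)) (S_mul HH) (hmulA HH) phi_nak.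
rewrite -(phi_S (c ** a)) (S_mul HH) Sc; congr phi.
by rewrite !(hmulA HH) S_gl (hmulx1 HH).
Qed.

End Integral.

(** * Grouplike elements have finite order *)

Section Grouplike.
Variables (F : fieldType) (n : nat) (H : hopfData F n).
Hypothesis HH : isHopf H.
Local Notation vB := (vec F 'I_n).
Local Notation "x ** y" := (mulH H x y) (at level 40, left associativity).
Local Notation S := (SH H).
Local Notation eps := (epsH H).
Local Notation one := (oneH H).
Local Notation sw x g := (sw2 (DeltaH H) x g).

Definition hpow (g : vB) k := iter k (fun x => g ** x) one.

Lemma hpowD g j k : hpow g (j + k) = hpow g j ** hpow g k.
Proof.
elim: j => [|j IH]; first by rewrite (hmul1x HH).
by rewrite addSn /= IH (hmulA HH).
Qed.

Variable g : vB.
Hypothesis gD : forall (W : lmodType F) (k : vB -> vB -> W), bil k -> sw g k = k g g.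
Hypothesis gE : eps g = 1.
Hypothesis gS : S g ** g = one.

Lemma hpow_comul (W : lmodType F) (k : vB -> vB -> W) m : bil k ->
  sw (hpow g m) k = k (hpow g m) (hpow g m).
Proof.
elim: m k => [|m IH] k lk; first exact: sw_one.
rewrite [hpow g m.+1]/(g ** hpow g m) (sw_mul HH) // gD; last by split; lint.
by rewrite (IH (fun c d => k (g ** c) (g ** d))); last by split; lint.
Qed.

Lemma hpow_eps m : eps (hpow g m) = 1.
Proof. by elim: m => [|m IH]; rewrite ?(eps_one HH) //= (eps_mul HH) gE IH mulr1. Qed.

Lemma hpow_inj_l j x y : hpow g j ** x = hpow g j ** y -> x = y.
Proof.
elim: j x y => [|j IH] x y /=; first by rewrite !(hmul1x HH).
rewrite !(hmulA HH) => /(congr1 (fun z => S g ** z)).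
by rewrite -!(hmulA HH) gS !(hmul1x HH) => /IH.
Qed.

(** Reversed, so that the newest power is the head, as [free_cons] expects. *)
Let X m : seq vB := [seq hpow g i | i <- rev (iota 0 m)].

Lemma powers_succ m : X m.+1 = hpow g m :: X m.
Proof. by rewrite /X -addn1 iotaD rev_cat. Qed.

(** Linear independence of distinct grouplike elements, applied to powers: the first power that
    depends linearly on the earlier ones must coincide with one of them. *)
Lemma grouplike_finite_order : exists2 m, (0 < m)%N & hpow g m = one.
Proof.
have [m fm nfm] : exists2 m, free (X m) & ~~ free (X m.+1).
  have nf : ~~ free (X (\dim {:vB}).+1).
    apply/negP=> f; have := dim_span (X (\dim {:vB}).+1).
    have := dimvS (subvf (span (X (\dim {:vB}).+1))).
    move: f; rewrite /free => /eqP ->.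
    by rewrite size_map size_rev size_iota ltnn.
  elim: (\dim {:vB}).+1 nf => [|k IH] nf; first by rewrite nil_free in nf.
  by case: (boolP (free (X k))) => [fk|/IH //]; exists k.
rewrite powers_succ free_cons fm andbT negbK in nfm.
have sz : size (X m) = m by rewrite size_map size_rev size_iota.
pose T := in_tuple (X m).
pose c i := coord T i (hpow g m).
have e : hpow g m = \sum_i c i *: T`_i by apply: (@coord_span _ _ _ T (hpow g m)); exact: nfm.
have nthT (i : 'I_(size (X m))) : exists2 k, (k < m)%N & T`_i = hpow g k.
  have := mem_nth 0 (ltn_ord i); case/mapP=> k; rewrite mem_rev mem_iota add0n => /= km ->.
  by exists k.
have lc i : lin (coord T i : vB -> F^o).
  by move=> a x y; rewrite linearP.
(* Comparing the coproduct of g^m with that of its expansion in the independent earlier powers: the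
   coefficients are orthogonal idempotents of F, so exactly one of them is 1. *)
have cc i j : c i * c j = (i == j)%:R * c i.
  pose K (a b : vB) : F^o := coord T i a * coord T j b.
  have lK : bil K.
    split=> y; rewrite /K; first by apply: lin_mulFr.
    by apply: (@lin_mulFl _ _ (coord T j) (coord T i y)).
  rewrite -[LHS]/(K (hpow g m) (hpow g m)) -hpow_comul //.
  rewrite {1}e (lin_sum _ _ _ (lin_swx H K (@lin_id _ vB))).
  transitivity (\sum_k c k * ((i == k)%:R * (j == k)%:R)).
    apply: eq_bigr => k _; rewrite (linZ _ _ (lin_swx H K (@lin_id _ vB))).
    case: (nthT k) => p _ Tk; rewrite Tk hpow_comul // -Tk /K.
    by rewrite !coord_free // ![_ == k]eq_sym.
  rewrite (bigD1 i) //= big1 => [|k /negbTE ne]; last first.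
    by rewrite eq_sym ne mul0r mulr0.
  by rewrite addr0 eqxx mul1r mulrC eq_sym.
have [i ci] : exists i, c i != 0.
  case: (pickP (fun i => c i != 0)) => [i ci|c0]; first by exists i.
  have := hpow_eps m; rewrite e big1 => [|i _]; last first.
    by have /negbFE/eqP -> := c0 i; rewrite scale0r.
  by rewrite (lin0 (lin_epsH H (@lin_id _ vB))) => /esym/eqP; rewrite oner_eq0.
have ci1 : c i = 1.
  by apply: (mulfI ci); rewrite cc eqxx mul1r mulr1.
have [k km Tk] := nthT i.
have e1 : hpow g m = hpow g k.
  rewrite e (bigD1 i) //= big1 => [|j ji]; first by rewrite addr0 ci1 scale1r Tk.
  by have := cc i j; rewrite eq_sym (negbTE ji) mul0r ci1 mul1r => ->; rewrite scale0r.
exists (m - k)%N; first by rewrite subn_gt0.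
apply: (@hpow_inj_l k); rewrite -hpowD subnKC ?(ltnW km) //.
by rewrite e1 (hmulx1 HH).
Qed.

End Grouplike.

Section FiniteOrder.
Variables (F : fieldType) (n : nat) (H : hopfData F n).
Hypothesis HH : isHopf H.
Variable l : vec F 'I_n.
Hypothesis hl : integral H l.
Local Notation S := (SH H).
Local Notation "x ** y" := (mulH H x y) (at level 40, left associativity).

Lemma S2_finite_order : exists2 m, (0 < m)%N & forall x, iter m (fun y => S (S y)) x = x.
Proof.
have [m m0 gm] := @grouplike_finite_order _ _ H HH (gl H l) (gl_comul HH hl)
  (gl_eps HH hl) (S_gl HH hl).
exists (m * 2)%N; first by rewrite muln_gt0 m0.
set g := gl H l in gm.
(* Radford's formula reads gl S^4(x) = x gl. It concerns the square of S^2, hence the factor 2 in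
   the exponent. *)
have e k x : hpow H g k ** iter (k * 2) (fun y => S (S y)) x = x ** hpow H g k.
  elim: k x => [|k IH] x; first by rewrite (hmul1x HH) (hmulx1 HH).
  have {2}-> : k.+1 = (k + 1)%N by rewrite addn1.
  rewrite mulnDl iterD [hpow _ _ k.+1]/(g ** hpow H g k) (hmulA HH) IH mul1n /=.
  rewrite -{2}(S4 HH hl x) -/g !(hmulA HH).
  by rewrite -[S g ** (g ** _)](hmulA HH) (S_gl HH hl) (hmul1x HH).
by move=> x; have := e m x; rewrite gm (hmul1x HH) (hmulx1 HH).
Qed.

End FiniteOrder.

(** * The trace of the squared antipode *)

Lemma natr_inj_char0 (F : fieldType) : [pchar F] =i pred0 ->
  injective (fun m : nat => m%:R : F).
Proof.
move=> /pcharf0P p0 a b; wlog ab : a b / (a <= b)%N.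
  by move=> w e; case: (leqP a b) => [/w|/ltnW /w h]; [exact | exact/esym/h].
by move=> /esym/eqP; rewrite -subr_eq0 -natrB // p0 subn_eq0 => ba; apply/eqP; rewrite eqn_leq ab.
Qed.

Section Positivity.
Variables (F : fieldType) (n : nat) (H : hopfData F n).
Hypothesis charF : [pchar F] =i pred0.
Hypothesis HH : isHopf H.
Local Notation vB := (vec F 'I_n).
Local Notation "x ** y" := (mulH H x y) (at level 40, left associativity).
Local Notation S := (SH H).
Local Notation one := (oneH H).
Implicit Types (x y z e f v : vB).
Variable l : vB.
Hypothesis hl : integral H l.

Let T x := S (S x).
Variables (M : nat) (zeta : F).
Hypothesis M0 : (0 < M)%N.
Hypothesis TM : forall x, iter M T x = x.
Hypothesis prim_zeta : M.-primitive_root zeta.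

Lemma lin_T : lin T. Proof. by rewrite /T; lint. Qed.
Lemma T_mul x y : T (x ** y) = T x ** T y. Proof. by rewrite /T !(S_mul HH). Qed.
Lemma T_one : T one = one. Proof. by rewrite /T !(S_one HH). Qed.
Lemma iT_mul j x y : iter j T (x ** y) = iter j T x ** iter j T y.
Proof. by elim: j => //= j ->; rewrite T_mul. Qed.
Lemma T_Z c x : T (c *: x) = c *: T x. Proof. exact: linZ lin_T. Qed.
Lemma mulZl c x y : (c *: x) ** y = c *: (x ** y).
Proof. by rewrite (linZ _ _ (f := fun z => z ** y)) //; lint. Qed.
Lemma mulZr c x y : x ** (c *: y) = c *: (x ** y).
Proof. by rewrite (linZ _ _ (f := fun z => x ** z)) //; lint. Qed.
Lemma mul0v y : 0 ** y = 0. Proof. by rewrite (lin0 (f := fun z => z ** y)) //; lint. Qed.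
Lemma mulv0 y : y ** 0 = 0. Proof. by rewrite (lin0 (f := fun z => y ** z)) //; lint. Qed.
Lemma iT_eigen j c x : T x = c *: x -> iter j T x = c ^+ j *: x.
Proof.
by move=> e; elim: j => [|j IH] /=; rewrite ?scale1r // IH T_Z e scalerA -exprSr.
Qed.

Lemma natF0 m : (m%:R == 0 :> F) = (m == 0%N).
Proof. by have /pcharf0P -> := charF. Qed.

Lemma zeta_neq0 : zeta != 0.
Proof.
apply/eqP=> z0; have := prim_expr_order prim_zeta.
by rewrite z0 expr0n (gtn_eqF M0) => /esym/eqP; rewrite oner_eq0.
Qed.

Lemma zetaM k : (zeta ^+ k) ^+ M = 1.
Proof. by rewrite exprAC (prim_expr_order prim_zeta) expr1n. Qed.

(** The spectral projector of T for the eigenvalue c^-1, where c^M = 1. *)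
Definition proj (c : F) v : vB := M%:R^-1 *: \sum_(j < M) c ^+ j *: iter j T v.

Lemma T_proj c v : c != 0 -> c ^+ M = 1 -> T (proj c v) = c^-1 *: proj c v.
Proof.
move=> c0 cM; rewrite /proj T_Z scalerA [c^-1 * _]mulrC -scalerA; congr (_ *: _).
rewrite (lin_sum _ _ _ lin_T) -(big_mkord xpredT (fun j => T (c ^+ j *: iter j T v))).
rewrite -(big_mkord xpredT (fun j => c ^+ j *: iter j T v)).
transitivity (c^-1 *: \sum_(0 <= j < M) c ^+ j.+1 *: iter j.+1 T v).
  rewrite scaler_sumr; apply: eq_bigr => j _.
  by rewrite scalerA exprS mulKf // T_Z.
congr (_ *: _); rewrite -(prednK M0) big_nat_recr //= [RHS]big_nat_recl //= addrC.
congr (_ + _).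
have <- : iter M T v = T (iter M.-1 T v) by rewrite -[in LHS](prednK M0).
by rewrite TM (prednK M0) cM expr0.
Qed.

Lemma sum_proj v : \sum_(k < M) proj (zeta ^- k) v = v.
Proof.
rewrite /proj -scaler_sumr exchange_big /=.
rewrite (bigD1 (Ordinal M0)) //= [X in _ *: (_ + X)]big1 => [|j j0].
  rewrite addr0 -scaler_suml (eq_bigr (fun _ => 1)) => [|k _]; last by rewrite expr0.
  by rewrite sumr_const card_ord scalerA mulVf ?scale1r // natF0 -lt0n.
rewrite -scaler_suml.
rewrite (eq_bigr (fun k : 'I_M => (zeta ^- j) ^+ k)) => [|k _]; last first.
  by rewrite -!exprVn -!exprM mulnC.
have ne : zeta ^- j != 1.
  rewrite invr_eq1 -(prim_order_dvd prim_zeta); apply/negP=> /dvdn_leq.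
  by rewrite lt0n -val_eqE /= in j0 * => /(_ j0); rewrite leqNgt ltn_ord.
suff -> : \sum_(k < M) (zeta ^- j) ^+ k = 0 by rewrite scale0r.
have := subrX1 (zeta ^- j) M; rewrite exprVn zetaM invr1 subrr.
by move=> /esym/eqP; rewrite mulf_eq0 subr_eq0 (negbTE ne) /= => /eqP.
Qed.

(** Applying T^j to x y x = x shows x T^j(y) x = c^-j x, so the homogeneous part [proj c y] of any
    quasi-inverse y of x is one as well. *)
Lemma vn_graded c x : c != 0 -> c ^+ M = 1 -> T x = c *: x ->
  exists2 y, x ** y ** x = x & T y = c^-1 *: y.
Proof.
move=> c0 cM Tx; have [y xyx] := vn_regular HH hl x.
exists (proj c y); last exact: T_proj.
have e j : x ** iter j T y ** x = c ^- j *: x.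
  have := congr1 (iter j T) xyx; rewrite !iT_mul (iT_eigen _ Tx).
  rewrite !mulZl mulZr scalerA => /(congr1 (fun z => (c ^- j * c ^- j) *: z)).
  rewrite !scalerA mulrACA !mulVf ?mul1r ?scale1r ?expf_neq0 // => ->.
  by rewrite -mulrA mulVf ?mulr1 ?expf_neq0.
rewrite /proj mulZr mulZl (lin_sum _ _ _ (f := fun z => x ** z)); last by lint.
rewrite (lin_sum _ _ _ (f := fun z => z ** x)); last by lint.
rewrite (eq_bigr (fun _ => x)) => [|j _].
  by rewrite sumr_const card_ord -scaler_nat scalerA mulVf ?scale1r // natF0 -lt0n.
by rewrite mulZr mulZl e scalerA divff ?scale1r // expf_neq0.
Qed.

Definition idem f := f ** f = f /\ T f = f.
(** Primitive only among the idempotents fixed by T. The corner f H f may still be large, since T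
    need not act trivially on it. *)
Definition primitive f :=
  [/\ f != 0, idem f & forall e, idem e -> f ** e = e -> e ** f = e -> e = 0 \/ e = f].

(** Matrix units between the summands cut out by q and s, homogeneous under T of mutually inverse
    degrees. *)
Definition unitpair q s (c : F) x y :=
  [/\ x ** y = q, y ** x = s, T x = c *: x, T y = c^-1 *: y &
      [/\ q ** x = x, x ** s = x, s ** y = y & y ** q = y]].

(** For a homogeneous quasi-inverse y of x, the products x y and y x are nonzero T-fixed idempotents
    below q and s, so they are q and s by primitivity. *)
Lemma primitive_unit q s c x : primitive q -> primitive s -> c != 0 -> c ^+ M = 1 ->
  x != 0 -> q ** x = x -> x ** s = x -> T x = c *: x -> exists y, unitpair q s c x y.
Proof.
move=> [q0 [qq Tq] qp] [s0 [ss Ts] sp] c0 cM x0 qx xs Tx.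
have [y xyx Ty] := vn_graded c0 cM Tx.
(* Cutting y down to the piece s H q keeps it a quasi-inverse of the same degree. *)
exists (s ** y ** q).
have xy'x : x ** (s ** y ** q) ** x = x.
  by rewrite -!(hmulA HH) xs !(hmulA HH) qx -(hmulA HH).
have Ty' : T (s ** y ** q) = c^-1 *: (s ** y ** q).
  by rewrite !T_mul Ts Tq Ty mulZr mulZl.
have sy : s ** (s ** y ** q) = s ** y ** q by rewrite -!(hmulA HH) ss.
have yq : s ** y ** q ** q = s ** y ** q by rewrite !(hmulA HH) qq.
move: (s ** y ** q) xy'x Ty' sy yq => {Ty xyx} {}y xyx Ty sy yq.
split=> //.
  have [] := qp (x ** y).
  - split; first by rewrite -(hmulA HH) xyx.
    by rewrite T_mul Tx Ty mulZl mulZr scalerA divff ?scale1r.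
  - by rewrite -(hmulA HH) qx.
  - by rewrite (hmulA HH) yq.
  - by move=> xy0; rewrite xy0 mul0v in xyx; rewrite -xyx eqxx in x0.
  by [].
have [] := sp (y ** x).
- split; first by rewrite (hmulA HH) -(hmulA HH x) xyx.
  by rewrite T_mul Tx Ty mulZl mulZr scalerA mulVf ?scale1r.
- by rewrite -(hmulA HH) sy.
- by rewrite (hmulA HH) xs.
- by move=> yx0; rewrite (hmulA HH) yx0 mulv0 in xyx; rewrite -xyx eqxx in x0.
by [].
Qed.

(** For T-fixed idempotents this is the trace of T on the Peirce piece s H t. *)
Definition tst s t : F := tr (fun v => s ** T v ** t).

(** The matrix units identify s H t with q H q. By cyclicity of the trace they move around T, and
    passing T costs their degrees. *)
Lemma tst_unit q s t c c' x y x' y' : q ** q = q ->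
  unitpair q s c x y -> unitpair q t c' x' y' -> tst s t = c' * c^-1 * tst q q.
Proof.
move=> qq [xy yx Tx Ty _] [x'y' y'x' Tx' Ty' _].
have lT := lin_T.
transitivity (tr (fun v => s ** T v ** y' ** x')).
  by apply: eq_tr => v; rewrite -y'x' !(hmulA HH).
rewrite (@tr_cyc _ _ (fun w => w ** x') (fun v => s ** T v ** y')); try by lint.
rewrite (eq_tr (g := fun v => c' *: (y ** (x ** T v ** q)))); last first.
  by move=> v; rewrite T_mul Tx' mulZr mulZr mulZl -x'y' -yx !(hmulA HH).
rewrite trZ (@tr_cyc _ _ (fun w => y ** w) (fun v => x ** T v ** q)); try by lint.
rewrite -mulrA; congr (_ * _); rewrite -trZ; apply: eq_tr => v.
by rewrite T_mul Ty mulZl mulZr mulZl -xy !(hmulA HH).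
Qed.

Lemma exists_homogeneous q s v : q ** v ** s != 0 ->
  exists k : 'I_M, q ** proj (zeta ^- k) v ** s != 0.
Proof.
move=> ne; case: (pickP (fun k : 'I_M => q ** proj (zeta ^- k) v ** s != 0)) => [k|h].
  by exists k.
case/eqP: ne; rewrite -(sum_proj v) (lin_sum _ _ _ (f := fun z => q ** z ** s)); last by lint.
by apply: big1 => k _; apply/eqP/negbFE/h.
Qed.

Lemma T_piece q s k v : T q = q -> T s = s ->
  T (q ** proj (zeta ^- k) v ** s) = zeta ^+ k *: (q ** proj (zeta ^- k) v ** s).
Proof.
move=> Tq Ts; rewrite !T_mul Tq Ts T_proj ?invrK ?mulZr ?mulZl //.
  by rewrite invr_eq0 expf_neq0 // zeta_neq0.
by rewrite exprVn zetaM invr1.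
Qed.

Lemma connected_unit q s v : primitive q -> primitive s -> q ** v ** s != 0 ->
  exists k : 'I_M, exists x y, unitpair q s (zeta ^+ k) x y.
Proof.
move=> pq ps /exists_homogeneous [k ne].
have [_ [qq Tq] _] := pq; have [_ [ss Ts] _] := ps.
exists k, (q ** proj (zeta ^- k) v ** s); apply: primitive_unit => //.
- by rewrite expf_neq0 // zeta_neq0.
- exact: zetaM.
- by rewrite -!(hmulA HH) qq.
- by rewrite (hmulA HH) ss.
- exact: T_piece.
Qed.

(** If q H q has an eigenvector of T with eigenvalue z != 1, it is invertible in the corner and
    [tst_unit] gives tst = z tst, so the trace is 0. Otherwise T is the identity on q H q and the
    trace is its dimension. *)
Lemma tst_nat q : primitive q -> exists d : nat, tst q q = d%:R.
Proof.
move=> pq; have [q0 [qq Tq] _] := pq.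
have q1 : unitpair q q 1 q q by split; rewrite ?invr1 ?scale1r.
case: (Classical_Prop.classic (exists k v, q ** proj (zeta ^- k) v ** q != 0 /\ zeta ^+ k != 1)).
  move=> [k [v [ne nek]]]; exists 0%N.
  have [||||||y up] := @primitive_unit q q (zeta ^+ k) (q ** proj (zeta ^- k) v ** q) pq pq.
  - by rewrite expf_neq0 // zeta_neq0.
  - exact: zetaM.
  - by [].
  - by rewrite -!(hmulA HH) qq.
  - by rewrite (hmulA HH) qq.
  - exact: T_piece.
  have := tst_unit qq q1 up; rewrite invr1 mulr1 => e.
  apply/eqP; move/eqP: e; rewrite -subr_eq0 -{1}[tst q q]mul1r -mulrBl mulf_eq0 subr_eq0.
  by rewrite eq_sym (negbTE nek).
move=> none.
have Tid v : T (q ** v ** q) = q ** v ** q.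
  rewrite -{1 2}(sum_proj v) (lin_sum _ _ _ (f := fun z => q ** z ** q)); last by lint.
  rewrite (lin_sum _ _ _ lin_T); apply: eq_bigr => k _; rewrite T_piece //.
  have [z1|nz] := eqVneq (zeta ^+ k) 1; first by rewrite z1 scale1r.
  have [->|ne] := eqVneq (q ** proj (zeta ^- k) v ** q) 0; first by rewrite scaler0.
  by case: none; exists k, v.
rewrite /tst (eq_tr (g := fun v => q ** v ** q)); last first.
  by move=> v; rewrite -[RHS]Tid !T_mul Tq.
exists (\rank (opmx (fun v => q ** v ** q))); apply: tr_idempotent; first by lint.
by move=> v; rewrite -!(hmulA HH) qq !(hmulA HH) qq.
Qed.

Lemma idem_rank f : f ** f = f -> tr (fun v => f ** v) = (\rank (opmx (fun v => f ** v)))%:R.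
Proof. by move=> ff; apply: tr_idempotent => [|v]; [lint | rewrite -(hmulA HH) ff]. Qed.

Lemma idem_rank0 f : \rank (opmx (fun v => f ** v)) = 0%N -> f = 0.
Proof.
move=> /eqP; rewrite mxrank_eq0 => /eqP e; rewrite -[f](hmulx1 HH).
have := @opmx_inj _ _ (fun v => f ** v) (fun _ => 0); rewrite e; apply; try by lint.
by apply/matrixP=> i j; rewrite !mxE vec0.
Qed.

(** Induction on the rank of left multiplication by f. In characteristic zero additivity of traces
    of idempotents is additivity of ranks, so a proper summand e and its complement f - e both have
    smaller rank. *)
Lemma primitive_decomposition f : idem f ->
  exists2 s : seq vB, (forall e, e \in s -> primitive e) & f = \sum_(e <- s) e.
Proof.
move: {2}_.+1 (ltnSn (\rank (opmx (fun v => f ** v)))) => k.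
elim: k f => // k IH f; rewrite ltnS => fk idf.
have [f0|f0] := eqVneq f 0; first by exists [::]; rewrite ?big_nil.
case: (Classical_Prop.classic (primitive f)) => [pf|npf].
  by exists [:: f] => [e|]; rewrite ?big_seq1 // inE => /eqP ->.
have [e [[ee Te] fe ef e0 nef]] : exists e, [/\ idem e, f ** e = e, e ** f = e, e != 0 & e != f].
  apply: Classical_Prop.NNPP => none; case: npf; split=> // e ide fe ef.
  have [|e0] := eqVneq e 0; first by left.
  have [|ne] := eqVneq e f; first by right.
  by case: none; exists e.
case: idf => ff Tf.
have idfe : idem (f - e).
  split; last by rewrite (linB _ _ lin_T) Tf Te.
  rewrite (linB (f := fun z => (f - e) ** z)); last by lint.
  rewrite !(linB (f := fun z => z ** _)); try by lint.
  by rewrite ff fe ef ee subrr subr0.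
have rk : (\rank (opmx (fun v => f ** v)) =
   \rank (opmx (fun v => e ** v)) + \rank (opmx (fun v => (f - e)%R ** v)))%N.
  have := idem_rank ff; rewrite (eq_tr (g := fun v => e ** v + (f - e) ** v)).
    rewrite trD (idem_rank ee) (idem_rank idfe.1) -natrD => /(natr_inj_char0 charF).
    by move=> ->.
  move=> v; rewrite -(linD (f := fun z => z ** v)) 1?addrC ?subrK //; lint.
have re : (0 < \rank (opmx (fun v => e ** v)))%N.
  by rewrite lt0n; apply: contra_neq e0; apply: idem_rank0.
have rfe : (0 < \rank (opmx (fun v => (f - e)%R ** v)))%N.
  rewrite lt0n; apply: contra_neq nef => /idem_rank0/eqP; rewrite subr_eq0 => /eqP; exact.
have [||s1 p1 e1] := IH e => //.
  by apply: leq_trans fk; rewrite rk -[X in (X < _)%N]addn0 ltn_add2l.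
have [||s2 p2 e2] := IH (f - e) => //.
  by apply: leq_trans fk; rewrite rk -[X in (X < _)%N]add0n ltn_add2r.
exists (s1 ++ s2) => [x|]; first by rewrite mem_cat => /orP[/p1|/p2].
by rewrite big_cat /= -e1 -e2 [RHS]addrC subrK.
Qed.

(* The trace of the finite order automorphism T on the corner f H f is a sum of
   d |sum zeta^k|^2 over the isomorphism classes of primitive summands of f. *)
Lemma corner_trace f : idem f ->
  exists m (r : 'I_m -> 'I_m) (k d : 'I_m -> nat),
    (forall i, k i < M)%N /\
    tst f f = \sum_i \sum_j (r i == r j)%:R * (d (r i))%:R * (zeta ^+ k j * zeta ^- k i).
Proof.
move=> /primitive_decomposition [s ps fs].
pose e (i : 'I_(size s)) := tnth (in_tuple s) i.
have pe i : primitive (e i) by apply: ps; rewrite /e (tnth_nth 0) mem_nth.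
have fe : f = \sum_i e i by rewrite fs big_tnth.
(* The relation e_i H e_j != 0, tested on a basis to make it boolean. On primitive idempotents it is
   an equivalence, because a nonzero piece contains matrix units. *)
pose conn i j := [exists b, e i ** bvec F b ** e j != 0].
have connP i j : reflect (exists v, e i ** v ** e j != 0) (conn i j).
  apply: (iffP existsP) => [[b]|[v ne]]; first by exists (bvec F b).
  case: (pickP (fun b => e i ** bvec F b ** e j != 0)) => [b|h]; first by exists b.
  case/eqP: ne.
  rewrite (lin_expand (f := fun v => e i ** v ** e j)); last by lint.
  by apply: big1 => b _; have /negbFE/eqP -> := h b; rewrite scaler0.
have connI i : conn i i.
  apply/connP; exists one; have [e0 [ee _] _] := pe i.
  by rewrite (hmulx1 HH) ee.
have connU i j : conn i j -> exists k : 'I_M, exists x y, unitpair (e i) (e j) (zeta ^+ k) x y.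
  by move=> /connP [v]; apply: connected_unit.
have eid i : e i ** e i = e i by have [_ []] := pe i.
have connS i j : conn i j -> conn j i.
  move=> /connU [k [x [y [xy _ _ _ [_ _ jy yi]]]]]; apply/connP; exists y.
  have [e0 _ _] := pe i; rewrite jy yi; apply: contra_neq e0 => y0.
  by rewrite -xy y0 mulv0.
have connT i j k : conn i j -> conn j k -> conn i k.
  move=> /connU [a [x [y [xy _ _ _ [ix xj _ _]]]]] /connU [b [x' [y' [x'y' _ _ _ [_ x'k _ _]]]]].
  apply/connP; exists (x ** x'); have [e0 _ _] := pe i.
  rewrite -(hmulA HH) ix (hmulA HH) x'k; apply: contra_neq e0 => h.
  have : x ** x' ** y' ** y = 0 by rewrite h !mul0v.
  by rewrite (hmulA HH x) x'y' xj xy.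
(* A representative of the class of i. As [pick] depends only on the extension of its predicate, r
   is constant on classes; reflexivity excludes the default. *)
pose r i := odflt i [pick q | conn q i].
have rP i : conn (r i) i.
  by rewrite /r; case: pickP => //= h; rewrite -(h i) connI.
have rE i j : conn i j -> r i = r j.
  move=> ij; rewrite /r (eq_pick (Q := conn^~ j)) => [|q].
    by case: pickP => //= h; have := h j; rewrite connI.
  by apply/idP/idP => h; [exact: connT h ij | exact: connT h (connS _ _ ij)].
have [k kP] := fin_all_exists (fun i => connU _ _ (rP i)).
have [d dP] := fin_all_exists (fun i => tst_nat (pe i)).
exists (size s), r, (fun i => k i : nat), d; split=> // {fs ps}.
transitivity (\sum_i \sum_j tst (e i) (e j)).
  rewrite /tst fe (eq_tr (g := fun v => \sum_i \sum_j e i ** T v ** e j)).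
    by rewrite tr_sum; apply: eq_bigr => i _; rewrite tr_sum.
  move=> v; rewrite (lin_sum _ _ _ (f := fun z => z ** T v)); last by lint.
  rewrite (lin_sum _ _ _ (f := fun z => z ** _)); last by lint.
  apply: eq_bigr => i _; rewrite (lin_sum _ _ _ (f := fun z => _ ** z)) //; lint.
apply: eq_bigr => i _; apply: eq_bigr => j _.
have [rij|nr] := eqVneq (r i) (r j); last first.
  rewrite !mul0r /tst (eq_tr (g := fun _ => 0)).
    by rewrite /tr big1 // => b _; rewrite vec0.
  move=> v; apply/eqP; apply: contraNT nr => ne; apply/eqP; apply: rE.
  by apply/connP; exists (T v).
have [x [y up]] := kP i; have [x' [y' up']] := kP j.
rewrite rij in up; rewrite (tst_unit (eid _) up up') dP rij mul1r.
by rewrite mulrC.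
Qed.

(** The integral l is a central idempotent fixed by T and contributes phi(l) = 1 to the trace of T;
    the rest is the corner of 1 - l. *)
Lemma phi_one_corner : exists m (r : 'I_m -> 'I_m) (k d : 'I_m -> nat),
    (forall i, k i < M)%N /\
    phi H one = 1 + \sum_i \sum_j (r i == r j)%:R * (d (r i))%:R * (zeta ^+ k j * zeta ^- k i).
Proof.
have ll : l ** l = l by rewrite (int_l hl) (int_eps hl) scale1r.
have Tl : T l = l by rewrite /T !(int_S HH hl).
have idf : idem (one - l).
  split; last by rewrite (linB _ _ lin_T) T_one Tl.
  rewrite (linB (f := fun z => (one - l) ** z)); last by lint.
  rewrite !(linB (f := fun z => z ** _)); try by lint.
  by rewrite !(hmulx1 HH) (hmul1x HH) ll subrr subr0.
have [m [r [k [d [kM e]]]]] := corner_trace idf.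
exists m, r, k, d; split=> //; rewrite -e -(phi_int HH hl) /tst /phi -trD.
apply: eq_tr => v; rewrite -/(T v) (hmul1x HH) (int_r HH hl).
rewrite (linB (f := fun z => (one - l) ** T v ** z)); last by lint.
rewrite !(linB (f := fun z => z ** T v)); try by lint.
rewrite !(linB (f := fun z => z ** _)); try by lint.
rewrite !(hmulx1 HH) (hmul1x HH) (int_r HH hl) mulZl ll (int_l hl) subrr subr0.
by rewrite addrC subrK.
Qed.

End Positivity.

(** * Primitive roots of unity and transfer to the algebraic numbers *)

Lemma exists_irreducible_factor (F : fieldType) (p : {poly F}) :
  (1 < size p)%N -> exists2 q, irreducible_poly q & q %| p.
Proof.
move: {2}_.+1 (ltnSn (size p)) => k; elim: k p => // k IH p; rewrite ltnS => pk p1.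
(* Irreducibility over an arbitrary field is not decidable, hence the classical case distinction. *)
case: (Classical_Prop.classic (irreducible_poly p)) => [ip|nip]; first by exists p.
have [q [q1 qp nqp]] : exists q : {poly F}, [/\ size q != 1%N, q %| p & ~~ (q %= p)].
  apply: Classical_Prop.NNPP => none; case: nip; split=> // q q1 qp.
  by apply/negPn/negP => nqp; case: none; exists q.
have p0 : p != 0 by rewrite -size_poly_gt0 (ltnW p1).
have q0 : q != 0 by apply: contraTneq qp => ->; rewrite dvd0p.
have qlt : (size q < size p)%N.
  by rewrite ltn_neqAle (dvdp_leq p0 qp) andbT dvdp_size_eqp.
have [||r ir rq] := IH q.
- exact: leq_trans qlt pk.
- by rewrite ltn_neqAle eq_sym q1 size_poly_gt0.
by exists r => //; apply: dvdp_trans rq qp.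
Qed.

Section CyclotomicRoots.
Variable L : fieldType.
Local Notation pZ := (map_poly (intr : int -> L)).

Lemma XnsubC_Phi m : (0 < m)%N -> 'X^m - 1 = \prod_(d <- divisors m) pZ 'Phi_d.
Proof.
move=> m0; rewrite -rmorph_prod prod_Cyclotomic //.
by rewrite rmorphB /= map_polyXn rmorph1.
Qed.

Lemma root_Phi_expr m z : (0 < m)%N -> root (pZ 'Phi_m) z -> z ^+ m = 1.
Proof.
move=> m0 rz; apply/eqP; rewrite -subr_eq0.
have -> : z ^+ m - 1 = ('X^m - 1).[z] by rewrite !hornerE.
rewrite XnsubC_Phi // -/(root _ z) (big_rem m) /=; last by rewrite -dvdn_divisors.
by rewrite rootM rz.
Qed.

Lemma prim_root_Phi m z : m.-primitive_root z -> root (pZ 'Phi_m) z.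
Proof.
move=> pz; have m0 := prim_order_gt0 pz.
have : root ('X^m - 1) z by rewrite rootE !hornerE (prim_expr_order pz) subrr.
rewrite XnsubC_Phi // -big_filter; have : all (fun d => d %| m)%N (divisors m).
  by apply/allP=> d; rewrite -dvdn_divisors.
rewrite big_filter; elim: (divisors m) => [_|d s IH /= /andP[dm sm]].
  by rewrite big_nil rootE hornerE oner_eq0.
rewrite big_cons rootM => /orP[rd|]; last exact: IH.
have d0 := dvdn_gt0 m0 dm.
have : (m %| d)%N by rewrite (prim_order_dvd pz) (root_Phi_expr d0 rd).
by move=> md; have -> : m = d by apply/eqP; rewrite eqn_dvd dm md.
Qed.

End CyclotomicRoots.

(** Adjoin a root of an irreducible factor of the cyclotomic polynomial. In characteristic zero X^m
    - 1 is separable, which excludes that this root has smaller order. *)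
Lemma exists_prim_root_ext (F : fieldType) m : [pchar F] =i pred0 -> (0 < m)%N ->
  exists (L : fieldExtType F) (z : L), m.-primitive_root z.
Proof.
move=> charF m0.
have szP : (1 < size (map_poly (intr : int -> F) 'Phi_m))%N.
  rewrite size_map_poly_id0 ?size_Cyclotomic ?ltnS ?totient_gt0 //.
  by rewrite (monicP (Cyclotomic_monic m)) oner_eq0.
have [p ip pP] := exists_irreducible_factor szP.
have [L _ [z rz _]] := irredp_FAdjoin ip.
exists L, z.
have charL : [pchar L] =i pred0 by move=> q; rewrite (fmorph_pchar (in_alg L)) charF.
have rP : root (map_poly (intr : int -> L) 'Phi_m) z.
  have -> : map_poly (intr : int -> L) 'Phi_m = map_poly (in_alg L) (map_poly intr 'Phi_m).
    by rewrite -map_poly_comp; apply: eq_map_poly => c; rewrite [RHS](rmorph_int (in_alg L)).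
  have [q ->] := dvdpP _ _ pP.
  by rewrite rmorphM rootM rz orbT.
have [d pd dm] := prim_order_exists m0 (root_Phi_expr m0 rP).
have [<- //|ne] := eqVneq d m.
(* otherwise z is a double root of X^m - 1 *)
have rd := prim_root_Phi pd.
have e := XnsubC_Phi L m0.
rewrite (big_rem m) /= in e; last by rewrite -dvdn_divisors.
rewrite (big_rem d) /= in e; last by rewrite mem_rem_uniq ?divisors_uniq // inE ne -dvdn_divisors.
have := congr1 (fun q => q^`().[z]) e.
rewrite derivB derivXn derivC subr0 !derivM !hornerE.
move: rP rd; rewrite !rootE => /eqP -> /eqP ->.
rewrite /= !(mul0r, mulr0, addr0, add0r) => /eqP.
rewrite hornerMn hornerXn -mulr_natl mulf_eq0 expf_eq0.
have /pcharf0P -> := charL; rewrite (gtn_eqF m0) /= => /andP[_ /eqP z0].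
have := prim_expr_order pd; rewrite z0 expr0n (gtn_eqF (prim_order_gt0 pd)).
by move=> /esym/eqP; rewrite oner_eq0.
Qed.

(** The resultant of ['Phi_m] and Q is an integer combination of both, so it vanishes at z and hence
    in Z. The two polynomials then have a nonconstant common divisor over Z, and any complex root w
    of it is a primitive root of unity killed by Q. *)
Lemma transfer_root (L : fieldType) m (z : L) (Q : {poly int}) :
  [pchar L] =i pred0 -> m.-primitive_root z -> root (map_poly intr Q) z ->
  exists2 w : algC, m.-primitive_root w & root (map_poly intr Q) w.
Proof.
move=> charL pz rQ; have m0 := prim_order_gt0 pz.
have intr0 (c : int) : c%:~R = 0 :> L -> c = 0.
  have /pcharf0P p0 := charL.
  case: c => k /eqP; first by rewrite -pmulrn p0 => /eqP ->.
  by rewrite NegzE mulrNz oppr_eq0 -pmulrn p0.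
have [w0 pw0] := C_prim_root_exists m0.
have [szQ|szQ] := leqP (size Q) 1.
  (* A constant Q with a root in characteristic zero is 0, so any primitive root serves. *)
  exists w0 => //; move: rQ; rewrite (size1_polyC szQ) map_polyC /= rootC.
  by move=> /eqP/intr0 ->; rewrite map_polyC /= rootC.
have szP : (1 < size 'Phi_m)%N by rewrite size_Cyclotomic ltnS totient_gt0.
have res0 : resultant 'Phi_m Q = 0.
  have [[u v] _ /= e] := resultant_in_ideal szP szQ.
  apply: intr0; have := congr1 (fun p => (map_poly (intr : int -> L) p).[z]) e.
  rewrite map_polyC hornerC /= => ->; rewrite rmorphD !rmorphM !hornerE.
  have /eqP -> := prim_root_Phi pz; move/eqP: rQ => ->.
  by rewrite !mulr0 addr0.
move/eqP: res0; rewrite resultant_eq0; set g := gcdp _ _ => szg.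
have injC : injective (intr : int -> algC) by exact: intr_inj.
have szgC : size (map_poly (intr : int -> algC) g) = size g by apply: size_map_inj_poly.
have [|w rw] := closed_rootP (map_poly (intr : int -> algC) g) _.
  by rewrite szgC; apply: contraTneq szg => ->.
have dv (p : {poly int}) : g %| p -> root (map_poly (intr : int -> algC) p) w.
  move=> /Pdiv.Idomain.dvdpP [[c q] /= c0 e].
  have := congr1 (fun p => (map_poly (intr : int -> algC) p).[w]) e.
  rewrite rmorphM map_polyZ !hornerE; move/eqP: rw => -> /eqP.
  by rewrite mulr0 mulf_eq0 intr_eq0 (negbTE c0).
exists w; last exact/dv/dvdp_gcdr.
rewrite -(root_cyclotomic pw0) -(Cintr_Cyclotomic pw0).
exact/dv/dvdp_gcdl.
Qed.

(** On the unit circle inversion is conjugation; grouping the indices by their class leaves weighted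
    squared absolute values. *)
Lemma weighted_norms_ge0 M (w : algC) m (r : 'I_m -> 'I_m) (k d : 'I_m -> nat) :
  M.-primitive_root w ->
  0 <= \sum_i \sum_j (r i == r j)%:R * (d (r i))%:R * (w ^+ k j * w ^- k i).
Proof.
move=> pw.
have wV i : w ^- k i = (w ^+ k i)^*.
  have nw : `|w| = 1.
    apply/eqP; rewrite -(@pexpr_eq1 _ _ M) ?(prim_order_gt0 pw) // -normrX.
    by rewrite (prim_expr_order pw) normr1.
  by rewrite invC_norm normrX nw !expr1n invr1 mul1r.
rewrite (partition_big r xpredT) //=; apply: sumr_ge0 => q _.
rewrite (eq_bigr (fun i => (d q)%:R * (w ^+ k i)^* *
     \sum_(j | r j == q) w ^+ k j)) => [|i /eqP ri].
  rewrite -mulr_suml -mulr_sumr -rmorph_sum /= -mulrA [_^* * _]mulrC -normCK.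
  by rewrite mulr_ge0 ?ler0n ?exprn_ge0.
rewrite mulr_sumr [RHS]big_mkcond; apply: eq_bigr => j _; rewrite ri eq_sym wV.
case: (_ == _); last by rewrite !mul0r.
by rewrite mul1r -mulrA [_^* * _]mulrC.
Qed.

(** * Extension of scalars *)

Section BaseChange.
Variables (F L : fieldType) (io : {rmorphism F -> L}).

Definition mv (B : finType) (x : vec F B) : vec L B := [ffun b => io (x b)].

Section Vectors.
Variable B : finType.

Lemma mvE (x : vec F B) b : mv x b = io (x b). Proof. by rewrite ffunE. Qed.

Lemma mvD (x y : vec F B) : mv (x + y) = mv x + mv y.
Proof. by apply/ffunP=> b; rewrite mvE !vecD rmorphD !mvE. Qed.

Lemma mvZ a (x : vec F B) : mv (a *: x) = io a *: mv x.
Proof. by apply/ffunP=> b; rewrite mvE !vecZ rmorphM !mvE. Qed.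

Lemma mv_sum (I : Type) (s : seq I) (X : I -> vec F B) :
  mv (\sum_(i <- s) X i) = \sum_(i <- s) mv (X i).
Proof.
apply: (big_morph (@mv B) mvD).
by apply/ffunP=> b; rewrite mvE !vec0 rmorph0.
Qed.

Lemma mv_b (b : B) : mv (bvec F b) = bvec L b.
Proof. by apply/ffunP=> c; rewrite mvE !bvecE rmorph_nat. Qed.

End Vectors.

Lemma mv_tens (A B : finType) (x : vec F A) (y : vec F B) : mv (tens x y) = tens (mv x) (mv y).
Proof. by apply/ffunP=> p; rewrite mvE !tensE rmorphM !mvE. Qed.

Lemma mv_linext (B C : finType) (g : B -> vec F C) (g' : B -> vec L C) x :
  (forall b, mv (g b) = g' b) -> mv (linext g x) = linext g' (mv x).
Proof.
by move=> e; rewrite mv_sum; apply: eq_bigr => b _; rewrite mvZ e mvE.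
Qed.

Lemma mv_linext2 (A B C : finType) (g : A -> B -> vec F C) (g' : A -> B -> vec L C) x y :
  (forall a b, mv (g a b) = g' a b) -> mv (linext2 g x y) = linext2 g' (mv x) (mv y).
Proof.
move=> e; rewrite mv_sum; apply: eq_bigr => a _; rewrite mv_sum.
by apply: eq_bigr => b _; rewrite mvZ e rmorphM !mvE.
Qed.

Variables (n : nat) (H : hopfData F n).
Hypothesis HH : isHopf H.

Definition mapH : hopfData L n :=
  HopfData (fun i j k => io (hm H i j k)) (fun i => io (hu H i))
    (fun i j k => io (hc H i j k)) (fun i => io (he H i)) (fun i j => io (hs H i j)).

Lemma mv_mkv (B : finType) (f : B -> F) (g : B -> L) :
  (forall b, io (f b) = g b) -> mv (mkv f) = mkv g.
Proof. by move=> e; apply/ffunP=> b; rewrite mvE !mkvE. Qed.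

Lemma mv_mulH x y : mv (mulH H x y) = mulH mapH (mv x) (mv y).
Proof. by apply: mv_linext2 => i j; apply: mv_mkv. Qed.

Lemma mv_oneH : mv (oneH H) = oneH mapH.
Proof. exact: mv_mkv. Qed.

Lemma mv_DeltaH x : mv (DeltaH H x) = DeltaH mapH (mv x).
Proof. by apply: mv_linext => i; apply: mv_mkv. Qed.

Lemma mv_SH x : mv (SH H x) = SH mapH (mv x).
Proof. by apply: mv_linext => i; apply: mv_mkv. Qed.

Lemma mv_epsH x : io (epsH H x) = epsH mapH (mv x).
Proof. by rewrite rmorph_sum; apply: eq_bigr => i _; rewrite rmorphM mvE. Qed.

Lemma mv_mulHH s t : mv (mulHH H s t) = mulHH mapH (mv s) (mv t).
Proof. by apply: mv_linext2 => p q; rewrite mv_tens !mv_mulH !mv_b. Qed.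

Lemma mv_sw x (g : vec F 'I_n -> vec F 'I_n -> vec F 'I_n) g' :
  (forall i j, mv (g (bvec F i) (bvec F j)) = g' (bvec L i) (bvec L j)) ->
  mv (sw2 (DeltaH H) x g) = sw2 (DeltaH mapH) (mv x) g'.
Proof.
move=> e; rewrite mv_sum; apply: eq_bigr => p _.
by rewrite mvZ -mv_DeltaH mvE e.
Qed.

Lemma lin_DeltaHp (p : 'I_n * 'I_n) :
  lin ((fun x => DeltaH mapH x p) : vec L 'I_n -> L^o).
Proof. by move=> a x y; rewrite (lin_DeltaH mapH (@lin_id _ _)) vecD vecZ. Qed.

(** Every axiom is a multilinear identity, so it suffices to test it on basis vectors, where it is
    the image under [io] of the axiom over F. *)
Lemma mapH_isHopf : isHopf mapH.
Proof.
have lD := lin_DeltaHp.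
have DE i : DeltaH mapH (bvec L i) = mv (DeltaH H (bvec F i)) by rewrite mv_DeltaH mv_b.
split.
- split=> [x y z|x].
    apply: (eq_on_basis (f := fun x => mulH mapH (mulH mapH x y) z)
      (g := fun x => mulH mapH x (mulH mapH y z))); try by lint.
    move=> i.
    apply: (eq_on_basis (f := fun y => mulH mapH (mulH mapH (bvec L i) y) z)
      (g := fun y => mulH mapH (bvec L i) (mulH mapH y z))); try by lint.
    move=> j.
    apply: (eq_on_basis (f := fun z => mulH mapH (mulH mapH (bvec L i) (bvec L j)) z)
      (g := fun z => mulH mapH (bvec L i) (mulH mapH (bvec L j) z))); try by lint.
    by move=> k; rewrite -!mv_b -!mv_mulH (hmulA HH).
  split.
    apply: (eq_on_basis (f := fun x => mulH mapH (oneH mapH) x) (g := id)); try by lint.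
    by move=> i; rewrite -mv_b -mv_oneH -mv_mulH (hmul1x HH).
  apply: (eq_on_basis (f := fun x => mulH mapH x (oneH mapH)) (g := id)); try by lint.
  by move=> i; rewrite -mv_b -mv_oneH -mv_mulH (hmulx1 HH).
- move=> x; apply/ffunP=> t; rewrite !mkvE.
  apply: (eq_on_basis (W := L^o)
    (f := fun x => \sum_p DeltaH mapH x (p, t.2) * DeltaH mapH (bvec L p) t.1)
    (g := fun x => \sum_p DeltaH mapH x (t.1.1, p) * DeltaH mapH (bvec L p) (t.1.2, t.2))).
  + by apply: lin_bigsum => p; apply: lin_mulFr.
  + by apply: lin_bigsum => p; apply: lin_mulFr.
  move=> i; case: HH => _ h _ _ _; move/ffunP: (h (bvec F i)) => /(_ t).
  rewrite !mkvE => /(congr1 io); rewrite !rmorph_sum /= => e.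
  rewrite (eq_bigr _ (fun p _ => _ : _ = io (DeltaH H (bvec F i) (p, t.2) * DeltaH H (bvec F p) t.1))).
    rewrite e; apply: eq_bigr => p _.
    by rewrite !DE !mvE rmorphM.
  by move=> p; rewrite !DE !mvE rmorphM.
- move=> x; split; apply/ffunP=> j; rewrite mkvE.
    apply: (eq_on_basis (W := L^o)
      (f := fun x => \sum_i DeltaH mapH x (i, j) * he mapH i) (g := fun x => x j)).
    + by apply: lin_bigsum => p; apply: lin_mulFr.
    + exact: lin_coord.
    move=> i; case: HH => _ _ h _ _; case: (h (bvec F i)) => /ffunP/(_ j) + _.
    rewrite mkvE => /(congr1 io); rewrite -mvE mv_b => <-.
    by rewrite rmorph_sum; apply: eq_bigr => p _; rewrite DE mvE rmorphM.
  apply: (eq_on_basis (W := L^o)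
    (f := fun x => \sum_i DeltaH mapH x (j, i) * he mapH i) (g := fun x => x j)).
  + by apply: lin_bigsum => p; apply: lin_mulFr.
  + exact: lin_coord.
  move=> i; case: HH => _ _ h _ _; case: (h (bvec F i)) => _ /ffunP/(_ j).
  rewrite mkvE => /(congr1 io); rewrite -mvE mv_b => <-.
  by rewrite rmorph_sum; apply: eq_bigr => p _; rewrite DE mvE rmorphM.
- have lDl x : lin (DeltaH mapH : vec L 'I_n -> _) := lin_DeltaH mapH (@lin_id _ _).
  split; last first.
    case: HH => _ _ _ [_ [h1 h2]] _; split.
      by rewrite -mv_oneH -mv_DeltaH h1 mv_tens.
    by rewrite -mv_oneH -mv_epsH h2 rmorph1.
  move=> x y; split.
    apply: (eq_on_basis (f := fun x => DeltaH mapH (mulH mapH x y))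
      (g := fun x => mulHH mapH (DeltaH mapH x) (DeltaH mapH y))).
    + by apply: lin_DeltaH; lint.
    + by apply: (lin_comp (lin_linext2l _ _)); apply: lin_DeltaH; lint.
    move=> i.
    apply: (eq_on_basis (f := fun y => DeltaH mapH (mulH mapH (bvec L i) y))
      (g := fun y => mulHH mapH (DeltaH mapH (bvec L i)) (DeltaH mapH y))).
    + by apply: lin_DeltaH; lint.
    + by apply: (lin_comp (lin_linext2r _ _)); apply: lin_DeltaH; lint.
    move=> j; rewrite -!mv_b -mv_mulH -!mv_DeltaH -mv_mulHH.
    by case: HH => _ _ _ [h _] _; case: (h (bvec F i) (bvec F j)) => ->.
  apply: (eq_on_basis (W := L^o) (f := fun x => epsH mapH (mulH mapH x y))
     (g := fun x => epsH mapH x * epsH mapH y)); try by lint.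
  move=> i.
  apply: (eq_on_basis (W := L^o) (f := fun y => epsH mapH (mulH mapH (bvec L i) y))
     (g := fun y => epsH mapH (bvec L i) * epsH mapH y)); try by lint.
  by move=> j; rewrite -!mv_b -mv_mulH -!mv_epsH (eps_mul HH) rmorphM.
- move=> x; split.
    apply: (eq_on_basis (f := fun x => sw2 (DeltaH mapH) x (fun a b => mulH mapH (SH mapH a) b))
      (g := fun x => epsH mapH x *: oneH mapH)); try by lint.
    move=> i; rewrite -mv_b -mv_epsH -mv_oneH -mvZ.
    case: HH => _ _ _ _ h; case: (h (bvec F i)) => <- _.
    by symmetry; apply: mv_sw => a b; rewrite mv_mulH mv_SH !mv_b.
  apply: (eq_on_basis (f := fun x => sw2 (DeltaH mapH) x (fun a b => mulH mapH a (SH mapH b)))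
      (g := fun x => epsH mapH x *: oneH mapH)); try by lint.
  move=> i; rewrite -mv_b -mv_epsH -mv_oneH -mvZ.
  case: HH => _ _ _ _ h; case: (h (bvec F i)) => _ <-.
  by symmetry; apply: mv_sw => a b; rewrite mv_mulH mv_SH !mv_b.
Qed.

Lemma mv_integral l : integral H l -> integral mapH (mv l).
Proof.
move=> [hl el]; split; last by rewrite -mv_epsH el rmorph1.
move=> a; apply: (eq_on_basis (f := fun a => mulH mapH a (mv l))
   (g := fun a => epsH mapH a *: mv l)); try by lint.
by move=> i; rewrite -mv_b -mv_mulH hl mvZ mv_epsH.
Qed.

Lemma mv_phi x : io (phi H x) = phi mapH (mv x).
Proof.
rewrite rmorph_sum; apply: eq_bigr => i _.
by rewrite -mvE mv_mulH !mv_SH mv_b.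
Qed.

End BaseChange.

Lemma comm_idem (X : Type) (f g : X -> X) : (forall x, f (f x) = f x) ->
  (forall x, g (g x) = g x) -> (forall x, f (g x) = g (f x)) ->
  forall x, f (g (f (g x))) = f (g x).
Proof. by move=> ff gg fg x; rewrite -fg ff gg. Qed.

(** * The squared antipode is the identity *)

Section LarsonRadford.
Variables (F : fieldType) (n : nat) (H : hopfData F n).
Hypothesis charF : [pchar F] =i pred0.
Hypothesis HH : isHopf H.
Local Notation vB := (vec F 'I_n).
Local Notation "x ** y" := (mulH H x y) (at level 40, left associativity).
Local Notation S := (SH H).
Local Notation eps := (epsH H).
Local Notation one := (oneH H).
Local Notation sw x g := (sw2 (DeltaH H) x g).

(** The kernel U of the counit is a left ideal. For a complement W let w be the W-component of 1:
    its counit is 1, and each x w - eps(x) w lies in both U and W, hence is 0. *)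
Lemma semisimple_integral : semisimpleH H -> exists l, integral H l.
Proof.
move=> ss; pose e : 'cV[F]_n := \col_i he H i.
pose U := kermx e.
have epsv (v : 'rV[F]_n) : (v *m e) 0 0 = eps (mkv (fun i => v 0 i)).
  by rewrite mxE; apply: eq_bigr => i _; rewrite mxE mkvE.
have mulv i (v : 'rV[F]_n) : mkv (fun k => (v *m Lmat H i) 0 k) = bvec F i ** mkv (fun k => v 0 k).
  rewrite (lin_expand (f := fun z => bvec F i ** z)); last by lint.
  apply/ffunP=> k; rewrite mkvE mxE vec_sum; apply: eq_bigr => j _.
  by rewrite vecZ mkvE mulHb mxE.
have Le i : Lmat H i *m e = he H i *: e.
  apply/matrixP=> j k; rewrite !mxE -(epsb H i) -(epsb H j) -(eps_mul HH).
  by apply: eq_bigr => p _; rewrite !mxE mulHb.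
have lU : leftIdeal H U.
  by move=> i; apply/sub_kermxP; rewrite -mulmxA Le -scalemxAr mulmx_ker scaler0.
have [W [lW UW UWT]] := ss U lU.
pose u : 'rV[F]_n := \row_i hu H i.
have /sub_addsmxP [[u1 u2] /= eu] : (u <= U + W)%MS by apply: submx_trans UWT; apply: submx1.
have uE : mkv (fun k => u 0 k) = one by apply/ffunP=> k; rewrite !mkvE mxE.
pose w := u2 *m W.
have ew : (w *m e) 0 0 = 1.
  have : (u *m e) 0 0 = 1 by rewrite epsv uE (eps_one HH).
  by rewrite eu mulmxDl -mulmxA mulmx_ker mulmx0 add0r.
exists (mkv (fun k => w 0 k)); split; last by rewrite -epsv.
move=> a; apply: (eq_on_basis (f := fun a => a ** mkv (fun k => w 0 k))
  (g := fun a => eps a *: mkv (fun k => w 0 k))); try by lint.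
move=> i; rewrite -mulv epsb.
suff /eqP : w *m Lmat H i - he H i *: w == 0.
  move/eqP; rewrite subr_eq0 => /eqP ->; apply/ffunP=> k.
  by rewrite vecZ !mkvE mxE.
rewrite -submx0; apply: submx_trans UW; rewrite sub_capmx; apply/andP; split.
  apply/sub_kermxP; rewrite mulmxBl -mulmxA Le -scalemxAr -scalemxAl subrr //.
apply: addmx_sub.
  by rewrite /w -mulmxA; apply: submx_trans (submxMl _ _) (lW i).
by rewrite -scaleNr; apply: scalemx_sub; apply: submxMl.
Qed.

Variable l : vB.
Hypothesis hl : integral H l.

(* phi 1 = tr S^2 is 1 plus a corner trace, a fixed integer polynomial in a primitive
   root of unity; its vanishing would transfer to algC, where the corner trace is
   a nonnegative real number. *)
Lemma phi_one_neq0 : phi H one != 0.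
Proof.
have [M M0 TM] := S2_finite_order HH hl.
have [L [z pz]] := exists_prim_root_ext charF M0.
pose io : {rmorphism F -> L} := in_alg L.
have charL : [pchar L] =i pred0 by move=> q; rewrite (fmorph_pchar io) charF.
have HH' := mapH_isHopf io HH; have hl' := mv_integral io hl.
pose T' y := SH (mapH io H) (SH (mapH io H) y).
have TM' x : iter M T' x = x.
  apply: (eq_on_basis (f := iter M T') (g := id)).
  - by apply: lin_iter; rewrite /T'; lint.
  - exact: lin_id.
  move=> b; rewrite -(mv_b io b).
  have -> m y : iter m T' (mv io y) = mv io (iter m (fun y => S (S y)) y).
    by elim: m => //= m ->; rewrite /T' !mv_SH.
  by rewrite TM.
have [m [r [k [d [kM e]]]]] := phi_one_corner charL HH' hl' M0 TM' pz.
(* A polynomial with integer coefficients has no negative powers: since w^M = 1 and k i < M, the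
   factor w^-(k i) is written w^(M - k i). *)
pose Q : {poly int} := 1 + \sum_i \sum_j
  ((r i == r j)%:R * (d (r i))%:R) *: 'X^(k j + (M - k i)).
have QE (K : fieldType) (w : K) : M.-primitive_root w -> (map_poly intr Q).[w] =
    1 + \sum_i \sum_j (r i == r j)%:R * (d (r i))%:R * (w ^+ k j * w ^- k i).
  move=> pw; have w0 : w != 0.
    apply/eqP=> w0; have := prim_expr_order pw.
    by rewrite w0 expr0n (gtn_eqF M0) => /esym/eqP; rewrite oner_eq0.
  rewrite rmorphD rmorph1 hornerD hornerC; congr (_ + _).
  rewrite rmorph_sum horner_sum; apply: eq_bigr => i _.
  rewrite rmorph_sum horner_sum; apply: eq_bigr => j _.
  rewrite /= map_polyZ hornerZ map_polyXn hornerXn rmorphM /= !rmorph_nat.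
  congr (_ * _); rewrite exprD; congr (_ * _).
  by rewrite exprB ?unitfE ?(ltnW (kM i)) // (prim_expr_order pw) mul1r.
apply/eqP=> t0; have rQ : root (map_poly intr Q) z.
  by rewrite rootE (QE _ _ pz) -e -mv_oneH -mv_phi t0 rmorph0.
have [w pw] := transfer_root charL pz rQ.
rewrite rootE (QE _ _ pw) => /eqP e0.
have := weighted_norms_ge0 r k d pw.
by move/(ltr_pwDl ltr01); rewrite e0 ltxx.
Qed.

(** At h = 1 the defining property of the distinguished grouplike reads phi(1) 1 = phi(1) gl, and
    phi(1) = tr S^2 may be cancelled. *)
Lemma gl_one : gl H l = one.
Proof.
have := phi_gl HH hl one; rewrite (sw_one HH); last by split; have := lin_phi H; lint.
by move=> /(scalerI phi_one_neq0).
Qed.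

Lemma S4_id x : S (S (S (S x))) = x.
Proof.
by have := S4 HH hl x; rewrite gl_one (S_one HH) (hmul1x HH) (hmulx1 HH).
Qed.

Let T x := S (S x).
Let lT : lin T. Proof. by rewrite /T; lint. Qed.

Lemma chi_T x : chi H (T x) = chi H x.
Proof.
rewrite /chi (eq_tr (g := fun y => T (x ** T y))).
  rewrite (@tr_cyc _ _ T (fun y => x ** T y)) //; last by lint.
  by apply: eq_tr => y; rewrite /T S4_id.
by move=> y; rewrite /T !(S_mul HH) S4_id.
Qed.

Lemma dual_trace c : phi (dualH H) c = tr (fun x => sw x (fun a b => pairing c a *: T b)).
Proof.
apply: eq_bigr => i _.
rewrite -[mulH _ _ _]/(mulHd H c (SHd H (SHd H (bvec F i)))) -[LHS]pairing_b pairing_mulHd.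
rewrite -[RHS]pairing_b pairingC.
rewrite (sw_lin (W' := F^o) (f := fun z => pairing (bvec F i) z)); last by lint.
apply: (eq_sw (W := F^o)) => a b.
by rewrite !pairing_SHd (linZ (W := F^o) (f := fun z => pairing (bvec F i) z)) //; lint.
Qed.

(** By [phi_integral] for the dual, its trace form is an integral of the bidual, that is of H, hence
    a multiple of l. The factor is its counit, the trace of S^2. *)
Lemma dual_trace_int c : phi (dualH H) c = phi H one * pairing c l.
Proof.
pose lt : vB := [ffun i => phi (dualH H) (bvec F i)].
have lE c' : phi (dualH H) c' = pairing c' lt.
  rewrite (lin_expand c' (lin_phi (dualH H))).
  by apply: eq_bigr => i _; rewrite ffunE.
have hlt x : x ** lt = eps x *: lt.
  apply: pairing_injr => d; rewrite pairing_mulH.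
  have := congr1 (fun z => pairing z x) (phi_integral (dual_isHopf HH) d).
  rewrite (sw_lin (W' := F^o) (f := fun z => pairing z x)); last by lint.
  rewrite (linZ (W := F^o) (f := fun z => pairing z x)); last by lint.
  rewrite -[oneH _]/(oneHd H) pairing_oneHd.
  rewrite (linZ (W := F^o) (f := fun z => pairing d z)); last by lint.
  rewrite -lE /GRing.scale /= [RHS]mulrC => <-.
  apply: (eq_sw (H := dualH H) (W := F^o)) => a b.
  by rewrite (linZ (W := F^o) (f := fun z => pairing z x)) -?lE 1?mulrC //; lint.
have -> : phi H one = eps lt.
  rewrite -pairing_oneHd -lE dual_trace; apply: eq_tr => x.
  rewrite (hmul1x HH) -/(T x) -[LHS](sw_counitl HH (g := T)) //.
  by apply: eq_sw => a b; rewrite pairing_oneHd.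
have e : lt = eps lt *: l.
  by rewrite -(int_r HH hl) hlt (int_eps hl) scale1r.
by rewrite lE {1}e (linZ (W := F^o) (f := fun z => pairing c z)) //; lint.
Qed.

Lemma n_neq0 : (n%:R : F) != 0.
Proof.
have /pcharf0P -> := charF; apply/eqP=> n0.
have : eps one = 0 by apply: big1 => i; have := leq_ltn_trans (leq0n i) (ltn_ord i); move/lt0n_neq0/eqP.
by rewrite (eps_one HH) => /eqP; rewrite oner_eq0.
Qed.

(** The element chi/n of the dual is idempotent by [chi_chi]; P is its action on H. *)
Let P x : vB := n%:R^-1 *: sw x (fun a b => chi H a *: b).
Let lchi := lin_chi H.
Let lP : lin P. Proof. by rewrite /P; lint. Qed.

Lemma P_idem x : P (P x) = P x.
Proof.
rewrite /P (linZ _ _ (f := fun z => sw z _)); last by lint.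
congr (_ *: _); rewrite (sw_lin (f := fun z => sw z (fun a b => chi H a *: b))); last by lint.
transitivity (n%:R^-1 *: sw x (fun a b => sw b (fun b1 b2 => (chi H a * chi H b1) *: b2))).
  congr (_ *: _); apply: eq_sw => a b.
  rewrite (linZ _ _ (f := fun z => sw z _)); last by lint.
  by rewrite -sw_scale; apply: eq_sw => b1 b2; rewrite scalerA.
rewrite -(sw_coassoc HH) -sw_scale; apply: eq_sw => a b.
rewrite -(sw_lin (W := F^o) (f := fun s => s *: b)); last by lint.
by rewrite (chi_chi HH) scalerA mulKf // n_neq0.
Qed.

Lemma P_S2 x : P (T x) = T (P x).
Proof.
rewrite /P (linZ _ _ lT) (sw_S2 HH); last by split; lint.
rewrite (sw_lin _ _ lT); congr (_ *: _); apply: eq_sw => a b.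
by rewrite (linZ _ _ lT) -/(T a) chi_T.
Qed.

(** n P T is x |-> chi(x_(1)) T(x_(2)), whose trace is the trace form of the dual at chi, that is
    tr(T) chi(l); and chi(l) = 1 because left multiplication by l has rank one. *)
Lemma tr_P_S2 : n%:R * tr (fun x => P (T x)) = tr T.
Proof.
have -> : tr T = phi H one by apply: eq_tr => x; rewrite (hmul1x HH).
rewrite (eq_tr (g := fun x => n%:R^-1 *: sw x (fun a b => chi H a *: T b))).
  rewrite trZ mulrA divff ?mul1r ?n_neq0 //.
  pose c : vB := [ffun i => chi H (bvec F i)].
  have cE x : pairing c x = chi H x.
    rewrite pairingC (lin_expand x lchi).
    by apply: eq_bigr => i _; rewrite ffunE.
  rewrite (eq_tr (g := fun x => sw x (fun a b => pairing c a *: T b))); last first.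
    by move=> x; apply: eq_sw => a b; rewrite cE.
  rewrite -dual_trace dual_trace_int cE /chi.
  rewrite (eq_tr (g := fun x => eps x *: l)); last by move=> x; rewrite (int_r HH hl).
  by rewrite tr_rank1 ?(int_eps hl) ?mulr1 //; lint.
move=> x; rewrite P_S2 /P (linZ _ _ lT) (sw_lin _ _ lT); congr (_ *: _).
by apply: eq_sw => a b; rewrite (linZ _ _ lT).
Qed.

(* Let p, q be the multiplicities of the eigenvalues 1, -1 of S^2 on H and p', q' those
   on the image of P.  Then p + q = n and tr_P_S2 reads n (p' - q') = p - q, which is
   nonzero, so p - q = n or -n, and S^2 fixes 1. *)
Theorem S2_id x : S (S x) = x.
Proof.
have TT y : T (T y) = y by exact: S4_id.
have two : (2%:R : F) != 0 by have /pcharf0P -> := charF.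
pose Qp y : vB := 2^-1 *: (y + T y); pose Qm y : vB := 2^-1 *: (y - T y).
have h1 : (2^-1 + 2^-1 : F) = 1.
  by apply: (mulfI two); rewrite mulrDr divff // mulr1 (natrD _ 1 1).
have yE y : Qp y + Qm y = y.
  by rewrite -scalerDr addrACA subrr addr0 scalerDr -scalerDl h1 scale1r.
have TE y : Qp y - Qm y = T y.
  rewrite -scalerBr opprB addrACA [T y + _]addrC addrACA subrr add0r.
  by rewrite scalerDr -scalerDl h1 scale1r.
have lQp : lin Qp by rewrite /Qp; lint.
have lQm : lin Qm by rewrite /Qm; lint.
have TQp y : T (Qp y) = Qp y by rewrite (linZ _ _ lT) (linD _ _ lT) TT addrC.
have TQm y : T (Qm y) = - Qm y.
  by rewrite (linZ _ _ lT) (linB _ _ lT) TT -opprB scalerN.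
have Qpp y : Qp (Qp y) = Qp y.
  by rewrite {1}/Qp TQp scalerDr -scalerDl h1 scale1r.
have Qmm y : Qm (Qm y) = Qm y.
  by rewrite {1}/Qm TQm opprK scalerDr -scalerDl h1 scale1r.
have PQp y : P (Qp y) = Qp (P y) by rewrite (linZ _ _ lP) (linD _ _ lP) P_S2.
have PQm y : P (Qm y) = Qm (P y) by rewrite (linZ _ _ lP) (linB _ _ lP) P_S2.
pose f1 (y : vB) : vB := P (Qp y); pose f2 (y : vB) : vB := P (Qm y).
have lf1 : lin f1 by apply: lin_comp.
have lf2 : lin f2 by apply: lin_comp.
have tp := tr_idempotent lQp Qpp; have tm := tr_idempotent lQm Qmm.
have tPp := tr_idempotent lf1 (comm_idem P_idem Qpp PQp).
have tPm := tr_idempotent lf2 (comm_idem P_idem Qmm PQm).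
set p := \rank (opmx Qp) in tp; set q := \rank (opmx Qm) in tm.
set p' := \rank (opmx f1) in tPp.
set q' := \rank (opmx f2) in tPm.
have tT : tr T = p%:R - q%:R.
  rewrite -(eq_tr TE) (trD Qp (fun y => - Qm y)) tp -tm; congr (_ + _).
  rewrite -mulN1r -trZ; apply: eq_tr => y; by rewrite scaleN1r.
have tPT : tr (fun y => P (T y)) = p'%:R - q'%:R.
  rewrite (eq_tr (g := fun y => f1 y + -1 *: f2 y)).
    by rewrite (trD f1 (fun y => -1 *: f2 y)) (trZ (-1) f2) tPp tPm mulN1r.
  by move=> y; rewrite -TE (linB _ _ lP) scaleN1r.
have pq : (p + q = n)%N.
  apply: (natr_inj_char0 charF); rewrite natrD -tp -tm -trD (eq_tr yE).
  by rewrite -opmx_tr (_ : opmx _ = 1%:M) ?mxtrace1 // -opmx_id.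
(* The trace identity n (p' - q') = p - q, rearranged to avoid subtraction in the naturals. With p +
   q = n, the case p' < q' forces p = 0 and p' > q' forces q = 0. *)
have key : (n * p' + q = n * q' + p)%N.
  apply: (natr_inj_char0 charF); rewrite !natrD !natrM.
  have := tr_P_S2; rewrite tT tPT mulrBr => /eqP; rewrite subr_eq addrAC eq_sym subr_eq => /eqP h.
  by rewrite -h addrC.
have npq : p <> q.
  move=> e; have := phi_one_neq0.
  have -> : phi H one = tr T by apply: eq_tr => y; rewrite (hmul1x HH).
  by rewrite tT e subrr eqxx.
have rank0 (f : vB -> vB) : lin f -> \rank (opmx f) = 0%N -> forall y, f y = 0.
  move=> lf /eqP; rewrite mxrank_eq0 => /eqP e; apply: opmx_inj => //; first exact: lin_const0.
  by rewrite e; apply/matrixP=> i j; rewrite !mxE vec0.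
have [lt|gt|eq] := ltngtP p' q'; last by case: npq; apply/eqP; rewrite -(eqn_add2l (n * q')) -key eq.
  have : (n * p' + n <= n * q')%N by rewrite -mulnSr leq_mul2l lt orbT.
  move=> h; have p0 : p = 0%N by lia.
  have /(_ one) := rank0 _ lQp p0; rewrite /Qp /T !(S_one HH) scalerDr -scalerDl h1 scale1r.
  move=> o0; have := eps_one HH; rewrite o0 (lin0 (lin_epsH H (@lin_id _ vB))).
  by move=> /esym/eqP; rewrite oner_eq0.
have : (n * q' + n <= n * p')%N by rewrite -mulnSr leq_mul2l gt orbT.
move=> h; have q0 : q = 0%N by lia.
by rewrite -/(T x) -TE (rank0 _ lQm q0) subr0 -[RHS]yE (rank0 _ lQm q0) addr0.
Qed.

End LarsonRadford.

(** * The Heisenberg double *)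

Lemma linext2_ev (F : fieldType) (A B C D : finType) (W : lmodType F)
  (K : vec F A -> vec F B -> vec F C -> vec F D -> W) X Y :
  linext2 (fun (p : A * B) (q : C * D) => K (bvec F p.1) (bvec F p.2) (bvec F q.1) (bvec F q.2)) X Y =
  ev (fun a b => ev (fun c d => K a b c d) Y) X.
Proof. by rewrite linext2E; apply: eq_bigr. Qed.

Lemma ev_ext (F : fieldType) (A B : finType) (W : lmodType F) (f g : vec F (A * B)%type -> W) :
  lin f -> lin g -> (forall x y, f (tens x y) = g (tens x y)) -> f =1 g.
Proof.
move=> lf lg e; apply: eq_on_basis => // -[a b].
by rewrite -tens_b e.
Qed.

Lemma eq_ev (F : fieldType) (A B : finType) (W : lmodType F) (f g : vec F A -> vec F B -> W) t :
  (forall a b, f a b = g a b) -> ev f t = ev g t.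
Proof. by move=> e; apply: eq_bigr => p _; rewrite e. Qed.

(** * Coregular actions *)

Section Translations.
Variables (F : fieldType) (n : nat) (H : hopfData F n).
Local Notation vB := (vec F 'I_n).
Local Notation "x ** y" := (mulH H x y) (at level 40, left associativity).

(** The two coregular actions of H on its dual, <a_(1), y> a_(2) for [ltrans] and a_(1) <a_(2), y>
    for [rtrans]. They absorb Sweedler sums over the dual, so that cross relations keep only sums
    over H. *)
Definition ltrans (a y : vB) : vB := [ffun k => pairing a (y ** bvec F k)].
Definition rtrans (a y : vB) : vB := [ffun k => pairing a (bvec F k ** y)].

Lemma pairing_ltrans a y x : pairing (ltrans a y) x = pairing a (y ** x).
Proof.
rewrite [RHS](lin_expand (W := F^o) (f := fun x => pairing a (y ** x))); last by lint.
by rewrite pairingC; apply: eq_bigr => i _; rewrite ffunE.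
Qed.

Lemma pairing_rtrans a y x : pairing (rtrans a y) x = pairing a (x ** y).
Proof.
rewrite [RHS](lin_expand (W := F^o) (f := fun x => pairing a (x ** y))); last by lint.
by rewrite pairingC; apply: eq_bigr => i _; rewrite ffunE.
Qed.

Lemma bil_ltrans : bil ltrans.
Proof.
split=> b c x y; apply: pairing_inj => z.
  rewrite (linD (W := F^o) (f := fun u => pairing u z)) ?pairing_ltrans; last by lint.
  rewrite (linZ (W := F^o) (f := fun u => pairing u z)) ?pairing_ltrans; last by lint.
  exact: (lin_pairl (b ** z) (@lin_id _ vB)).
rewrite (linD (W := F^o) (f := fun u => pairing u z)) ?pairing_ltrans; last by lint.
rewrite (linZ (W := F^o) (f := fun u => pairing u z)) ?pairing_ltrans; last by lint.
by apply: (lin_pairr b (lin_mulHl H z (@lin_id _ vB))).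
Qed.

Lemma bil_rtrans : bil rtrans.
Proof.
split=> b c x y; apply: pairing_inj => z.
  rewrite (linD (W := F^o) (f := fun u => pairing u z)) ?pairing_rtrans; last by lint.
  rewrite (linZ (W := F^o) (f := fun u => pairing u z)) ?pairing_rtrans; last by lint.
  exact: (lin_pairl (z ** b) (@lin_id _ vB)).
rewrite (linD (W := F^o) (f := fun u => pairing u z)) ?pairing_rtrans; last by lint.
rewrite (linZ (W := F^o) (f := fun u => pairing u z)) ?pairing_rtrans; last by lint.
by apply: (lin_pairr b (lin_mulHr H z (@lin_id _ vB))).
Qed.

Lemma swd_pairl (W : lmodType F) a y (g : vB -> W) : lin g ->
  sw2 (DeltaHd H) a (fun a1 a2 => pairing a1 y *: g a2) = g (ltrans a y).
Proof.
move=> lg; transitivity (g (sw2 (DeltaH (dualH H)) a (fun a1 a2 => pairing a1 y *: a2))).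
  rewrite (sw_lin _ _ lg); apply: (eq_sw (H := dualH H)) => b c.
  by rewrite (linZ _ _ lg).
congr g; apply: pairing_inj => x; rewrite pairing_ltrans pairing_mulH.
rewrite (sw_lin (W' := F^o) (f := fun z => pairing z x)); last by lint.
apply: (eq_sw (H := dualH H) (W := F^o)) => b c.
by rewrite (linZ (W := F^o) (f := fun z => pairing z x)) //; lint.
Qed.

Lemma swd_pairr (W : lmodType F) a y (g : vB -> W) : lin g ->
  sw2 (DeltaHd H) a (fun a1 a2 => pairing a2 y *: g a1) = g (rtrans a y).
Proof.
move=> lg; transitivity (g (sw2 (DeltaH (dualH H)) a (fun a1 a2 => pairing a2 y *: a1))).
  rewrite (sw_lin _ _ lg); apply: (eq_sw (H := dualH H)) => b c.
  by rewrite (linZ _ _ lg).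
congr g; apply: pairing_inj => x; rewrite pairing_rtrans pairing_mulH.
rewrite (sw_lin (W' := F^o) (f := fun z => pairing z x)); last by lint.
apply: (eq_sw (H := dualH H) (W := F^o)) => b c.
by rewrite (linZ (W := F^o) (f := fun z => pairing z x)) 1?mulrC //; lint.
Qed.

End Translations.

Arguments swd_pairl {F n H W a y g}.
Arguments swd_pairr {F n H W a y g}.

Section Heisenberg.
Variables (F : fieldType) (n : nat) (H : hopfData F n).
Hypothesis HH : isHopf H.
Hypothesis SS : forall x, SH H (SH H x) = x.
Local Notation vB := (vec F 'I_n).
Local Notation vBB := (vec F ('I_n * 'I_n)%type).
Local Notation "x ** y" := (mulH H x y) (at level 40, left associativity).
Local Notation S := (SH H).
Local Notation eps := (epsH H).
Local Notation one := (oneH H).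
Local Notation sw x g := (sw2 (DeltaH H) x g).
Local Notation lt := (ltrans H).
Local Notation rt := (rtrans H).
Local Notation mH := (mulHeis H).
Implicit Types (x y z h a : vB) (W : lmodType F).

(** The antipode identity of the opposite algebra, which holds for S^-1 in general and for S because
    S^2 = id. *)
Lemma sw_Sl_op W x (g : vB -> W) : lin g -> sw x (fun a b => g (S b ** a)) = eps x *: g one.
Proof.
move=> lg; rewrite -(S_one HH) -(sw_Sl HH (g := fun z => g (S z))); last by lint.
by apply: eq_sw => a b; rewrite (S_mul HH) SS.
Qed.

Lemma sw_Sr_op W x (g : vB -> W) : lin g -> sw x (fun a b => g (b ** S a)) = eps x *: g one.
Proof.
move=> lg; rewrite -(S_one HH) -(sw_Sr HH (g := fun z => g (S z))); last by lint.
by apply: eq_sw => a b; rewrite (S_mul HH) SS.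
Qed.

(** The coregular action of the dual on H; the Heisenberg double is its smash product with H acting
    by left multiplication. *)
Definition hit a x : vB := sw x (fun x1 x2 => pairing a x2 *: x1).

Lemma bil_hit : bil hit.
Proof. by split=> y; rewrite /hit; lint. Qed.

Lemma hit_one x : hit (oneHd H) x = x.
Proof.
rewrite -[RHS](sw_counitr HH (g := id)) //.
by apply: eq_sw => a b; rewrite pairing_oneHd.
Qed.

Lemma hit_mul a b x : hit (mulHd H a b) x = hit a (hit b x).
Proof.
rewrite /hit (sw_lin (f := fun z => sw z (fun x1 x2 => pairing a x2 *: x1))); last by lint.
transitivity (sw x (fun x1 x2 => sw x2 (fun x3 x4 => (pairing a x3 * pairing b x4) *: x1))).
  apply: eq_sw => x1 x2; rewrite pairing_mulHd.
  by rewrite -(sw_lin (W := F^o) (f := fun s => s *: x1)); last by lint.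
rewrite -(sw_coassoc HH); apply: eq_sw => u v.
rewrite (linZ _ _ (f := fun z => sw z _)); last by lint.
by rewrite -sw_scale; apply: eq_sw => x1 x2; rewrite scalerA mulrC.
Qed.

Lemma hit_mulH a y x : hit a (y ** x) = sw y (fun y1 y2 => y1 ** hit (lt a y2) x).
Proof.
rewrite /hit (sw_mul HH); last by split; lint.
apply: eq_sw => y1 y2; rewrite (sw_lin (f := fun z => y1 ** z)); last by lint.
apply: eq_sw => x1 x2; rewrite pairing_ltrans.
by rewrite (linZ _ _ (f := fun z => y1 ** z)) //; lint.
Qed.

(* The faithful representation of H(H) on H on which identities in H(H) are checked. *)
Definition hact (X : vBB) x : vB := ev (fun h a => h ** hit a x) X.

Lemma bil_hact : bil hact.
Proof.
split=> y; first exact: lin_ev.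
have lh := bil_hit.
by rewrite /hact /ev; lint.
Qed.

Lemma hact_tens h a x : hact (tens h a) x = h ** hit a x.
Proof. by have lh := bil_hit; apply: ev_tens; lint. Qed.

Lemma mulHeis_ev X Y : mH X Y = ev (fun h a => ev (fun h' a' =>
  sw h' (fun h1 h2 => tens (h ** h1) (mulHd H (lt a h2) a'))) Y) X.
Proof.
rewrite /mulHeis (linext2_ev (fun h a h' a' => sw2 (DeltaHd H) a (fun a1 a2 =>
  sw h' (fun h1 h2 => pairing a1 h2 *: tens (h ** h1) (mulHd H a2 a'))))).
apply: eq_ev => h a; apply: eq_ev => h' a'.
rewrite (sw_exch (H := dualH H) (H' := H) a h'); apply: eq_sw => h1 h2.
rewrite (swd_pairl (g := fun z => tens (h ** h1) (mulHd H z a'))) //.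
by lint.
Qed.

Lemma bil_mulHeis : bil mH.
Proof.
split=> X; first exact: lin_linext2l.
exact: lin_linext2r.
Qed.

Lemma mulHeis_tens h a h' a' : mH (tens h a) (tens h' a') =
  sw h' (fun h1 h2 => tens (h ** h1) (mulHd H (lt a h2) a')).
Proof.
have llt := bil_ltrans H.
rewrite mulHeis_ev ev_tens; first by rewrite ev_tens //; lint.
- by move=> b; rewrite /ev; lint.
by move=> b; rewrite /ev; lint.
Qed.

Lemma hact_mul X Y x : hact (mH X Y) x = hact X (hact Y x).
Proof.
have lh := bil_hact; have lm := bil_mulHeis.
apply: (ev_ext (f := fun X => hact (mH X Y) x) (g := fun X => hact X (hact Y x))).
- exact: lin_comp (lh.1 x) (lm.1 _).
- exact: lh.1.
move=> h a.
apply: (ev_ext (f := fun Y => hact (mH (tens h a) Y) x)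
               (g := fun Y => hact (tens h a) (hact Y x))).
- exact: lin_comp (lh.1 x) (lm.2 _).
- exact: lin_comp (lh.2 _) (lh.1 x).
move=> h' a'; rewrite !hact_tens mulHeis_tens hit_mulH.
rewrite (sw_lin (f := fun Z => hact Z x)); last by lint.
rewrite (sw_lin (f := fun z => h ** z)); last by lint.
by apply: eq_sw => h1 h2; rewrite hact_tens hit_mul (hmulA HH).
Qed.

Lemma hact_one x : hact (oneHeis H) x = x.
Proof. by rewrite hact_tens hit_one (hmul1x HH). Qed.

(** The coefficients of X are read off its action: applying X to z_(2) gives u z_(2) <b, z_(3)>, and
    the factor S(z_(1)) cancels the remaining leg by the opposite antipode identity. *)
Lemma hact_recover X z : ev (fun u b => pairing b z *: u) X = sw z (fun z1 z2 => hact X z2 ** S z1).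
Proof.
have lh := bil_hact; have lhit := bil_hit.
apply: (ev_ext (f := fun X => ev (fun u b => pairing b z *: u) X)
  (g := fun X => sw z (fun z1 z2 => hact X z2 ** S z1))); [exact: lin_ev | by lint |].
move=> h a; rewrite ev_tens; try by lint.
transitivity (sw z (fun z1 z2 => sw z2 (fun z3 z4 => pairing a z4 *: (h ** (z3 ** S z1))))); last first.
  apply: eq_sw => z1 z2; rewrite hact_tens /hit (sw_lin (f := fun y => h ** y ** S z1)); last by lint.
  apply: eq_sw => z3 z4; rewrite (linZ _ _ (f := fun y => h ** y ** S z1)); last by lint.
  by rewrite (hmulA HH).
rewrite -(sw_coassoc HH).
transitivity (sw z (fun u z4 => eps u *: (pairing a z4 *: h))).
  by rewrite (sw_counitl HH (g := fun z4 => pairing a z4 *: h)); last by lint.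
apply: eq_sw => u z4.
rewrite (sw_Sr_op _ (g := fun y => pairing a z4 *: (h ** y))); last by lint.
by rewrite (hmulx1 HH).
Qed.

Lemma hact_inj X Y : hact X =1 hact Y -> X = Y.
Proof.
move=> e; apply/ffunP=> -[i j].
have E (Z : vBB) : Z (i, j) = ev (fun u b => pairing b (bvec F j) *: u) Z i.
  rewrite /ev vec_sum -[LHS](sum_coord (W := F^o) (i, j) Z); apply: eq_bigr => -[k m] _.
  by rewrite !vecZ pairing_b -tens_b tensE !bvecE /= [i == k]eq_sym [j == m]eq_sym /GRing.scale /= mulrC [(_ == j)%:R * _]mulrC.
rewrite !E !hact_recover; congr (fun_of_fin _ i).
by apply: eq_sw => z1 z2; rewrite e.
Qed.

Lemma mulHeisA X Y Z : mH (mH X Y) Z = mH X (mH Y Z).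
Proof. by apply: hact_inj => x; rewrite !hact_mul. Qed.

Lemma mulHeis1X X : mH (oneHeis H) X = X.
Proof. by apply: hact_inj => x; rewrite hact_mul hact_one. Qed.

Lemma mulHeisX1 X : mH X (oneHeis H) = X.
Proof. by apply: hact_inj => x; rewrite hact_mul hact_one. Qed.

(* rho0 true, rho0 false are the edge factors of Hol at r(bar e), l(bar e)^-1 and
   sig0 true, sig0 false those at r(e), l(e)^-1. *)
Definition rho0 (b : bool) z : vBB :=
  if b then tens z (oneHd H) else
  \sum_i \sum_j tens (bvec F i ** S z ** S (bvec F j)) (mulHd H (bvec F j) (bvec F i)).

Definition sig0 (b : bool) g : vBB :=
  if b then tens one g else
  \sum_i \sum_j tens (bvec F i ** S (bvec F j))
                     (mulHd H (mulHd H (bvec F j) (SHd H g)) (bvec F i)).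

Lemma sum_pairing W (f : vB -> W) x : lin f -> \sum_i pairing (bvec F i) x *: f (bvec F i) = f x.
Proof.
move=> lf; rewrite [RHS](lin_expand x lf); apply: eq_bigr => i _.
by rewrite pairingC pairing_b.
Qed.

Lemma hact_rho0 b z x : hact (rho0 b z) x = if b then z ** x else x ** S z.
Proof.
case: b; first by rewrite hact_tens hit_one.
have lh := bil_hact; have lhit := bil_hit.
rewrite /rho0 (lin_sum _ _ _ (lh.1 x)).
(* The dual bases feed the legs x4 and x3 into the H-factor; S(x3) x1 then cancels and left
   multiplication has become right multiplication. *)
transitivity (sw x (fun x1 x2 => sw x2 (fun x3 x4 => x4 ** S z ** S x3 ** x1))).
  transitivity (sw x (fun x1 x2 => \sum_i sw x2 (fun x3 x4 => \sum_j
      (pairing (bvec F i) x4 * pairing (bvec F j) x3) *: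
      (bvec F i ** S z ** S (bvec F j) ** x1)))).
    rewrite -sw_sum; apply: eq_bigr => i _; rewrite (lin_sum _ _ _ (lh.1 x)).
    transitivity (\sum_j sw x (fun x1 x2 => sw x2 (fun x3 x4 =>
      (pairing (bvec F i) x4 * pairing (bvec F j) x3) *:
      (bvec F i ** S z ** S (bvec F j) ** x1)))).
      apply: eq_bigr => j _; rewrite hact_tens /hit.
      rewrite (sw_lin (f := fun y => _ ** y)); last by lint.
      apply: eq_sw => x1 x2; rewrite (linZ _ _ (f := fun y => _ ** y)); last by lint.
      rewrite pairing_mulHd (sw_lin (W := F^o) (f := fun s => s *: _)); last by lint.
      by apply: eq_sw => x3 x4; rewrite mulrC.
    by rewrite sw_sum; apply: eq_sw => x1 x2; rewrite sw_sum.
  apply: eq_sw => x1 x2; rewrite sw_sum; apply: eq_sw => x3 x4.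
  rewrite -[RHS](sum_pairing x4 (f := fun y => y ** S z ** S x3 ** x1)); last by lint.
  apply: eq_bigr => i _.
  rewrite -(sum_pairing x3 (f := fun y => bvec F i ** S z ** S y ** x1)); last by lint.
  by rewrite scaler_sumr; apply: eq_bigr => j _; rewrite scalerA.
rewrite -(sw_coassoc HH).
transitivity (sw x (fun u x4 => eps u *: (x4 ** S z))).
  apply: eq_sw => u x4; rewrite -{2}[S z](hmulx1 HH).
  rewrite -(sw_Sl_op _ (g := fun y => x4 ** (S z ** y))); last by lint.
  by apply: eq_sw => x1 x3; rewrite !(hmulA HH).
by rewrite (sw_counitl HH (g := fun y => y ** S z)); last by lint.
Qed.

(** As for [hact_rho0], the dual bases carry the action to the other side: the second coregular
    action, twisted by the antipode. *)
Lemma hact_sig0 b g x : hact (sig0 b g) x =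
  if b then hit g x else sw x (fun x1 x2 => pairing g (S x1) *: x2).
Proof.
case: b; first by rewrite hact_tens (hmul1x HH).
have lh := bil_hact; have lhit := bil_hit.
rewrite /sig0 (lin_sum _ _ _ (lh.1 x)).
transitivity (sw x (fun x1 x2 => sw x2 (fun x3 y => sw y (fun x4 x5 =>
    pairing g (S x4) *: (x5 ** S x3 ** x1))))).
  transitivity (sw x (fun x1 x2 => \sum_i sw x2 (fun x3 y => sw y (fun x4 x5 =>
      \sum_j (pairing (bvec F i) x5 * pairing (bvec F j) x3) *: (pairing g (S x4) *:
      (bvec F i ** S (bvec F j) ** x1)))))).
    rewrite -sw_sum; apply: eq_bigr => i _; rewrite (lin_sum _ _ _ (lh.1 x)).
    transitivity (\sum_j sw x (fun x1 x2 => sw x2 (fun x3 y => sw y (fun x4 x5 =>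
      (pairing (bvec F i) x5 * pairing (bvec F j) x3) *: (pairing g (S x4) *:
      (bvec F i ** S (bvec F j) ** x1)))))).
      apply: eq_bigr => j _; rewrite hact_tens /hit.
      rewrite (sw_lin (f := fun y => _ ** y)); last by lint.
      apply: eq_sw => x1 x2; rewrite (linZ _ _ (f := fun y => _ ** y)); last by lint.
      rewrite -(sw_coassoc HH) pairing_mulHd (sw_lin (W := F^o) (f := fun s => s *: _)); last by lint.
      apply: eq_sw => u x5; rewrite pairing_mulHd.
      rewrite (sw_lin (W := F^o) (W' := F^o) (f := fun s : F^o => s * pairing (bvec F i) x5)); last first.
        by move=> c s s'; rewrite mulrDl -mulrA.
      rewrite (sw_lin (W := F^o) (f := fun s => s *: _)); last by lint.
      apply: eq_sw => x3 x4; rewrite pairing_SHd scalerA; congr (_ *: _).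
      by rewrite [LHS]mulrC mulrA.
    rewrite sw_sum; apply: eq_sw => x1 x2; rewrite sw_sum; apply: eq_sw => x3 y.
    by rewrite sw_sum.
  apply: eq_sw => x1 x2; rewrite sw_sum; apply: eq_sw => x3 y.
  rewrite sw_sum; apply: eq_sw => x4 x5.
  rewrite -[RHS](sum_pairing x5 (f := fun y => pairing g (S x4) *: (y ** S x3 ** x1))); last by lint.
  apply: eq_bigr => i _.
  rewrite -(sum_pairing x3 (f := fun y => pairing g (S x4) *: (bvec F i ** S y ** x1))); last by lint.
  by rewrite scaler_sumr; apply: eq_bigr => j _; rewrite [RHS]scalerA.
rewrite -(sw_coassoc HH).
transitivity (sw x (fun u y => eps u *: sw y (fun x4 x5 => pairing g (S x4) *: x5))).
  apply: eq_sw => u y; rewrite sw_exch -sw_scale; apply: eq_sw => x4 x5.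
  rewrite -{2}[x5](hmulx1 HH).
  rewrite -(sw_Sl_op _ (g := fun y => pairing g (S x4) *: (x5 ** y))); last by lint.
  by apply: eq_sw => x1 x3; rewrite !(hmulA HH).
by rewrite (sw_counitl HH (g := fun y => sw y (fun x4 x5 => pairing g (S x4) *: x5))); last by lint.
Qed.

Lemma lin_rho0 b : lin (rho0 b).
Proof. by rewrite /rho0; case: b; lint. Qed.

Lemma lin_sig0 b : lin (sig0 b).
Proof. by rewrite /sig0; case: b; lint. Qed.

Lemma rho0_mul b x y : rho0 b (x ** y) = mH (rho0 b x) (rho0 b y).
Proof.
apply: hact_inj => z; rewrite hact_mul !hact_rho0.
by case: b; rewrite ?(S_mul HH) !(hmulA HH).
Qed.

Lemma rho0_one b : rho0 b one = oneHeis H.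
Proof.
apply: hact_inj => z; rewrite hact_one hact_rho0.
by case: b; rewrite ?(S_one HH) ?(hmul1x HH) ?(hmulx1 HH).
Qed.

Lemma sig0_mul b x y : sig0 b (mulHd H x y) = mH (sig0 b x) (sig0 b y).
Proof.
apply: hact_inj => z; rewrite hact_mul !hact_sig0.
case: b; first by rewrite hit_mul.
rewrite (sw_lin (f := fun w => sw w (fun x1 x2 => pairing x (S x1) *: x2))); last by lint.
transitivity (sw z (fun u v => sw u (fun z1 z2 => (pairing x (S z2) * pairing y (S z1)) *: v))).
  apply: eq_sw => u v; rewrite pairing_mulHd (sw_S HH); last by split; lint.
  by rewrite -(sw_lin (W := F^o) (f := fun s => s *: v)); last by lint.
rewrite (sw_coassoc HH); apply: eq_sw => z1 v.
rewrite (linZ _ _ (f := fun w => sw w _)); last by lint.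
by rewrite -sw_scale; apply: eq_sw => z2 w; rewrite scalerA mulrC.
Qed.

Lemma sig0_one b : sig0 b (oneHd H) = oneHeis H.
Proof.
apply: hact_inj => z; rewrite hact_one hact_sig0.
case: b; first exact: hit_one.
rewrite -[RHS](sw_counitl HH (g := id)) //.
by apply: eq_sw => a b; rewrite pairing_oneHd (S_eps HH).
Qed.

(** Left and right multiplications of H commute; [sig0_comm] is the same statement for the two
    coregular actions. *)
Lemma rho0_comm b x y : mH (rho0 b x) (rho0 (~~ b) y) = mH (rho0 (~~ b) y) (rho0 b x).
Proof.
apply: hact_inj => z; rewrite !hact_mul !hact_rho0.
by case: b; rewrite /= (hmulA HH).
Qed.

Lemma sig0_comm b x y : mH (sig0 b x) (sig0 (~~ b) y) = mH (sig0 (~~ b) y) (sig0 b x).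
Proof.
wlog: b x y / b = true.
  by move=> w; case: b; [exact: w | rewrite (w true)].
move=> ->; apply: hact_inj => z; rewrite !hact_mul !hact_sig0 /hit.
rewrite (sw_lin (f := fun w => sw w (fun x1 x2 => pairing x x2 *: x1))); last by lint.
rewrite (sw_lin (f := fun w => sw w (fun x1 x2 => pairing y (S x1) *: x2))); last by lint.
transitivity (sw z (fun z1 u => sw u (fun z2 z3 => (pairing y (S z1) * pairing x z3) *: z2))).
  apply: eq_sw => z1 u; rewrite (linZ _ _ (f := fun w => sw w _)); last by lint.
  by rewrite -sw_scale; apply: eq_sw => z2 z3; rewrite scalerA.
rewrite -(sw_coassoc HH); apply: eq_sw => u z3.
rewrite (linZ _ _ (f := fun w => sw w _)); last by lint.
by rewrite -sw_scale; apply: eq_sw => z1 z2; rewrite scalerA mulrC.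
Qed.

(** The crossing of the vertex loop with a face that arrives at the vertex along this edge end. In
    [sig0_rho0_opp] the face leaves the vertex along it, and the other translation appears. *)
Lemma sig0_rho0_same b a h : mH (sig0 b a) (rho0 b h) =
  sw h (fun h1 h2 => mH (rho0 b h1) (sig0 b (lt a h2))).
Proof.
apply: hact_inj => x; rewrite hact_mul hact_rho0 hact_sig0.
rewrite (sw_lin (f := fun Z => hact Z x)); last by case: bil_hact => h1 h2; apply: h1.
under [RHS]eq_sw => h1 h2 do rewrite hact_mul hact_rho0 hact_sig0.
case: b; first by rewrite hit_mulH.
rewrite (sw_mul HH); last by split; lint.
transitivity (sw x (fun x1 x2 => sw h (fun h1 h2 => pairing a (S (x1 ** S h2)) *: (x2 ** S h1)))).
  by apply: eq_sw => x1 x2; rewrite (sw_S HH) //; split; lint.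
rewrite sw_exch; apply: eq_sw => h1 h2.
rewrite (sw_lin (f := fun w => w ** S h1)); last by lint.
apply: eq_sw => x1 x2; rewrite (linZ _ _ (f := fun w => w ** S h1)); last by lint.
by rewrite pairing_ltrans (S_mul HH) SS.
Qed.

Lemma sig0_rho0_opp b a h : mH (sig0 (~~ b) a) (rho0 b h) =
  sw h (fun h1 h2 => mH (rho0 b h2) (sig0 (~~ b) (rt a (S h1)))).
Proof.
apply: hact_inj => x; rewrite hact_mul hact_rho0 hact_sig0.
rewrite (sw_lin (f := fun Z => hact Z x)); last by case: bil_hact => h1 h2; apply: h1.
under [RHS]eq_sw => h1 h2 do rewrite hact_mul hact_rho0 hact_sig0.
case: b => /=.
  rewrite (sw_mul HH); last by split; lint.
  apply: eq_sw => h1 h2; rewrite (sw_lin (f := fun w => h2 ** w)); last by lint.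
  apply: eq_sw => x1 x2; rewrite (linZ _ _ (f := fun w => h2 ** w)); last by lint.
  by rewrite pairing_rtrans (S_mul HH).
rewrite /hit (sw_mul HH); last by split; lint.
transitivity (sw x (fun x1 x2 => sw h (fun h1 h2 => pairing a (x2 ** S h1) *: (x1 ** S h2)))).
  by apply: eq_sw => x1 x2; rewrite (sw_S HH) //; split; lint.
rewrite sw_exch; apply: eq_sw => h1 h2.
rewrite (sw_lin (f := fun w => w ** S h2)); last by lint.
apply: eq_sw => x1 x2; rewrite (linZ _ _ (f := fun w => w ** S h2)); last by lint.
by rewrite pairing_rtrans.
Qed.

End Heisenberg.

(** * Tensor powers of algebras and supports *)

Section TensorPower.
Variables (F : fieldType) (X B : finType).
Local Notation TX := (vec F {ffun X -> B}).
Implicit Types w : X -> vec F B.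

Lemma tpowE w f : tpow w f = \prod_x w x (f x).
Proof. by rewrite ffunE. Qed.

Lemma eq_tpow w w' : w =1 w' -> tpow w = tpow w'.
Proof. by move=> e; apply/ffunP=> f; rewrite !tpowE; apply: eq_bigr => x _; rewrite e. Qed.

Lemma tpow_b (f : {ffun X -> B}) : tpow (fun x => bvec F (f x)) = bvec F f.
Proof.
apply/ffunP=> g; rewrite tpowE bvecE.
have [->|ne] := eqVneq g f; first by apply: big1 => x _; rewrite bvecE eqxx.
have [x nx] : exists x, g x != f x.
  case: (pickP (fun x => g x != f x)) => [x nx|h]; first by exists x.
  by case/eqP: ne; apply/ffunP=> x; apply/eqP/negbFE/h.
by rewrite (bigD1 x) //= bvecE (negbTE nx) mul0r.
Qed.

Lemma tpow_ext (W : lmodType F) (f g : TX -> W) :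
  lin f -> lin g -> (forall w, f (tpow w) = g (tpow w)) -> f =1 g.
Proof. by move=> lf lg e; apply: eq_on_basis => // b; rewrite -tpow_b e. Qed.

Definition upd w x0 (a : vec F B) x := if x == x0 then a else w x.

Lemma lin_tpow w x0 : lin (fun a => tpow (upd w x0 a)).
Proof.
have E a f : tpow (upd w x0 a) f = a (f x0) * \prod_(x | x != x0) w x (f x).
  rewrite tpowE (bigD1 x0) //= /upd eqxx; congr (_ * _).
  by apply: eq_bigr => x /negbTE ->.
by move=> c a b; apply/ffunP=> f; rewrite vecD vecZ !E vecD vecZ mulrDl -mulrA.
Qed.

Lemma lin_tat one x0 : lin (fun a => tat one x0 a : TX).
Proof. exact: (lin_tpow (fun _ => one) x0). Qed.

Lemma bil_tmul m : bil (tmul m : TX -> TX -> TX).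
Proof. by split=> y; [exact: lin_linext2l | exact: lin_linext2r]. Qed.

Lemma tmul_tpow (m : vec F B -> vec F B -> vec F B) w w' : bil m ->
  tmul m (tpow w) (tpow w') = tpow (fun x => m (w x) (w' x)).
Proof.
move=> lm; apply/ffunP=> h; rewrite tpowE /tmul linext2E vec_sum.
transitivity (\prod_x \sum_a w x a * \sum_b w' x b * m (bvec F a) (bvec F b) (h x)); last first.
  apply: eq_bigr => x _; rewrite (lin_expand (w x) (lm.1 (w' x))) vec_sum.
  apply: eq_bigr => a _; rewrite vecZ; congr (_ * _).
  by rewrite (lin_expand (w' x) (lm.2 _)) vec_sum; apply: eq_bigr => b _; rewrite vecZ.
rewrite bigA_distr_bigA; apply: eq_bigr => f _.
rewrite vecZ vec_sum big_split /= tpowE; congr (_ * _).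
rewrite bigA_distr_bigA; apply: eq_bigr => g _.
by rewrite vecZ !tpowE -big_split.
Qed.

Section Algebra.
Variables (m : vec F B -> vec F B -> vec F B) (one : vec F B).
Hypothesis lm : bil m.
Hypothesis mA : forall a b c, m (m a b) c = m a (m b c).
Hypothesis m1 : forall a, m one a = a.
Hypothesis mr1 : forall a, m a one = a.

Lemma tmulA u v t : tmul m (tmul m u v) t = tmul m u (tmul m v t) :> TX.
Proof.
have lt := bil_tmul m.
apply: (tpow_ext (f := fun u => tmul m (tmul m u v) t) (g := fun u => tmul m u (tmul m v t))).
- exact: lin_comp (lt.1 _) (lt.1 _).
- exact: lt.1.
move=> w.
apply: (tpow_ext (f := fun v => tmul m (tmul m _ v) t) (g := fun v => tmul m _ (tmul m v t))).
- exact: lin_comp (lt.1 _) (lt.2 _).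
- exact: lin_comp (lt.2 _) (lt.1 _).
move=> w'.
apply: (tpow_ext (f := fun t => tmul m _ t) (g := fun t => tmul m _ (tmul m _ t))).
- exact: lt.2.
- exact: lin_comp (lt.2 _) (lt.2 _).
by move=> w''; rewrite !tmul_tpow //; apply: eq_tpow => x; rewrite mA.
Qed.

Lemma tmul1 u : tmul m (tone X one) u = u.
Proof.
apply: (tpow_ext (f := tmul m (tone X one)) (g := id)) => [||w]; try by [].
  by have := bil_tmul m; case.
by rewrite tmul_tpow //; apply: eq_tpow => x; rewrite m1.
Qed.

Lemma tmulr1 u : tmul m u (tone X one) = u.
Proof.
apply: (tpow_ext (f := fun u => tmul m u (tone X one)) (g := id)) => [||w]; try by [].
  by have := bil_tmul m; case.
by rewrite tmul_tpow //; apply: eq_tpow => x; rewrite mr1.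
Qed.

Lemma tat_mul (x0 : X) a b : tmul m (tat one x0 a) (tat one x0 b) = tat one x0 (m a b).
Proof. by rewrite tmul_tpow //; apply: eq_tpow => x; case: eqP. Qed.

Lemma tat_one (x0 : X) : tat one x0 one = tone X one.
Proof. by apply: eq_tpow => x; case: eqP. Qed.

(** An inductive span of pure tensors, so that statements about products of supported tensors reduce
    to a comparison factor by factor. *)
Inductive supp (P : pred X) : TX -> Prop :=
| supp_pure w : (forall x, ~~ P x -> w x = one) -> supp P (tpow w)
| supp_lin a u v : supp P u -> supp P v -> supp P (a *: u + v).

Lemma supp1 P : supp P (tone X one).
Proof. exact: supp_pure. Qed.

Lemma supp0 P : supp P 0.
Proof. by rewrite -[0](addNr (tone X one)) -scaleN1r; apply: supp_lin; apply: supp1. Qed.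

Lemma supp_scale P a u : supp P u -> supp P (a *: u).
Proof. by move=> su; rewrite -[_ *: _]addr0; apply: supp_lin => //; apply: supp0. Qed.

Lemma supp_sum P (I : Type) (s : seq I) (G : I -> TX) :
  (forall i, supp P (G i)) -> supp P (\sum_(i <- s) G i).
Proof.
move=> h; apply: big_ind => //; first exact: supp0.
by move=> u v su sv; rewrite -[u]scale1r; apply: supp_lin.
Qed.

Lemma supp_sub (P Q : pred X) u : {subset P <= Q} -> supp P u -> supp Q u.
Proof.
move=> PQ; elim=> [w hw|a u' v _ su _ sv]; last exact: supp_lin.
by apply: supp_pure => x nQ; apply: hw; apply: contra nQ; apply: PQ.
Qed.

Lemma supp_tat (x0 : X) a : supp (pred1 x0) (tat one x0 a).
Proof. by apply: supp_pure => x /= /negbTE ->. Qed.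

Lemma supp_mul P u v : supp P u -> supp P v -> supp P (tmul m u v).
Proof.
have lt := bil_tmul m.
move=> su; elim: su v => [w hw|a u1 u2 _ IH1 _ IH2] v sv; last first.
  by rewrite lt.1; apply: supp_lin; [exact: IH1 | exact: IH2].
elim: sv => [w' hw'|a v1 v2 _ IH1 _ IH2]; last by rewrite lt.2; apply: supp_lin.
rewrite tmul_tpow //; apply: supp_pure => x nP.
by rewrite hw // hw' // m1.
Qed.

Variables (m' : vec F B -> vec F B -> vec F B).
Hypothesis lm' : bil m'.
Hypothesis m'1 : forall a, m' one a = a.
Hypothesis m'r1 : forall a, m' a one = a.

(* On disjoint supports every tensor product algebra with unit [one] has the same
   (commutative) product. *)
Lemma tmul_disjoint (P Q : pred X) u v : (forall x, P x -> ~~ Q x) -> supp P u -> supp Q v ->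
  tmul m u v = tmul m' u v /\ tmul m u v = tmul m v u.
Proof.
have lt := bil_tmul m; have lt' := bil_tmul m'.
move=> dPQ su; elim: su v => [w hw|a u1 u2 _ IH1 _ IH2] v sv; last first.
  have [e1 c1] := IH1 _ sv; have [e2 c2] := IH2 _ sv.
  by rewrite lt.1 lt'.1 lt.2 e1 -e1 c1 e2 -e2 c2.
elim: sv => [w' hw'|a v1 v2 _ [e1 c1] _ [e2 c2]]; last first.
  by rewrite lt.2 lt'.2 lt.1 e1 -e1 c1 e2 -e2 c2.
rewrite !tmul_tpow //; split; apply: eq_tpow => x.
  case: (boolP (P x)) => Px; last by rewrite hw // m1 m'1.
  by rewrite hw' ?mr1 ?m'r1 // dPQ.
case: (boolP (P x)) => Px; last by rewrite hw // m1 mr1.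
by rewrite hw' ?mr1 ?m1 // dPQ.
Qed.

End Algebra.
End TensorPower.

(** * Holonomies of vertex and face loops *)

Section Holonomies.
Variables (F : fieldType) (n : nat) (H : hopfData F n) (E : finType).
Hypothesis HH : isHopf H.
Hypothesis SS : forall x, SH H (SH H x) = x.
Local Notation vB := (vec F 'I_n).
Local Notation vBB := (vec F ('I_n * 'I_n)%type).
Local Notation TE := (vec F {ffun E -> ('I_n * 'I_n)%type}).
Local Notation "x ** y" := (mulH H x y) (at level 40, left associativity).
Local Notation "x *d y" := (mulHd H x y) (at level 40, left associativity).
Local Notation S := (SH H).
Local Notation Sd := (SHd H).
Local Notation eps := (epsH H).
Local Notation epsd := (epsHd H).
Local Notation one := (oneH H).
Local Notation oned := (oneHd H).
Local Notation sw x g := (sw2 (DeltaH H) x g).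
Local Notation swd x g := (sw2 (DeltaHd H) x g).
Local Notation mE := (@mulHE F n H E).
Local Notation mDs := (@mulDsE F n H E).
Local Notation at_ := (@atE F n H E).
Implicit Types (x y z g : vB) (o d : E * bool).

Let HD := dual_isHopf HH.

Lemma epsd_mul x y : epsd (x *d y) = epsd x * epsd y. Proof. exact: (eps_mul HD). Qed.
Lemma epsd_one : epsd oned = 1. Proof. exact: (eps_one HD). Qed.
Lemma epsd_S x : epsd (Sd x) = epsd x. Proof. exact: (S_eps HD). Qed.
Lemma mulD1 x : oned *d x = x. Proof. exact: (hmul1x HD). Qed.
Lemma mulDr1 x : x *d oned = x. Proof. exact: (hmulx1 HD). Qed.
Lemma Sd_one : Sd oned = oned. Proof. exact: (S_one HD). Qed.
Lemma Sd_mul x y : Sd (x *d y) = Sd y *d Sd x. Proof. exact: (S_mul HD). Qed.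

(** The basis expansion of 1. It collapses the dual basis sums in the coproduct and antipode of the
    dual of D(H) as soon as a counit meets one of the two bases. *)
Lemma sum_epsd (W : lmodType F) (f : vB -> W) : lin f ->
  \sum_i epsd (bvec F i) *: f (bvec F i) = f one.
Proof.
move=> lf; rewrite [RHS](lin_expand _ lf); apply: eq_bigr => i _.
by rewrite -[epsd _]/(epsH (dualH H) (bvec F i)) (epsb (dualH H) i) mkvE.
Qed.

Lemma sum_eps (W : lmodType F) (f : vB -> W) : lin f ->
  \sum_i eps (bvec F i) *: f (bvec F i) = f oned.
Proof.
move=> lf; rewrite [RHS](lin_expand _ lf); apply: eq_bigr => i _.
by rewrite (epsb H i) mkvE.
Qed.

Lemma bil_mE : bil mE. Proof. exact: bil_tmul. Qed.
Lemma bil_mDs : bil mDs. Proof. exact: bil_tmul. Qed.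
Lemma lin_at_ e : lin (at_ e). Proof. exact: lin_tat. Qed.

Lemma bil_mulDs : bil (mulDs H).
Proof. by split=> y; [exact: lin_linext2l | exact: lin_linext2r]. Qed.

Lemma mulDs_tens x a y b : mulDs H (tens x a) (tens y b) = tens (y ** x) (a *d b).
Proof.
rewrite /mulDs (linext2_ev (fun x a y b => tens (y ** x) (a *d b))).
by rewrite ev_tens; [rewrite ev_tens //; lint | move=> c; rewrite /ev; lint ..].
Qed.

Lemma mulDs1X X : mulDs H (oneDs H) X = X.
Proof.
apply: (ev_ext (f := mulDs H (oneDs H)) (g := id)) => //; first exact: bil_mulDs.2.
by move=> x y; rewrite mulDs_tens (hmulx1 HH) mulD1.
Qed.

Lemma mulDsX1 X : mulDs H X (oneDs H) = X.
Proof.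
apply: (ev_ext (f := fun X => mulDs H X (oneDs H)) (g := id)) => //; first exact: bil_mulDs.1.
by move=> x y; rewrite mulDs_tens (hmul1x HH) mulDr1.
Qed.

Lemma mEA X Y Z : mE (mE X Y) Z = mE X (mE Y Z).
Proof. by apply: tmulA; [exact: bil_mulHeis | exact: mulHeisA]. Qed.

Lemma mE1 X : mE (oneHE H E) X = X.
Proof. by apply: tmul1; [exact: bil_mulHeis | exact: mulHeis1X]. Qed.

Lemma mEr1 X : mE X (oneHE H E) = X.
Proof. by apply: tmulr1; [exact: bil_mulHeis | exact: mulHeisX1]. Qed.

Definition rho o z : TE := at_ o.1 (rho0 H o.2 z).
Definition sig d g : TE := at_ d.1 (sig0 H d.2 g).

Lemma lin_rho o : lin (rho o).
Proof. exact: lin_comp (lin_at_ _) (lin_rho0 _ _). Qed.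

Lemma lin_sig o : lin (sig o).
Proof. exact: lin_comp (lin_at_ _) (lin_sig0 _ _). Qed.

(** The common form of both kinds of holonomy: a convolution product over edges along the coproduct
    of K, with K = H for vertex loops and K = [dualH H] for face loops. *)
Fixpoint cprod (K : hopfData F n) (r : E * bool -> vB -> TE) (s : seq (E * bool)) z : TE :=
  if s is o :: s' then sw2 (DeltaH K) z (fun z1 z2 => mE (r o z1) (cprod K r s' z2))
  else epsH K z *: oneHE H E.

Local Notation rhos := (cprod H rho).
Local Notation sigs := (cprod (dualH H) sig).

Lemma lin_cprod K r s : lin (cprod K r s).
Proof. by case: s => [|o s] /=; lint. Qed.

Local Notation supp := (supp (oneHeis H)).

Lemma supp_rho o z : supp (pred1 o.1) (rho o z).
Proof. exact: supp_tat. Qed.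

Lemma supp_sig o z : supp (pred1 o.1) (sig o z).
Proof. exact: supp_tat. Qed.

Lemma supp_swsum (P : pred E) (D : vB -> vBB) z (G : vB -> vB -> TE) :
  (forall a b, supp P (G a b)) -> supp P (sw2 D z G).
Proof. by move=> h; apply: supp_sum => p; apply: supp_scale. Qed.

Lemma supp_cprod K r s z : (forall o x, supp (pred1 o.1) (r o x)) ->
  supp (mem (map fst s)) (cprod K r s z).
Proof.
move=> sr; elim: s z => [|o s IH] z /=; first by apply: supp_scale; apply: supp1.
apply: supp_swsum => a b; apply: supp_mul; [exact: bil_mulHeis | exact: mulHeis1X | |].
  by apply: supp_sub (sr o a) => e; rewrite !inE => ->.
by apply: supp_sub (IH b) => e; rewrite !inE => ->; rewrite orbT.
Qed.

Lemma disjoint_supp (P Q : pred E) X Y : (forall e, P e -> ~~ Q e) -> supp P X -> supp Q Y ->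
  mE X Y = mDs X Y /\ mE X Y = mE Y X.
Proof.
move=> dPQ sX sY; apply: (tmul_disjoint (one := oneHeis H)) dPQ sX sY.
- exact: bil_mulHeis.
- exact: mulHeis1X.
- exact: mulHeisX1.
- exact: bil_mulDs.
- exact: mulDs1X.
- exact: mulDsX1.
Qed.

Lemma holpure_tens (f : vB -> vB -> TE) y g : bil f -> holpure f (tens y g) = f y g.
Proof. by move=> lf; apply: ev_tens => [u|u]; [exact: lf.1 | exact: lf.2]. Qed.

Lemma lin_holpure (f : vB -> vB -> TE) : lin (holpure f).
Proof. exact: lin_ev. Qed.

Lemma SDs_tens y g : SDs H (tens y g) = \sum_i \sum_j
  tens (bvec F i ** S y ** bvec F j) (Sd (bvec F j) *d Sd g *d bvec F i).
Proof.
have -> : SDs H (tens y g) = ev (fun y g => \sum_i \sum_j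
  tens (bvec F i ** S y ** bvec F j) (Sd (bvec F j) *d Sd g *d bvec F i)) (tens y g) by [].
by rewrite ev_tens //; lint.
Qed.

Lemma lin_SDs : lin (SDs H). Proof. exact: lin_linext. Qed.

Lemma lin_hol_tedge t : lin (hol_tedge (E := E) H t).
Proof. by case: t => e; apply: lin_holpure. Qed.

Lemma lin_hol_step s : lin (hol_step (E := E) H s).
Proof.
case: s => t [] /=; last exact: lin_hol_tedge.
exact: lin_comp (lin_hol_tedge t) lin_SDs.
Qed.

(** For a reversed edge end the holonomy at l(bar e) applies the counit to the dual leg, so the sums
    in [SDs] reduce to the antipode on y; the factor of l(bar e) at S(y) is [rho0 false]. *)
Lemma hol_rbarstep o y g : hol_step H (rbarstep o) (tens y g) = epsd g *: rho o y.
Proof.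
have la := lin_at_.
case: o => e []; rewrite /hol_step /=; first by rewrite holpure_tens //; split; lint.
rewrite -[LHS]/(hol_tedge H (tLbar e) (SDs H (tens y g))) SDs_tens.
pose L u := \sum_i \sum_j at_ e (tens (bvec F i ** u ** S (bvec F j)) (bvec F j *d bvec F i)).
have lL : lin L by rewrite /L; lint.
have lh := lin_hol_tedge (tLbar e).
transitivity (\sum_i \sum_j (epsd (bvec F j) * epsd g * epsd (bvec F i)) *:
                 L (bvec F i ** S y ** bvec F j)).
  rewrite (lin_sum _ _ _ lh); apply: eq_bigr => i _.
  rewrite (lin_sum _ _ _ lh); apply: eq_bigr => j _.
  rewrite /= holpure_tens; last by split; lint.
  by rewrite !epsd_mul !epsd_S.
transitivity (epsd g *: L (S y)); last first.
  congr (_ *: _); rewrite /rho /rho0 /= (lin_sum _ _ _ (la e)); apply: eq_bigr => i _.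
  by rewrite (lin_sum _ _ _ (la e)).
transitivity (\sum_i epsd (bvec F i) *: (epsd g *: L (bvec F i ** S y))).
  apply: eq_bigr => i _; rewrite -[in RHS](hmulx1 HH (_ ** S y)).
  rewrite -(sum_epsd (f := fun z => L (bvec F i ** S y ** z))); last exact: lin_comp lL (lin_mulHr H _ (@lin_id _ vB)).
  rewrite !scaler_sumr; apply: eq_bigr => j _; rewrite !scalerA; congr (_ *: _).
  by rewrite [LHS]mulrC -[RHS]mulrA [in RHS](mulrC (epsd g)).
rewrite (sum_epsd (f := fun z => epsd g *: L (z ** S y))); last exact: lin_scale _ (lin_comp lL (lin_mulHl H _ (@lin_id _ vB))).
by rewrite (hmul1x HH).
Qed.

Lemma hol_rstep o y g : hol_step H (rstep o) (tens y g) = eps y *: sig o g.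
Proof.
have la := lin_at_.
case: o => e []; rewrite /hol_step /=; first by rewrite holpure_tens //; split; lint.
rewrite -[LHS]/(hol_tedge H (tL e) (SDs H (tens y g))) SDs_tens.
pose L u := \sum_i \sum_j at_ e (tens (bvec F i ** S (bvec F j)) (bvec F j *d u *d bvec F i)).
have lL : lin L by rewrite /L; lint.
have lh := lin_hol_tedge (tL e).
transitivity (\sum_i \sum_j (eps (bvec F i) * eps y * eps (bvec F j)) *:
                 L (Sd (bvec F j) *d Sd g *d bvec F i)).
  rewrite (lin_sum _ _ _ lh); apply: eq_bigr => i _.
  rewrite (lin_sum _ _ _ lh); apply: eq_bigr => j _.
  rewrite /= holpure_tens; last by split; lint.
  by rewrite !(eps_mul HH) !(S_eps HH).
transitivity (eps y *: L (Sd g)); last first.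
  congr (_ *: _); rewrite /sig /sig0 /= (lin_sum _ _ _ (la e)); apply: eq_bigr => i _.
  by rewrite (lin_sum _ _ _ (la e)).
transitivity (\sum_i eps (bvec F i) *: (eps y *: L (Sd g *d bvec F i))).
  apply: eq_bigr => i _; rewrite -[in RHS](mulD1 (Sd g)) -Sd_one.
  rewrite -(sum_eps (f := fun z => L (Sd z *d Sd g *d bvec F i))); last exact: lin_comp lL (lin_mulHdl H _ (lin_mulHdl H _ (lin_SHd H (@lin_id _ vB)))).
  by rewrite !scaler_sumr; apply: eq_bigr => j _; rewrite !scalerA.
rewrite (sum_eps (f := fun z => eps y *: L (Sd g *d z))); last exact: lin_scale _ (lin_comp lL (lin_mulHdr H _ (@lin_id _ vB))).
by rewrite mulDr1.
Qed.

Lemma conv_tens (p q : vBB -> TE) y g : lin p -> lin q ->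
  conv H p q (tens y g) = sw y (fun y1 y2 => swd g (fun g1 g2 => \sum_i \sum_j
    mDs (p (tens y1 (bvec F i *d g1 *d bvec F j)))
        (q (tens (S (bvec F j) ** y2 ** bvec F i) g2)))).
Proof.
move=> lp lq; have lm := bil_mDs.
have lc : lin (ev (fun a b => mDs (p a) (q b))) by exact: lin_ev.
transitivity (ev (fun a b => mDs (p a) (q b)) (DeltaDs H (tens y g))); first by [].
have -> : DeltaDs H (tens y g) = ev (fun y g => sw y (fun y1 y2 => swd g (fun g1 g2 =>
   \sum_i \sum_j tens (tens y1 (bvec F i *d g1 *d bvec F j))
                      (tens (S (bvec F j) ** y2 ** bvec F i) g2)))) (tens y g) by [].
rewrite ev_tens; try by lint.
rewrite (sw_lin _ _ lc); apply: eq_sw => y1 y2.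
rewrite (sw_lin (H := dualH H) _ _ lc); apply: (eq_sw (H := dualH H)) => g1 g2.
rewrite (lin_sum _ _ _ lc); apply: eq_bigr => i _.
rewrite (lin_sum _ _ _ lc); apply: eq_bigr => j _.
by rewrite ev_tens //; lint.
Qed.

Lemma lin_conv (p q : vBB -> TE) : lin (conv H p q).
Proof.
apply: (lin_comp (lin_ev (fun a b => mDs (p a) (q b)))).
exact: lin_linext.
Qed.

Lemma lin_hol (w : seq (step E)) : lin (hol H w).
Proof.
case: w => [|s [|t w]] /=; last exact: lin_conv; last exact: lin_hol_step.
apply: lin_scalel; rewrite /epsDs; apply: lin_bigsum => p; apply: lin_mulFr.
exact: lin_coord.
Qed.

Lemma epsDs_tens y g : epsDs H (tens y g) = eps y * epsd g.
Proof.
have -> : epsDs H (tens y g) = ev (W := F^o) (fun y g => eps y * epsd g) (tens y g) by [].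
by rewrite ev_tens //; lint.
Qed.

(** Every step applies the counit to its dual leg, which trivialises the twist in the coproduct
    [DeltaDs] and leaves the coproduct of H. [hol_face] is the mirror image, with the counit of
    H. *)
Lemma hol_vertex s y g : uniq (map fst s) ->
  hol H (map (@rbarstep E) s) (tens y g) = epsd g *: rhos s y.
Proof.
elim: s y g => [|o [|o' s] IH] y g us.
- by rewrite /= /convUnit epsDs_tens scalerA mulrC.
- rewrite [LHS]hol_rbarstep; congr (_ *: _); rewrite /=.
  rewrite -[LHS](sw_counitr HH (g := rho o)); last exact: lin_rho.
  by apply: eq_sw => a b; rewrite (linZ _ _ (bil_mE.2 _)) mEr1.
have [no us'] : o.1 \notin map fst (o' :: s) /\ uniq (map fst (o' :: s)) by apply/andP.
transitivity (conv H (hol_step H (rbarstep o)) (hol H (map (@rbarstep E) (o' :: s))) (tens y g)).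
  by [].
rewrite conv_tens; [| exact: lin_hol_step | exact: lin_hol].
set t := o' :: s in IH us' no *.
have lr := lin_cprod H rho t; have lm := bil_mDs; have lro := lin_rho o.
rewrite [rhos (o :: t) y]/= -sw_scale; apply: eq_sw => y1 y2.
have disj e : pred1 o.1 e -> ~~ mem (map fst t) e by move=> /eqP ->.
(* The edge of o does not occur in the rest of the path, so the product in the dual of D(H) is the
   Heisenberg product. *)
rewrite (disjoint_supp disj (supp_rho o y1) (supp_cprod H t y2 supp_rho)).1.
transitivity (swd g (fun g1 g2 => epsd g1 *: (epsd g2 *: mDs (rho o y1) (rhos t y2)))); last first.
  rewrite (sw_counitl HD (g := fun g2 => epsd g2 *: mDs (rho o y1) (rhos t y2))) //.
  by lint.
apply: (eq_sw (H := dualH H)) => g1 g2.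
transitivity (\sum_i \sum_j (epsd (bvec F i) * epsd g1 * epsd (bvec F j) * epsd g2) *:
     mDs (rho o y1) (rhos t (S (bvec F j) ** y2 ** bvec F i))).
  apply: eq_bigr => i _; apply: eq_bigr => j _.
  rewrite hol_rbarstep IH // !epsd_mul (linZ _ _ (lm.1 _)) (linZ _ _ (lm.2 _)).
  by rewrite scalerA.
transitivity (\sum_i epsd (bvec F i) *: (epsd g1 *: (epsd g2 *: mDs (rho o y1) (rhos t (y2 ** bvec F i))))).
  apply: eq_bigr => i _; rewrite -[in RHS](hmul1x HH y2) -(S_one HH).
  rewrite -[X in _ = _ *: (_ *: (_ *: X))](sum_epsd (f := fun z => mDs (rho o y1) (rhos t (S z ** y2 ** bvec F i)))); last exact: lin_comp (lm.2 _) (lin_comp lr (lin_mulHl H _ (lin_mulHl H _ (lin_SH H (@lin_id _ vB))))).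
  rewrite !scaler_sumr; apply: eq_bigr => j _; rewrite !scalerA; congr (_ *: _).
  by rewrite mulrAC.
rewrite (sum_epsd (f := fun z => epsd g1 *: (epsd g2 *: mDs (rho o y1) (rhos t (y2 ** z))))); last exact: lin_scale _ (lin_scale _ (lin_comp (lm.2 _) (lin_comp lr (lin_mulHr H _ (@lin_id _ vB))))).
by rewrite (hmulx1 HH).
Qed.

Lemma hol_face s y g : uniq (map fst s) ->
  hol H (map (@rstep E) s) (tens y g) = eps y *: sigs s g.
Proof.
elim: s y g => [|o [|o' s] IH] y g us.
- by rewrite /= /convUnit epsDs_tens scalerA.
- rewrite [LHS]hol_rstep; congr (_ *: _); rewrite /=.
  rewrite -[LHS](sw_counitr HD (g := sig o)); last exact: lin_sig.
  by apply: (eq_sw (H := dualH H)) => a b; rewrite (linZ _ _ (bil_mE.2 _)) mEr1.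
have [no us'] : o.1 \notin map fst (o' :: s) /\ uniq (map fst (o' :: s)) by apply/andP.
transitivity (conv H (hol_step H (rstep o)) (hol H (map (@rstep E) (o' :: s))) (tens y g)).
  by [].
rewrite conv_tens; [| exact: lin_hol_step | exact: lin_hol].
set t := o' :: s in IH us' no *.
have lr := lin_cprod (dualH H) sig t; have lm := bil_mDs; have lso := lin_sig o.
rewrite [sigs (o :: t) g]/= -(sw_scale (H := dualH H)).
rewrite (sw_exch (H' := dualH H)); apply: (eq_sw (H := dualH H)) => g1 g2.
have disj e : pred1 o.1 e -> ~~ mem (map fst t) e by move=> /eqP ->.
rewrite (disjoint_supp disj (supp_sig o g1) (supp_cprod (dualH H) t g2 supp_sig)).1.
transitivity (sw y (fun y1 y2 => eps y1 *: (eps y2 *: mDs (sig o g1) (sigs t g2)))); last first.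
  by rewrite (sw_counitl HH (g := fun y2 => eps y2 *: mDs (sig o g1) (sigs t g2))) //; lint.
apply: eq_sw => y1 y2.
transitivity (\sum_i \sum_j (eps y1 * (eps (bvec F j) * eps y2 * eps (bvec F i))) *:
     mDs (sig o (bvec F i *d g1 *d bvec F j)) (sigs t g2)).
  apply: eq_bigr => i _; apply: eq_bigr => j _.
  rewrite hol_rstep IH // !(eps_mul HH) (S_eps HH) (linZ _ _ (lm.1 _)) (linZ _ _ (lm.2 _)).
  by rewrite scalerA.
transitivity (\sum_i eps (bvec F i) *: (eps y1 *: (eps y2 *: mDs (sig o (bvec F i *d g1)) (sigs t g2)))).
  apply: eq_bigr => i _; rewrite -[in RHS](mulDr1 (bvec F i *d g1)).
  rewrite -[X in _ = _ *: (_ *: (_ *: X))](sum_eps (f := fun z => mDs (sig o (bvec F i *d g1 *d z)) (sigs t g2))); last exact: lin_comp (lm.1 _) (lin_comp lso (lin_mulHdr H _ (@lin_id _ vB))).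
  rewrite !scaler_sumr; apply: eq_bigr => j _; rewrite !scalerA; congr (_ *: _).
  by ring.
rewrite (sum_eps (f := fun z => eps y1 *: (eps y2 *: mDs (sig o (z *d g1)) (sigs t g2)))); last exact: lin_scale _ (lin_scale _ (lin_comp (lm.1 _) (lin_comp lso (lin_mulHdl H _ (@lin_id _ vB))))).
by rewrite mulD1.
Qed.

End Holonomies.

(** * Coregular actions and the coproduct of the dual *)

Section TranslationSweedler.
Variables (F : fieldType) (n : nat) (H : hopfData F n).
Hypothesis HH : isHopf H.
Local Notation vB := (vec F 'I_n).
Local Notation "x ** y" := (mulH H x y) (at level 40, left associativity).
Local Notation swd x g := (sw2 (DeltaH (dualH H)) x g).
Local Notation lt := (ltrans H).
Local Notation rt := (rtrans H).

Lemma lt_lt a y z : lt (lt a y) z = lt a (y ** z).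
Proof. by apply: pairing_inj => x; rewrite !pairing_ltrans (hmulA HH). Qed.

Lemma rt_rt a y z : rt (rt a y) z = rt a (z ** y).
Proof. by apply: pairing_inj => x; rewrite !pairing_rtrans (hmulA HH). Qed.

Lemma lt_one a : lt a (oneH H) = a.
Proof. by apply: pairing_inj => x; rewrite !pairing_ltrans (hmul1x HH). Qed.

Lemma rt_one a : rt a (oneH H) = a.
Proof. by apply: pairing_inj => x; rewrite !pairing_rtrans (hmulx1 HH). Qed.

Lemma swd_tensor_eq (W : lmodType F) a b (f g f' g' : vB -> vB) (G : vB -> vB -> W) : bil G ->
  (forall x y, swd a (fun u v => pairing (f u) x * pairing (g v) y : F^o) =
               swd b (fun u v => pairing (f' u) x * pairing (g' v) y : F^o)) ->
  swd a (fun u v => G (f u) (g v)) = swd b (fun u v => G (f' u) (g' v)).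
Proof.
move=> lG e.
have E c p q : swd c (fun u v => G (p u) (q v)) = ev G (swd c (fun u v => tens (p u) (q v))).
  rewrite (sw_lin _ _ (lin_ev G)); apply: (eq_sw (H := dualH H)) => u v.
  by rewrite ev_tens //; [exact: lG.1 | exact: lG.2].
have E2 c p q x y : ev (W := F^o) (fun u v => pairing x u * pairing y v) (swd c (fun u v => tens (p u) (q v))) =
    swd c (fun u v => pairing (p u) x * pairing (q v) y : F^o).
  rewrite (sw_lin _ _ (lin_ev (W := F^o) _)); apply: (eq_sw (H := dualH H) (W := F^o)) => u v.
  by rewrite ev_tens; [rewrite pairingC [pairing y _]pairingC | lint | lint].
by rewrite !E; apply: sw_pair_eq => x y; rewrite !E2.
Qed.

Lemma swd_ltrans (W : lmodType F) a y (G : vB -> vB -> W) : bil G ->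
  swd (lt a y) G = swd a (fun a1 a2 => G (lt a1 y) a2).
Proof.
move=> lG; apply: (swd_tensor_eq (f := id) (g := id) (f' := fun u => lt u y) (g' := id)) => // x z.
under [RHS](eq_sw (H := dualH H) (W := F^o)) do rewrite pairing_ltrans.
by rewrite -[LHS]pairing_mulH -[RHS]pairing_mulH pairing_ltrans (hmulA HH).
Qed.

Lemma swd_rtrans (W : lmodType F) a y (G : vB -> vB -> W) : bil G ->
  swd (rt a y) G = swd a (fun a1 a2 => G a1 (rt a2 y)).
Proof.
move=> lG; apply: (swd_tensor_eq (f := id) (g := id) (f' := id) (g' := fun u => rt u y)) => // x z.
under [RHS](eq_sw (H := dualH H) (W := F^o)) do rewrite pairing_rtrans.
by rewrite -[LHS]pairing_mulH -[RHS]pairing_mulH pairing_rtrans (hmulA HH).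
Qed.

(** Paired with x (x) z, both sides give <a, x y y' z>: inner translations of neighbouring legs
    merge into one. *)
Lemma swd_middle (W : lmodType F) a y y' (G : vB -> vB -> W) : bil G ->
  swd a (fun a1 a2 => G (rt a1 y) (lt a2 y')) = swd a (fun a1 a2 => G (rt a1 (y ** y')) a2).
Proof.
move=> lG; apply: (swd_tensor_eq (f := fun u => rt u y) (g := fun u => lt u y')
  (f' := fun u => rt u (y ** y')) (g' := id)) => // x z.
under [RHS](eq_sw (H := dualH H) (W := F^o)) do rewrite pairing_rtrans.
under [LHS](eq_sw (H := dualH H) (W := F^o)) do rewrite pairing_rtrans pairing_ltrans.
by rewrite -[LHS]pairing_mulH -[RHS]pairing_mulH !(hmulA HH).
Qed.

Lemma swd_sandwich (W : lmodType F) a y y' (G : vB -> vB -> vB -> W) :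
  (forall v w, lin (fun u => G u v w)) -> (forall u w, lin (fun v => G u v w)) ->
  (forall u v, lin (G u v)) ->
  swd (lt (rt a y) y') (fun a1 b => swd b (fun a2 a3 => G a1 a2 a3)) =
  swd a (fun a1 b => swd b (fun a2 a3 => G (lt a1 y') a2 (rt a3 y))).
Proof.
move=> l1 l2 l3; have llt := bil_ltrans H.
rewrite swd_ltrans; last first.
  by split=> u; [apply: lin_swg => a2 a3; exact: l1 | exact: lin_swx (@lin_id _ _)].
rewrite swd_rtrans; last first.
  split=> u; last exact: lin_swx (@lin_id _ _).
  by apply: lin_swg => a2 a3; exact: lin_comp (l1 _ _) (llt.1 _).
apply: (eq_sw (H := dualH H)) => a1 b; rewrite swd_rtrans //.
Qed.

Lemma swd_sw_exch (W : lmodType F) a h (K : vB -> vB -> vB -> vB -> vB -> vB -> W) :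
  swd a (fun a1 b => swd b (fun a2 a3 => sw2 (DeltaH H) h (fun h1 w =>
     sw2 (DeltaH H) w (fun h2 h3 => K a1 a2 a3 h1 h2 h3)))) =
  sw2 (DeltaH H) h (fun h1 w => sw2 (DeltaH H) w (fun h2 h3 =>
     swd a (fun a1 b => swd b (fun a2 a3 => K a1 a2 a3 h1 h2 h3)))).
Proof.
transitivity (swd a (fun a1 b => sw2 (DeltaH H) h (fun h1 w => sw2 (DeltaH H) w (fun h2 h3 =>
   swd b (fun a2 a3 => K a1 a2 a3 h1 h2 h3))))).
  apply: (eq_sw (H := dualH H)) => a1 b; rewrite -(sw_exch (H' := dualH H)).
  by apply: eq_sw => h1 w; rewrite -(sw_exch (H' := dualH H)).
rewrite -(sw_exch (H' := dualH H)); apply: eq_sw => h1 w.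
by rewrite -(sw_exch (H' := dualH H)).
Qed.

End TranslationSweedler.

(** * Relations between edge operators and their products *)

Section Relations.
Variables (F : fieldType) (n : nat) (H : hopfData F n) (E : finType).
Hypothesis HH : isHopf H.
Hypothesis SS : forall x, SH H (SH H x) = x.
Local Notation vB := (vec F 'I_n).
Local Notation TE := (vec F {ffun E -> ('I_n * 'I_n)%type}).
Local Notation "x ** y" := (mulH H x y) (at level 40, left associativity).
Local Notation S := (SH H).
Local Notation eps := (epsH H).
Local Notation one := (oneH H).
Local Notation sw x g := (sw2 (DeltaH H) x g).
Local Notation swd x g := (sw2 (DeltaH (dualH H)) x g).
Local Notation mE := (@mulHE F n H E).
Local Notation lt := (ltrans H).
Local Notation rt := (rtrans H).
Local Notation rho := (@rho F n H E).
Local Notation sig := (@sig F n H E).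
Local Notation cprod := (@cprod F n H E).
Local Notation rhos := (cprod H rho).
Local Notation sigs := (cprod (dualH H) sig).
Local Notation oneE := (oneHE H E).
Implicit Types (x y z h a : vB) (o d : E * bool) (X Y Z : TE) (s t : seq (E * bool)).

Let HD := dual_isHopf HH.
Let mA := mEA HH SS (E := E).
Let m1 := mE1 HH SS (E := E).
Let mr1 := mEr1 HH SS (E := E).
Let lm : bil mE := bil_mE H E.
Let lrho := @lin_rho F n H E.
Let lsig := @lin_sig F n H E.
Let llt := bil_ltrans H.
Let lrt := bil_rtrans H.

Definition flip o : E * bool := (o.1, ~~ o.2).

Definition cm X Y := mE X Y = mE Y X.

Lemma cm_sym X Y : cm X Y -> cm Y X. Proof. by move=> c; rewrite /cm c. Qed.

Lemma cm_one X : cm X oneE. Proof. by rewrite /cm m1 mr1. Qed.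

Lemma cm_scale X (c : F) Y : cm X Y -> cm X (c *: Y).
Proof. by rewrite /cm => cY; rewrite (linZ _ _ (lm.1 _)) (linZ _ _ (lm.2 _)) cY. Qed.

Lemma cm_sum X (I : Type) (r : seq I) (G : I -> TE) :
  (forall i, cm X (G i)) -> cm X (\sum_(i <- r) G i).
Proof.
move=> h; rewrite /cm (lin_sum _ _ _ (lm.1 X)) (lin_sum _ _ _ (lm.2 X)).
by apply: eq_bigr => i _; exact: h.
Qed.

Lemma cm_sw (K : hopfData F n) X z (G : vB -> vB -> TE) :
  (forall a b, cm X (G a b)) -> cm X (sw2 (DeltaH K) z G).
Proof. by move=> h; apply: cm_sum => p; apply: cm_scale. Qed.

Lemma cm_mul X Y Z : cm X Y -> cm X Z -> cm X (mE Y Z).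
Proof. by rewrite /cm => cY cZ; rewrite -mA cY mA cZ mA. Qed.

Lemma cm_cprod K (r : E * bool -> vB -> TE) X s z :
  (forall o x, o \in s -> cm X (r o x)) -> cm X (cprod K r s z).
Proof.
elim: s z => [|o s IH] z h /=; first by apply: cm_scale; apply: cm_one.
apply: cm_sw => a b; apply: cm_mul; first by apply: h; rewrite inE eqxx.
by apply: IH => o' x os; apply: h; rewrite inE os orbT.
Qed.

Lemma cm_disjoint e e' X Y : e != e' ->
  supp (oneHeis H) (pred1 e) X -> supp (oneHeis H) (pred1 e') Y -> cm X Y.
Proof.
move=> ne sX sY; apply: (disjoint_supp HH SS (P := pred1 e) (Q := pred1 e') _ sX sY).2.
by move=> x /eqP ->.
Qed.

Lemma rho_rho_ne o o' x y : o.1 != o'.1 -> cm (rho o x) (rho o' y).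
Proof. by move=> ne; apply: (cm_disjoint ne); apply: supp_tat. Qed.

Lemma sig_sig_ne o o' x y : o.1 != o'.1 -> cm (sig o x) (sig o' y).
Proof. by move=> ne; apply: (cm_disjoint ne); apply: supp_tat. Qed.

Lemma rho_sig_ne o o' x y : o.1 != o'.1 -> cm (rho o x) (sig o' y).
Proof. by move=> ne; apply: (cm_disjoint ne); apply: supp_tat. Qed.

Lemma at_mul e u v : mE (atE H e u) (atE H e v) = atE H e (mulHeis H u v).
Proof.
apply: (tat_mul (one := oneHeis H)); first exact: bil_mulHeis.
exact: mulHeis1X.
Qed.

Lemma rho_rho_opp o x y : cm (rho o x) (rho (flip o) y).
Proof. by rewrite /cm !at_mul rho0_comm. Qed.

Lemma sig_sig_opp o x y : cm (sig o x) (sig (flip o) y).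
Proof. by rewrite /cm !at_mul sig0_comm. Qed.

Lemma rho_mul o x y : rho o (x ** y) = mE (rho o x) (rho o y).
Proof. by rewrite at_mul -rho0_mul. Qed.

Lemma sig_mul o x y : sig o (mulH (dualH H) x y) = mE (sig o x) (sig o y).
Proof. by rewrite at_mul -sig0_mul. Qed.

Lemma rho_one o : rho o one = oneE.
Proof. by rewrite -[LHS]/(atE H o.1 (rho0 H o.2 one)) rho0_one //; apply: tat_one. Qed.

Lemma sig_one o : sig o (oneH (dualH H)) = oneE.
Proof. by rewrite -[LHS]/(atE H o.1 (sig0 H o.2 (oneH (dualH H)))) sig0_one //; apply: tat_one. Qed.

Section Cprod.
Variables (K : hopfData F n) (r : E * bool -> vB -> TE).
Hypothesis HK : isHopf K.
Hypothesis lr : forall o, lin (r o).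

Lemma cprod1 o z : cprod K r [:: o] z = r o z.
Proof.
rewrite /= -[RHS](sw_counitr HK (g := r o)) //.
by apply: eq_sw => a b; rewrite (linZ _ _ (lm.2 _)) mr1.
Qed.

Lemma cprod_cat s t z : cprod K r (s ++ t) z =
  sw2 (DeltaH K) z (fun z1 z2 => mE (cprod K r s z1) (cprod K r t z2)).
Proof.
have lc := @lin_cprod F n H E K r.
elim: s z => [|o s IH] z /=.
  rewrite -[LHS](sw_counitl HK (g := cprod K r t)) //.
  by apply: eq_sw => a b; rewrite (linZ _ _ (lm.1 _)) m1.
transitivity (sw2 (DeltaH K) z (fun z1 z2 => sw2 (DeltaH K) z2 (fun z3 z4 =>
   mE (mE (r o z1) (cprod K r s z3)) (cprod K r t z4)))).
  apply: eq_sw => z1 z2; rewrite IH (sw_lin _ _ (lm.2 _)).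
  by apply: eq_sw => z3 z4; rewrite mA.
rewrite -(sw_coassoc HK); apply: eq_sw => u z4.
by rewrite (sw_lin _ _ (lm.1 _)).
Qed.

Hypothesis r_mul : forall o x y, r o (mulH K x y) = mE (r o x) (r o y).
Hypothesis r_one : forall o, r o (oneH K) = oneE.
Hypothesis r_ne : forall o o' x y, o.1 != o'.1 -> cm (r o x) (r o' y).

(** Operators on distinct edges commute, so a convolution product of algebra maps over distinct
    edges is an algebra map. *)
Lemma cprod_mul s x y : uniq (map fst s) ->
  cprod K r s (mulH K x y) = mE (cprod K r s x) (cprod K r s y).
Proof.
have lc := @lin_cprod F n H E K r.
elim: s x y => [|o s IH] x y /=.
  by move=> _; rewrite (eps_mul HK) (linZ _ _ (lm.1 _)) (linZ _ _ (lm.2 _)) m1 scalerA.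
move=> /andP[no us].
rewrite (sw_mul HK); last first.
  by split=> u; [exact: lin_comp (lm.1 _) (lr _) | exact: lin_comp (lm.2 _) (lc _)].
rewrite (sw_lin _ _ (lm.1 _)); apply: eq_sw => x1 x2.
rewrite (sw_lin _ _ (lm.2 _)); apply: eq_sw => y1 y2.
rewrite r_mul IH // !mA; congr mE; rewrite -!mA; congr mE.
apply: cm_cprod => o' z os; apply: r_ne; apply: contraNneq no => ->.
by apply: map_f.
Qed.

Lemma cprod_one s : cprod K r s (oneH K) = oneE.
Proof.
have lc := @lin_cprod F n H E K r.
elim: s => [|o s IH] /=; first by rewrite (eps_one HK) scale1r.
rewrite (sw_one HK); first by rewrite r_one IH m1.
by split=> u; [exact: lin_comp (lm.1 _) (lr _) | exact: lin_comp (lm.2 _) (lc _)].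
Qed.

End Cprod.

Lemma sig_rho_same o a h : mE (sig o a) (rho o h) =
  sw h (fun h1 h2 => mE (rho o h1) (sig o (lt a h2))).
Proof.
rewrite at_mul sig0_rho0_same // (sw_lin _ _ (lin_at_ H _)).
by apply: eq_sw => h1 h2; rewrite at_mul.
Qed.

Lemma sig_rho_opp o a h : mE (sig (flip o) a) (rho o h) =
  sw h (fun h1 h2 => mE (rho o h2) (sig (flip o) (rt a (S h1)))).
Proof.
rewrite at_mul sig0_rho0_opp // (sw_lin _ _ (lin_at_ H _)).
by apply: eq_sw => h1 h2; rewrite at_mul.
Qed.

(** [sig_rho_same] solved for the other order: reinserting it on the right produces h_(2) S(h_(3))
    in a translation, with indices in the order that the opposite antipode identity cancels. *)
Lemma rho_sig_same o a h : mE (rho o h) (sig o a) =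
  sw h (fun h1 h2 => mE (sig o (lt a (S h2))) (rho o h1)).
Proof.
under [RHS]eq_sw => h1 h2 do rewrite sig_rho_same.
rewrite (sw_coassoc HH).
transitivity (sw h (fun h1 u => eps u *: mE (rho o h1) (sig o a))).
  by rewrite (sw_counitr HH (g := fun h1 => mE (rho o h1) (sig o a))) //; exact: lin_comp (lm.1 _) (lrho _).
apply: eq_sw => h1 u; rewrite -{1}(lt_one HH a).
have lg : lin (fun z => mE (rho o h1) (sig o (lt a z))).
  exact: lin_comp (lm.2 _) (lin_comp (lsig _) (llt.2 _)).
rewrite -(sw_Sl_op HH SS u lg); apply: eq_sw => h2 h3.
by rewrite lt_lt.
Qed.

Lemma rho_sig_opp o a h : mE (rho o h) (sig (flip o) a) =
  sw h (fun h1 h2 => mE (sig (flip o) (rt a h1)) (rho o h2)).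
Proof.
under [RHS]eq_sw => h1 h2 do rewrite sig_rho_opp.
rewrite -(sw_coassoc HH).
transitivity (sw h (fun u h3 => eps u *: mE (rho o h3) (sig (flip o) a))).
  by rewrite (sw_counitl HH (g := fun h3 => mE (rho o h3) (sig (flip o) a))) //; exact: lin_comp (lm.1 _) (lrho _).
apply: eq_sw => u h3; rewrite -{1}(rt_one HH a).
have lg : lin (fun z => mE (rho o h3) (sig (flip o) (rt a z))).
  exact: lin_comp (lm.2 _) (lin_comp (lsig _) (lrt.2 _)).
rewrite -(sw_Sl_op HH SS u lg); apply: eq_sw => h1 h2.
by rewrite rt_rt.
Qed.

(** The translations by h5 and S(h4) act on facing sides of neighbouring legs of a, so [swd_middle]
    merges them to h5 S(h4). After coassociativity h4 and h5 are neighbouring legs of h and the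
    product cancels. *)
Lemma corner_cancel (W : lmodType F) (G : vB -> vB -> vB -> vB -> W) h a :
  (forall v h1 h2, lin (fun u => G u v h1 h2)) ->
  (forall u h1 h2, lin (fun v => G u v h1 h2)) ->
  (forall u v h1, lin (fun h2 => G u v h1 h2)) ->
  swd a (fun a1 a2 => sw h (fun h1 h2 => sw h1 (fun h3 h4 => sw h2 (fun h5 h6 =>
    G (rt a1 h5) (lt a2 (S h4)) h3 h6)))) =
  sw h (fun h1 h2 => swd a (fun a1 a2 => G a1 a2 h1 h2)).
Proof.
move=> lG1 lG2 lG4.
pose K1 h3 h4 h2 := swd a (fun a1 a2 => sw h2 (fun h5 h6 =>
  G (rt a1 h5) (lt a2 (S h4)) h3 h6)).
pose K2 h3 h4 h5 h6 := swd a (fun a1 a2 => G (rt a1 h5) (lt a2 (S h4)) h3 h6).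
transitivity (sw h (fun h3 u => sw u (fun w h6 => sw w (fun h4 h5 => K2 h3 h4 h5 h6)))).
  rewrite -[LHS](sw_exch (H' := dualH H)).
  transitivity (sw h (fun h1 h2 => sw h1 (fun h3 h4 => K1 h3 h4 h2))).
    by apply: eq_sw => h1 h2; rewrite (sw_exch (H' := dualH H)).
  transitivity (sw h (fun h3 u => sw u (fun h4 h2 => K1 h3 h4 h2))).
    exact: (sw_coassoc HH h K1).
  apply: eq_sw => h3 u.
  transitivity (sw u (fun h4 h2 => sw h2 (fun h5 h6 => K2 h3 h4 h5 h6))); last first.
    exact: (esym (sw_coassoc HH u (K2 h3))).
  by apply: eq_sw => h4 h2; rewrite /K1 -(sw_exch (H' := dualH H)).
apply: eq_sw => h3 u.
transitivity (sw u (fun w h6 => eps w *: swd a (fun a1 a2 => G a1 a2 h3 h6))).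
  apply: eq_sw => w h6.
  have lg : lin (fun z => swd a (fun a1 a2 => G (rt a1 z) a2 h3 h6)).
    by apply: lin_swg => a1 a2; exact: lin_comp (lG1 _ _ _) (lrt.2 _).
  transitivity (sw w (fun h4 h5 => swd a (fun a1 a2 => G (rt a1 (h5 ** S h4)) a2 h3 h6))).
    apply: eq_sw => h4 h5; apply: (swd_middle HH a h5 (S h4) (G := fun p q => G p q h3 h6)).
    by split=> v; [exact: lG1 | exact: lG2].
  rewrite (sw_Sr_op HH SS w lg); congr (_ *: _).
  by apply: (eq_sw (H := dualH H)) => a1 a2; rewrite (rt_one HH).
rewrite (sw_counitl HH (g := fun h6 => swd a (fun a1 a2 => G a1 a2 h3 h6))) //.
by apply: lin_swg => a1 a2; exact: lG4.
Qed.

(* At a corner that carries no cilium the two crossings of the vertex loop with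
   the face cancel. *)
Lemma corner_comm o o' h a : o.1 != o'.1 -> cm (rhos [:: o; o'] h) (sigs [:: flip o'; o] a).
Proof.
move=> ne; have ne' : o'.1 != o.1 by rewrite eq_sym.
have R2 x : rhos [:: o; o'] x = sw x (fun h1 h2 => mE (rho o h1) (rho o' h2)).
  rewrite [LHS]/=; apply: eq_sw => h1 h2.
  by rewrite -[X in mE _ X]/(rhos [:: o'] h2) cprod1.
have S2 x : sigs [:: flip o'; o] x = swd x (fun a1 a2 => mE (sig (flip o') a1) (sig o a2)).
  rewrite [LHS]/=; apply: (eq_sw (H := dualH H)) => h1 h2.
  by rewrite -[X in mE _ X]/(sigs [:: o] h2) cprod1.
rewrite /cm R2 S2.
pose G (u v : vB) h1 h2 := mE (mE (sig (flip o') u) (sig o v)) (mE (rho o h1) (rho o' h2)).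
transitivity (sw h (fun h1 h2 => swd a (fun a1 a2 => G a1 a2 h1 h2))); last first.
  rewrite (sw_lin _ _ (lm.2 _)); apply: eq_sw => h1 h2.
  by rewrite (sw_lin _ _ (lm.1 _)).
have lG1 u h1 h2 : lin (fun v => G u v h1 h2).
  exact: lin_comp (lm.1 _) (lin_comp (lm.2 _) (lsig _)).
have lG2 v h1 h2 : lin (fun u => G u v h1 h2).
  exact: lin_comp (lm.1 _) (lin_comp (lm.1 _) (lsig _)).
have lG4 u v h1 : lin (fun h2 => G u v h1 h2).
  exact: lin_comp (lm.2 _) (lin_comp (lm.2 _) (lrho _)).
transitivity (swd a (fun a1 a2 => sw h (fun h1 h2 => sw h1 (fun h3 h4 => sw h2 (fun h5 h6 =>
    G (rt a1 h5) (lt a2 (S h4)) h3 h6))))).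
  rewrite (sw_lin _ _ (lm.2 _)); apply: (eq_sw (H := dualH H)) => a1 a2.
  rewrite (sw_lin _ _ (lm.1 _)); apply: eq_sw => h1 h2.
  transitivity (mE (mE (rho o h1) (mE (rho o' h2) (sig (flip o') a1))) (sig o a2)).
    by rewrite !mA.
  rewrite rho_sig_opp (sw_lin _ _ (lm.2 _)) (sw_lin _ _ (lm.1 _)).
  transitivity (sw h2 (fun h5 h6 => sw h1 (fun h3 h4 =>
    G (rt a1 h5) (lt a2 (S h4)) h3 h6))); last exact: sw_exch.
  apply: eq_sw => h5 h6.
  transitivity (mE (sig (flip o') (rt a1 h5)) (mE (mE (rho o h1) (sig o a2)) (rho o' h6))).
    have c1 : cm (rho o h1) (sig (flip o') (rt a1 h5)) by apply: rho_sig_ne.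
    have c2 : cm (rho o' h6) (sig o a2) by apply: rho_sig_ne.
    by rewrite -(mA (rho o h1)) c1 !mA c2.
  rewrite rho_sig_same (sw_lin _ _ (lm.1 _)) (sw_lin _ _ (lm.2 _)).
  by apply: eq_sw => h3 h4; rewrite /G !mA.
by apply: corner_cancel => *; [exact: lG2 | exact: lG1 | exact: lG4].
Qed.

(** Only the last factor of the vertex loop lies on the edge of [hi], so a single translation
    appears and nothing cancels it; [rhos_sig_lo] is the counterpart at the first factor. *)
Lemma rhos_sig_hi s hi a h : hi.1 \notin map fst s ->
  mE (rhos (rcons s hi) h) (sig hi a) =
  sw h (fun h1 h2 => mE (sig hi (lt a (S h2))) (rhos (rcons s hi) h1)).
Proof.
move=> nhi; rewrite -cats1.
have R x : rhos (s ++ [:: hi]) x = sw x (fun h1 h2 => mE (rhos s h1) (rho hi h2)).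
  by rewrite cprod_cat //; apply: eq_sw => h1 h2; rewrite cprod1.
rewrite R (sw_lin _ _ (lm.1 _)).
transitivity (sw h (fun h1 h2 => sw h2 (fun h3 h4 =>
   mE (sig hi (lt a (S h4))) (mE (rhos s h1) (rho hi h3))))).
  apply: eq_sw => h1 h2; rewrite mA rho_sig_same (sw_lin _ _ (lm.2 _)).
  apply: eq_sw => h3 h4; rewrite -!mA; congr mE; apply: cm_sym; apply: cm_cprod => o x os.
  apply: cm_sym; apply: rho_sig_ne; apply: contraNneq nhi => <-; exact: map_f.
rewrite -(sw_coassoc HH); apply: eq_sw => u h4.
by rewrite R (sw_lin _ _ (lm.2 _)).
Qed.

Lemma rhos_sig_lo s lo a h : lo.1 \notin map fst s ->
  mE (rhos (lo :: s) h) (sig (flip lo) a) =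
  sw h (fun h1 h2 => mE (sig (flip lo) (rt a h1)) (rhos (lo :: s) h2)).
Proof.
move=> nlo.
have R x : rhos (lo :: s) x = sw x (fun h1 h2 => mE (rho lo h1) (rhos s h2)) by [].
rewrite R (sw_lin _ _ (lm.1 _)).
transitivity (sw h (fun h1 h2 => sw h1 (fun h3 h4 =>
   mE (sig (flip lo) (rt a h3)) (mE (rho lo h4) (rhos s h2))))).
  apply: eq_sw => h1 h2.
  have c : cm (sig (flip lo) a) (rhos s h2).
    apply: cm_cprod => o x os; apply: cm_sym; apply: rho_sig_ne.
    by apply: contraNneq nlo => /= <-; exact: map_f.
  rewrite mA -c -mA rho_sig_opp (sw_lin _ _ (lm.1 _)).
  by apply: eq_sw => h3 h4; rewrite mA.
rewrite (sw_coassoc HH); apply: eq_sw => h3 u.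
by rewrite R (sw_lin _ _ (lm.2 _)).
Qed.

(* Only the first and the last edge end at v see the cilium: they contribute the two
   translations of the cross relation of D(H). *)
Lemma straighten lo c hi t h a : uniq (map fst (lo :: rcons c hi)) ->
  (forall x b, cm (rhos (lo :: rcons c hi) x) (sigs t b)) ->
  mE (rhos (lo :: rcons c hi) h) (sigs (hi :: rcons t (flip lo)) a) =
  sw h (fun h1 w => sw w (fun h2 h3 =>
    mE (sigs (hi :: rcons t (flip lo)) (lt (rt a h1) (S h3))) (rhos (lo :: rcons c hi) h2))).
Proof.
move=> us ct; set R := rhos (lo :: rcons c hi); set T := sigs (hi :: rcons t (flip lo)).
have lc := @lin_cprod F n H E.
have nlo : lo.1 \notin map fst (rcons c hi) by move: us => /= /andP[].
have nhi : hi.1 \notin map fst (lo :: c).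
  by move: us; rewrite -rcons_cons map_rcons rcons_uniq => /andP[].
have Tp x : T x = swd x (fun a1 b => swd b (fun a2 a3 =>
    mE (sig hi a1) (mE (sigs t a2) (sig (flip lo) a3)))).
  rewrite /T [LHS]/=; apply: (eq_sw (H := dualH H)) => a1 b.
  rewrite -cats1 cprod_cat // (sw_lin _ _ (lm.2 _)).
  apply: (eq_sw (H := dualH H)) => a2 a3.
  by rewrite -[X in mE _ (mE _ X)]/(sigs [:: flip lo] a3) cprod1.
have TT x y y' : T (lt (rt x y) y') = swd x (fun a1 b => swd b (fun a2 a3 =>
    mE (sig hi (lt a1 y')) (mE (sigs t a2) (sig (flip lo) (rt a3 y))))).
  rewrite Tp; apply: (swd_sandwich HH x y y' (G := fun a1 a2 a3 =>
    mE (sig hi a1) (mE (sigs t a2) (sig (flip lo) a3)))) => u v.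
  - exact: lin_comp (lm.1 _) (lsig _).
  - exact: lin_comp (lm.2 _) (lin_comp (lm.1 _) (lc _ _ _)).
  exact: lin_comp (lm.2 _) (lin_comp (lm.2 _) (lsig _)).
rewrite Tp (sw_lin _ _ (lm.2 _)).
transitivity (swd a (fun a1 b => swd b (fun a2 a3 => sw h (fun h1 w => sw w (fun h2 h3 =>
   mE (mE (sig hi (lt a1 (S h3))) (mE (sigs t a2) (sig (flip lo) (rt a3 h1)))) (R h2)))))).
  apply: (eq_sw (H := dualH H)) => a1 b; rewrite (sw_lin _ _ (lm.2 _)).
  apply: (eq_sw (H := dualH H)) => a2 a3.
  rewrite -[LHS]mA /R -{1}rcons_cons rhos_sig_hi // (sw_lin _ _ (lm.1 _)) -(sw_coassoc HH).
  apply: eq_sw => u h3; rewrite mA -[X in mE _ X]mA rcons_cons ct mA.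
  rewrite rhos_sig_lo // (sw_lin _ _ (lm.2 _)) (sw_lin _ _ (lm.2 _)).
  by apply: eq_sw => h1 h2; rewrite !mA.
rewrite [LHS](swd_sw_exch H a h (fun a1 a2 a3 h1 h2 h3 =>
   mE (mE (sig hi (lt a1 (S h3))) (mE (sigs t a2) (sig (flip lo) (rt a3 h1)))) (R h2))).
apply: eq_sw => h1 w; apply: eq_sw => h2 h3.
rewrite TT (sw_lin _ _ (lm.1 _)); apply: (eq_sw (H := dualH H)) => a1 b.
by rewrite (sw_lin _ _ (lm.1 _)).
Qed.

End Relations.

(** * Commutation relations on the ribbon graph *)

Section GraphLemmas.
Variables (V E : finType) (G : ribbon V E).
Hypothesis Gcil : ciliated G.
Hypothesis Greg : regular G.
Implicit Types (v w : V) (d o : E * bool).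

Lemma mem_cord v o : (o \in cord G v) = (endv G o == v).
Proof. by case: (Gcil v). Qed.

Lemma uniq_cord v : uniq (cord G v).
Proof. by case: (Gcil v). Qed.

Lemma flipK o : flip (flip o) = o.
Proof. by case: o => e b; rewrite /flip /= negbK. Qed.

Lemma endv_flip o : endv G (flip o) != endv G o.
Proof.
case: Greg => h _ _ _; case: o => e []; rewrite /endv /=; first exact: h.
by rewrite eq_sym.
Qed.

Lemma same_edge o o' : o.1 = o'.1 -> o' = o \/ o' = flip o.
Proof.
case: o o' => e b [e' b'] /= <-; case: (eqVneq b' b) => [->|ne]; first by left.
by right; rewrite /flip /=; case: b b' ne => [] [].
Qed.

Lemma uniq_cord_edges v : uniq (map fst (cord G v)).
Proof.
rewrite map_inj_in_uniq ?uniq_cord // => o o'; rewrite !mem_cord => /eqP ov /eqP o'v.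
case/same_edge => // e; have := endv_flip o.
by rewrite -e ov o'v eqxx.
Qed.

Lemma faceNextE d : faceNext G d = flip (next (cord G (endv G d)) d).
Proof. by []. Qed.

Lemma endv_next d : endv G (next (cord G (endv G d)) d) = endv G d.
Proof. by apply/eqP; rewrite -mem_cord mem_next mem_cord. Qed.

Lemma face_start d : endv G (flip (faceNext G d)) = endv G d.
Proof. by rewrite faceNextE flipK endv_next. Qed.

Lemma faceNext_inj : injective (faceNext G).
Proof.
move=> d d' e; have ev : endv G d = endv G d' by rewrite -face_start e face_start.
move: e; rewrite !faceNextE -ev => /(congr1 (@flip E)); rewrite !flipK.
by move/(congr1 (prev (cord G (endv G d)))); rewrite !prev_next ?uniq_cord.
Qed.

Lemma uniq_face_edges v : uniq (map fst (faceOf G v)).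
Proof. by rewrite /faceOf; case: Greg => _ _ h _; case: cilDart. Qed.

Lemma cilDart_unique v w d : cilIn G v d -> cilIn G w d -> v = w.
Proof.
case: Greg => _ _ _ /(_ d) h vd wd.
have /card_le1_eqP c : (#|[pred v | cilIn G v d]| <= 1)%N by rewrite h.
exact: c.
Qed.

(** A common dart puts both cilia on one face, and a face contains exactly one cilium. Injectivity
    of [faceNext] makes orbits symmetric. *)
Lemma mem_faceOf_unique v w d : d \in faceOf G v -> d \in faceOf G w -> v = w.
Proof.
rewrite /faceOf => dv dw; apply: (@cilDart_unique v w d); rewrite /cilIn.
  by case: cilDart dv => // d0; rewrite -!fconnect_orbit (fconnect_sym faceNext_inj).
by case: cilDart dw => // d0; rewrite -!fconnect_orbit (fconnect_sym faceNext_inj).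
Qed.

Lemma faceOf_cil v d : cilDart G v = Some d ->
  exists t, [/\ faceOf G v = d :: t, fpath (faceNext G) d t & faceNext G (last d t) = d].
Proof.
rewrite /faceOf => ->; have := cycle_orbit faceNext_inj d.
have : d \in orbit (faceNext G) d by rewrite -fconnect_orbit.
rewrite /orbit -orderSpred /= => _; rewrite rcons_path => /andP[p /eqP l].
by exists (traject (faceNext G) (faceNext G d) (order (faceNext G) d).-1).
Qed.

Lemma next_split (T : eqType) (s1 s2 : seq T) (d x : T) : uniq (s1 ++ d :: s2) ->
  next (s1 ++ d :: s2) d = head (head x (s1 ++ d :: s2)) s2.
Proof.
move=> u; rewrite next_nth mem_cat inE eqxx orbT.
have nd : d \notin s1.
  by move: u; rewrite cat_uniq => /and3P[_ /hasPn/(_ d)]; rewrite inE eqxx => /(_ isT).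
have ix : index d (s1 ++ d :: s2) = size s1 by rewrite index_cat (negbTE nd) /= eqxx addn0.
rewrite ix; case: s1 {u nd ix} => [|y s1] /=; first by rewrite nth0.
by rewrite nth_cat ltnNge leqnSn /= subSnn /= nth0.
Qed.

(** Away from the cilium the cyclic successor of d is its successor in the linear order, without
    wrap-around. *)
Lemma faceNext_corner v d : endv G d = v -> cilDart G v != Some (faceNext G d) ->
  exists s1 o s2, cord G v = s1 ++ d :: o :: s2 /\ faceNext G d = flip o.
Proof.
move=> dv nc; have dc : d \in cord G v by rewrite mem_cord dv.
have uc := uniq_cord v; move: nc; rewrite /cilDart faceNextE dv.
case/splitPr: dc uc => s1 [|o s2] uc; rewrite (next_split d uc) /=; last first.
  by move=> _; exists s1, o, s2.
by case: s1 {uc} => [|y s1] /=; rewrite eqxx.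
Qed.

(** The face f(v) leaves v through the lowest edge end; by injectivity of the cyclic successor it
    can close up only through the highest one. *)
Lemma face_at_cilium v d : cilDart G v = Some d -> exists lo c m hi,
  [/\ d = flip lo, cord G v = lo :: rcons c hi, faceOf G v = flip lo :: rcons m hi &
      fpath (faceNext G) d (rcons m hi)].
Proof.
move=> cd; have [t [ft pt lt]] := faceOf_cil cd.
have [lo [s [cv dlo]]] : exists lo s, cord G v = lo :: s /\ d = flip lo.
  by move: cd; rewrite /cilDart; case: cord => [|lo s] // [<-]; exists lo, s.
have [m [hi tE]] : exists m hi, t = rcons m hi.
  (* A face of length one would be a loop. *)
  case/lastP: t ft pt lt => [_ _ /= e|m hi _ _ _]; last by exists m, hi.
  by have := endv_flip d; rewrite -{1}e face_start eqxx.
subst t; exists lo; rewrite last_rcons in lt.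
have ehi : endv G hi = v.
  by rewrite -face_start lt dlo flipK; apply/eqP; rewrite -mem_cord cv inE eqxx.
have nx : next (cord G v) hi = lo.
  by move: lt; rewrite faceNextE ehi dlo => /(congr1 (@flip E)); rewrite !flipK.
have nlo : hi != lo.
  have := uniq_face_edges v; rewrite ft /= map_rcons mem_rcons inE negb_or.
  by case/andP=> /andP[+ _] _; rewrite dlo /=; apply: contraNneq => ->.
have : hi \in cord G v by rewrite mem_cord ehi.
rewrite cv inE (negbTE nlo) /= => his; have uc := uniq_cord v; rewrite cv in uc nx.
case/splitPr: his uc nx cv => s1 s2 uc nx cv.
have := next_split lo (s1 := lo :: s1) uc; rewrite nx /=.
case: s2 uc nx cv => [|o s2] uc nx cv /=; last first.
  by move=> e; move: uc; rewrite -e /= mem_cat !inE eqxx !orbT.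
by move=> _; exists s1, m, hi; rewrite -cats1 -dlo.
Qed.

End GraphLemmas.

Section GraphRelations.
Variables (F : fieldType) (n : nat) (H : hopfData F n).
Variables (V E : finType) (G : ribbon V E).
Hypothesis HH : isHopf H.
Hypothesis SS : forall x, SH H (SH H x) = x.
Hypothesis Gcil : ciliated G.
Hypothesis Greg : regular G.
Local Notation vB := (vec F 'I_n).
Local Notation S := (SH H).
Local Notation eps := (epsH H).
Local Notation sw x g := (sw2 (DeltaH H) x g).
Local Notation mE := (@mulHE F n H E).
Local Notation cm := (@cm F n H E).
Local Notation rho := (@rho F n H E).
Local Notation sig := (@sig F n H E).
Local Notation cprod := (@cprod F n H E).
Local Notation rhos := (cprod H rho).
Local Notation sigs := (cprod (dualH H) sig).
Implicit Types (v w : V) (d o : E * bool).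

Let HD := dual_isHopf HH.

Definition vhol v : vB -> _ := rhos (cord G v).
Definition fhol v : vB -> _ := sigs (rev (faceOf G v)).

(** On a shared edge the two loops cross opposite ends, where they act by left and by right
    multiplication. *)
Lemma vhol_comm v w x y : v != w -> cm (vhol v x) (vhol w y).
Proof.
move=> vw; apply: (cm_cprod HH SS) => o z ow; apply: cm_sym.
apply: (cm_cprod HH SS) => o' z' o'v.
have [e|ne] := eqVneq o.1 o'.1; last exact: rho_rho_ne.
case: (same_edge e) => e2; last by rewrite e2; apply: rho_rho_opp.
rewrite (mem_cord Gcil) in ow; rewrite (mem_cord Gcil) e2 (eqP ow) eq_sym in o'v.
by rewrite o'v in vw.
Qed.

(** The two faces have no common dart, so a shared edge is traversed in opposite directions and the
    two coregular actions commute. *)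
Lemma fhol_comm v w x y : v != w -> cm (fhol v x) (fhol w y).
Proof.
move=> vw; apply: (cm_cprod HH SS) => o z ow; apply: cm_sym.
apply: (cm_cprod HH SS) => o' z' o'v.
rewrite !mem_rev in ow o'v.
have [e|ne] := eqVneq o.1 o'.1; last exact: sig_sig_ne.
case: (same_edge e) => e2; last by rewrite e2; apply: sig_sig_opp.
by rewrite e2 in o'v; rewrite (mem_faceOf_unique Gcil Greg o'v ow) eqxx in vw.
Qed.

(** A face path that neither starts nor ends at v and avoids its cilium meets the edges at v in
    pairs: the dart arriving at v and the one leaving it next. Each pair commutes with the vertex
    loop by [corner_comm]. The induction is on the length because a visit consumes two darts. *)
Lemma path_comm v (s : seq (E * bool)) x a :
  sorted (frel (faceNext G)) s ->
  (forall d, cilDart G v = Some d -> d \notin s) ->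
  (if s is d :: _ then endv G (flip d) != v else true) ->
  (if s is d :: s' then endv G (last d s') != v else true) ->
  cm (vhol v x) (sigs (rev s) a).
Proof.
have cc := cprod_cat HH SS sig HD.
move: {2}_.+1 (ltnSn (size s)) => k; elim: k s x a => // k IH [|d s] x a.
  by move=> *; apply: cm_scale; apply: (cm_one HH SS).
rewrite /= ltnS => sk ps nc st en.
have [dv|dv] := eqVneq (endv G d) v; last first.
  rewrite rev_cons -cats1 cc; apply: cm_sw => a1 a2; apply: (cm_mul HH SS).
    apply: IH => //.
    - exact: path_sorted ps.
    - by move=> d0 /nc; rewrite inE negb_or => /andP[].
    - by case: s ps {nc sk en} => //= d' s /andP[/eqP <- _]; rewrite face_start.
    by case: s en {ps nc sk}.
  apply: (cm_cprod HH SS) => d' y; rewrite inE => /eqP ->; apply: cm_sym.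
  apply: (cm_cprod HH SS) => o y' oc; apply: cm_sym; apply: (rho_sig_ne HH SS).
  move: oc; rewrite mem_cord // => /eqP oc.
  apply/eqP=> e; case: (same_edge e) => e2; first by rewrite e2 oc eqxx in dv.
  by rewrite e2 flipK oc eqxx in st.
(* A visit to v: the path does not end here, so it continues with d' through the edge end following
   d. All other factors of the vertex loop lie on other edges. *)
case: s ps sk nc en => [|d' s]; first by rewrite dv eqxx.
move=> /= /andP[/eqP dd' ps] sk nc en.
have ncil : cilDart G v != Some (faceNext G d).
  by apply/eqP=> /nc; rewrite dd' !inE eqxx orbT.
have [s1 [o [s2 [cv fo]]]] := faceNext_corner Gcil dv ncil.
have d'o : d' = flip o by rewrite -dd'.
have uc := uniq_cord_edges Gcil Greg v; rewrite cv map_cat /= in uc.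
have ov : endv G o = v by apply/eqP; rewrite -(mem_cord Gcil) cv mem_cat !inE eqxx !orbT.
rewrite !rev_cons -!cats1 -catA cc; apply: cm_sw => a1 a2; apply: (cm_mul HH SS).
  apply: IH.
  - by apply: leq_trans (ltnW sk).
  - exact: path_sorted ps.
  - by move=> d0 /nc; rewrite !inE !negb_or => /and3P[].
  - case: s ps {nc sk en} => //= d2 s /andP[/eqP <- _]; rewrite face_start // d'o.
    by rewrite -ov endv_flip.
  by case: s en {ps nc sk}.
move: uc; rewrite cat_uniq => /and3P[_ /hasPn hs]; rewrite /= inE negb_or.
move=> /andP[/andP[neq_do nd2] /andP[no2 _]].
have sep o1 : o1 \in s1 ++ s2 -> (o1.1 != d.1) /\ (o1.1 != o.1).
  rewrite mem_cat => /orP[] /(map_f fst) os; split; apply/eqP=> e; rewrite e in os.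
  - by have /= := hs d.1; rewrite inE eqxx os => /(_ isT).
  - by have /= := hs o.1; rewrite !inE eqxx orbT os => /(_ isT).
  - by rewrite os in nd2.
  by rewrite os in no2.
rewrite /vhol cv -[d :: o :: s2]/([:: d; o] ++ s2); apply: cm_sym.
have cr := cprod_cat HH SS rho HH.
have side o1 y : o1 \in s1 ++ s2 -> cm (sigs [:: d'; d] a2) (rho o1 y).
  move=> /sep [nd no]; apply: cm_sym; apply: (cm_cprod HH SS) => d2 y2.
  by rewrite !inE d'o => /orP[/eqP->|/eqP->]; apply: (rho_sig_ne HH SS).
rewrite cr; apply: cm_sw => x1 x2; apply: (cm_mul HH SS).
  by apply: (cm_cprod HH SS) => o1 y os; apply: side; rewrite mem_cat os.
rewrite cr; apply: cm_sw => x3 x4; apply: (cm_mul HH SS).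
  by apply: cm_sym; rewrite d'o; apply: (corner_comm HH SS).
by apply: (cm_cprod HH SS) => o1 y os; apply: side; rewrite mem_cat os orbT.
Qed.

(** f(w) starts and ends at w and does not pass the cilium of v, as faces of distinct vertices share
    no dart. *)
Lemma vhol_fhol_comm v w x a : v != w -> cm (vhol v x) (fhol w a).
Proof.
move=> vw; case cw: (cilDart G w) => [d|]; last first.
  rewrite /fhol /faceOf cw; apply: cm_scale; exact: (cm_one HH SS).
have [t [ft pt lt]] := faceOf_cil Gcil cw.
have dw : endv G (flip d) = w.
  move: cw; rewrite /cilDart; case e: (cord G w) => [|o s] // [<-].
  by rewrite -[(o.1, ~~ o.2)]/(flip o) flipK; apply/eqP; rewrite -(mem_cord Gcil) e inE eqxx.
rewrite /fhol; apply: path_comm; rewrite ft //=.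
- move=> d0 cv; rewrite -ft; apply/negP=> d0w.
  have d0v : d0 \in faceOf G v by rewrite /faceOf cv -fconnect_orbit connect0.
  by rewrite (mem_faceOf_unique Gcil Greg d0v d0w) eqxx in vw.
- by rewrite dw eq_sym.
by rewrite -(face_start Gcil) lt dw eq_sym.
Qed.

Lemma vhol_fhol v h a : mE (vhol v h) (fhol v a) =
  sw h (fun h1 u => sw u (fun h2 h3 =>
    mE (fhol v (ltrans H (rtrans H a h1) (S h3))) (vhol v h2))).
Proof.
have lm : bil mE := bil_mE H E.
(* At an isolated vertex both holonomies are scalars and the relation reduces to the opposite
   antipode identity. *)
case cv: (cilDart G v) => [d|]; last first.
  have c0 : cord G v = [::] by move: cv; rewrite /cilDart; case: cord.
  have vE x : vhol v x = eps x *: oneHE H E by rewrite /vhol c0.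
  have fE b : fhol v b = pairing b (oneH H) *: oneHE H E.
    by rewrite /fhol /faceOf cv pairing_oneH.
  have mm (p q : F) : mE (p *: oneHE H E) (q *: oneHE H E) = q *: (p *: oneHE H E).
    by rewrite (linZ _ _ (lm.2 _)) (linZ _ _ (lm.1 _)) (mE1 HH SS).
  rewrite vE fE mm scalerA mulrC -scalerA.
  rewrite -(sw_Sl_op HH SS h (g := fun z => pairing a z *: oneHE H E)); last by lint.
  apply: eq_sw => h1 u.
  rewrite -[LHS](sw_counitl HH (g := fun y => pairing a (mulH H (S y) h1) *: oneHE H E)); last by lint.
  apply: eq_sw => h2 h3; rewrite vE fE mm pairing_ltrans pairing_rtrans.
  by rewrite (hmulx1 HH).
have [lo [c [m [hi [dlo co fo pf]]]]] := face_at_cilium Gcil Greg cv.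
rewrite /vhol /fhol co fo rev_cons rev_rcons rcons_cons.
apply: (straighten HH SS); first by rewrite -co; exact: uniq_cord_edges.
move=> x b; rewrite -co -/(vhol v x).
have lov : endv G lo = v by apply/eqP; rewrite -(mem_cord Gcil) co inE eqxx.
have hiv : endv G hi = v.
  by apply/eqP; rewrite -(mem_cord Gcil) co inE mem_rcons inE eqxx orbT.
move: pf; rewrite rcons_path => /andP[pm /eqP lm'].
apply: path_comm.
- exact: path_sorted pm.
- move=> d0; rewrite cv => -[<-]; have := uniq_face_edges Greg v.
  rewrite fo => /map_uniq /= /andP[+ _]; rewrite mem_rcons inE negb_or dlo.
  by case/andP.
- case: m pm {fo lm'} => //= d2 m /andP[/eqP <- _]; rewrite (face_start Gcil) dlo -lov.
  exact: (endv_flip Greg).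
case: m pm lm' {fo} => //= d2 m _ e; rewrite -(face_start Gcil) e -hiv.
exact: (endv_flip Greg).
Qed.

End GraphRelations.

(** * The action of D(H) at a vertex *)

Section SweedlerCancellations.
Variables (F : fieldType) (n : nat) (H : hopfData F n).
Hypothesis HH : isHopf H.
Hypothesis SS : forall x, SH H (SH H x) = x.
Local Notation vB := (vec F 'I_n).
Local Notation "x ** y" := (mulH H x y) (at level 40, left associativity).
Local Notation S := (SH H).
Local Notation Sd := (SHd H).
Local Notation eps := (epsH H).
Local Notation one := (oneH H).
Local Notation sw x g := (sw2 (DeltaH H) x g).
Local Notation swd x g := (sw2 (DeltaH (dualH H)) x g).
Local Notation lt := (ltrans H).
Local Notation rt := (rtrans H).
Implicit Types (x y z h a : vB) (W : lmodType F).

Lemma lt_rt a y z : lt (rt a y) z = rt (lt a z) y.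
Proof.
by apply: pairing_inj => x; rewrite !(pairing_ltrans, pairing_rtrans) (hmulA HH).
Qed.

Lemma antipode_translate a q1 q3 d e :
  lt (rt (Sd (lt (rt a q1) (S q3))) (S d)) e = Sd (lt (rt a (S e ** q1)) (S q3 ** d)).
Proof.
apply: pairing_inj => x.
rewrite !(pairing_ltrans, pairing_rtrans, pairing_SHd) !(S_mul HH) SS.
by rewrite !(hmulA HH).
Qed.

(** The Sweedler identity behind [QR]. After coassociativity the translations are by S(e) q1 and
    S(q3) d, each formed from neighbouring legs of q, and both cancel. *)
Lemma left_cancel W (G : vB -> vB -> W) a q : bil G ->
  sw q (fun q1 q' => sw q' (fun q2 q3 => sw q2 (fun c d => sw c (fun e f =>
    G (lt (rt (Sd (lt (rt a q1) (S q3))) (S d)) e) f)))) = G (Sd a) q.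
Proof.
move=> lG; have llt := bil_ltrans H; have lrt := bil_rtrans H.
pose K q1 e f d q3 := G (Sd (lt (rt a (S e ** q1)) (S q3 ** d))) f.
transitivity (sw q (fun q1 q' => sw q' (fun q2 q3 => sw q2 (fun e r => sw r (fun f d => K q1 e f d q3))))).
  apply: eq_sw => q1 q'; apply: eq_sw => q2 q3.
  rewrite -[RHS](sw_coassoc HH q2 (fun e f d => K q1 e f d q3)).
  by apply: eq_sw => c d; apply: eq_sw => e f; rewrite antipode_translate.
transitivity (sw q (fun q1 q' => sw q' (fun e s => sw s (fun r q3 => sw r (fun f d => K q1 e f d q3))))).
  apply: eq_sw => q1 q'.
  exact: (sw_coassoc HH q' (fun e r q3 => sw r (fun f d => K q1 e f d q3))).
rewrite -[LHS](sw_coassoc HH q (fun q1 e s => sw s (fun r q3 => sw r (fun f d => K q1 e f d q3)))).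
pose L f d q3 := G (Sd (lt a (S q3 ** d))) f.
transitivity (sw q (fun w s => eps w *: sw s (fun r q3 => sw r (fun f d => L f d q3)))).
  apply: eq_sw => w s.
  have lg : lin (fun z => sw s (fun r q3 => sw r (fun f d => G (Sd (lt (rt a z) (S q3 ** d))) f))).
    apply: lin_swg => r q3; apply: lin_swg => f d.
    exact: lin_comp (lG.1 _) (lin_SHd H (lin_comp (llt.1 _) (lrt.2 _))).
  transitivity (eps w *: sw s (fun r q3 => sw r (fun f d => G (Sd (lt (rt a one) (S q3 ** d))) f))).
    exact: (sw_Sl_op HH SS w lg).
  by congr (_ *: _); apply: eq_sw => r q3; apply: eq_sw => f d; rewrite (rt_one HH).
rewrite (sw_counitl HH (g := fun s => sw s (fun r q3 => sw r (fun f d => L f d q3)))); last first.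
  exact: lin_swx (@lin_id _ _).
rewrite (sw_coassoc HH q L).
transitivity (sw q (fun f w => eps w *: G (Sd a) f)).
  apply: eq_sw => f w.
  have lg : lin (fun z => G (Sd (lt a z)) f).
    exact: lin_comp (lG.1 _) (lin_SHd H (llt.2 _)).
  transitivity (eps w *: G (Sd (lt a one)) f); first exact: (sw_Sl_op HH SS w lg).
  by rewrite (lt_one HH).
exact: (sw_counitr HH (lG.2 _)).
Qed.

(** The Sweedler identity behind [qact_pact]. Of the four translations the two inner ones merge to
    q1 S(p3) and cancel; the outer two remain. *)
Lemma cross_cancel W (G : vB -> vB -> vB -> vB -> W) a h :
  (forall v x y, lin (fun u => G u v x y)) -> (forall u x y, lin (fun v => G u v x y)) ->
  (forall u v x, lin (fun y => G u v x y)) ->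
  swd a (fun a1 a2 => sw h (fun p q => sw p (fun p1 p' => sw p' (fun p2 p3 =>
    sw q (fun q1 q' => sw q' (fun q2 q3 =>
      G (lt (rt a1 q1) (S q3)) (lt (rt a2 p1) (S p3)) p2 q2)))))) =
  sw h (fun h1 u => sw u (fun w h3 => sw w (fun w1 w2 =>
    swd (lt (rt a h1) (S h3)) (fun b1 b2 => G b1 b2 w1 w2)))).
Proof.
move=> lG1 lG2 lG4; have llt := bil_ltrans H; have lrt := bil_rtrans H.
pose K z p1 p2 q2 q3 := swd a (fun a1 a2 => G (lt (rt a1 z) (S q3)) (rt a2 p1) p2 q2).
have lK p1 p2 q2 q3 : lin (fun z => K z p1 p2 q2 q3).
  apply: lin_swg => a1 a2; exact: lin_comp (lG1 _ _ _) (lin_comp (llt.1 _) (lrt.2 _)).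
have lK4 z p1 p2 : lin (fun u => sw u (fun q2 q3 => K z p1 p2 q2 q3)).
  exact: lin_swx (@lin_id _ _).
transitivity (sw h (fun p q => sw p (fun p1 p' => sw p' (fun p2 p3 =>
    sw q (fun q1 q' => sw q' (fun q2 q3 => K (q1 ** S p3) p1 p2 q2 q3)))))).
  rewrite -[LHS](sw_exch (H' := dualH H)); apply: eq_sw => p q.
  rewrite -[LHS](sw_exch (H' := dualH H)); apply: eq_sw => p1 p'.
  rewrite -[LHS](sw_exch (H' := dualH H)); apply: eq_sw => p2 p3.
  rewrite -[LHS](sw_exch (H' := dualH H)); apply: eq_sw => q1 q'.
  rewrite -[LHS](sw_exch (H' := dualH H)); apply: eq_sw => q2 q3.
  rewrite -[RHS](swd_middle HH a q1 (S p3) (G := fun u v => G (lt u (S q3)) (rt v p1) p2 q2)).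
    by apply: (eq_sw (H := dualH H)) => a1 a2; rewrite [lt (rt a2 p1) _]lt_rt.
  by split=> u; [exact: lin_comp (lG1 _ _ _) (llt.1 _) | exact: lin_comp (lG2 _ _ _) (lrt.1 _)].
transitivity (sw h (fun p1 r => sw r (fun p' q => sw p' (fun p2 p3 =>
    sw q (fun q1 q' => sw q' (fun q2 q3 => K (q1 ** S p3) p1 p2 q2 q3)))))).
  exact: (sw_coassoc HH h (fun p1 p' q => sw p' (fun p2 p3 =>
    sw q (fun q1 q' => sw q' (fun q2 q3 => K (q1 ** S p3) p1 p2 q2 q3))))).
apply: eq_sw => p1 r.
transitivity (sw r (fun p2 s => sw s (fun p3 q =>
    sw q (fun q1 q' => sw q' (fun q2 q3 => K (q1 ** S p3) p1 p2 q2 q3))))).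
  exact: (sw_coassoc HH r (fun p2 p3 q =>
    sw q (fun q1 q' => sw q' (fun q2 q3 => K (q1 ** S p3) p1 p2 q2 q3)))).
transitivity (sw r (fun p2 s => sw s (fun q2 q3 => K one p1 p2 q2 q3))).
  apply: eq_sw => p2 s.
  rewrite -[LHS](sw_coassoc HH s (fun p3 q1 q' => sw q' (fun q2 q3 => K (q1 ** S p3) p1 p2 q2 q3))).
  transitivity (sw s (fun w q' => eps w *: sw q' (fun q2 q3 => K one p1 p2 q2 q3))).
    apply: eq_sw => w q'.
    have lg : lin (fun z => sw q' (fun q2 q3 => K z p1 p2 q2 q3)) by apply: lin_swg.
    exact: (sw_Sr_op HH SS w lg).
  exact: (sw_counitl HH (lK4 one p1 p2)).
rewrite -[LHS](sw_coassoc HH r (fun p2 q2 q3 => K one p1 p2 q2 q3)).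
apply: eq_sw => w q3; apply: eq_sw => p2 q2.
have lG : bil (fun u v => G u v p2 q2) by split=> u; [exact: lG1 | exact: lG2].
have lG' : bil (fun u v => G (lt u (S q3)) v p2 q2).
  by split=> u; [exact: lin_comp (lG1 _ _ _) (llt.1 _) | exact: lG2].
rewrite (swd_ltrans HH _ _ lG) (swd_rtrans HH _ _ lG').
by apply: (eq_sw (H := dualH H)) => a1 a2; rewrite (rt_one HH).
Qed.

Lemma sw3E W x (g : vB -> vB -> vB -> W) :
  sw3 (Delta3H H) x g = sw x (fun u x3 => sw u (fun x1 x2 => g x1 x2 x3)).
Proof.
by rewrite sw_left_sum; apply: eq_bigr => t _; rewrite mkvE.
Qed.

End SweedlerCancellations.

Section Double.
Variables (F : fieldType) (n : nat) (H : hopfData F n).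
Local Notation vB := (vec F 'I_n).
Local Notation vBB := (vec F ('I_n * 'I_n)%type).
Local Notation "x ** y" := (mulH H x y) (at level 40, left associativity).
Local Notation S := (SH H).
Local Notation sw x g := (sw2 (DeltaH H) x g).
Local Notation swd x g := (sw2 (DeltaH (dualH H)) x g).
Local Notation lt := (ltrans H).
Local Notation rt := (rtrans H).

(** The pairings in the product of D(H) become the same two translations that occur in the cross
    relation of the holonomies. *)
Lemma mulDpureE a h a' h' : mulDpure H a h a' h' =
  sw h (fun u h3 => sw u (fun h1 h2 => tens (mulHd H a (lt (rt a' h1) (S h3))) (h2 ** h'))).
Proof.
rewrite /mulDpure [LHS](sw3E (dualH H)).
transitivity (sw h (fun u h3 => sw u (fun h1 h2 => swd a' (fun b a3 => swd b (fun a1 a2 =>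
  (pairing a3 h1 * pairing (SHd H a1) h3) *: tens (mulHd H a a2) (h2 ** h')))))).
  transitivity (swd a' (fun b a3 => sw h (fun u h3 => sw u (fun h1 h2 => swd b (fun a1 a2 =>
    (pairing a3 h1 * pairing (SHd H a1) h3) *: tens (mulHd H a a2) (h2 ** h')))))).
    apply: (eq_sw (H := dualH H)) => b a3.
    transitivity (swd b (fun a1 a2 => sw h (fun u h3 => sw u (fun h1 h2 =>
      (pairing a3 h1 * pairing (SHd H a1) h3) *: tens (mulHd H a a2) (h2 ** h'))))).
      by apply: (eq_sw (H := dualH H)) => a1 a2; rewrite sw3E.
    rewrite -[LHS](sw_exch (H' := dualH H)); apply: eq_sw => u h3.
    by rewrite -[LHS](sw_exch (H' := dualH H)).
  rewrite -[LHS](sw_exch (H' := dualH H)); apply: eq_sw => u h3.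
  by rewrite -[LHS](sw_exch (H' := dualH H)).
apply: eq_sw => u h3; apply: eq_sw => h1 h2.
pose K b : vBB := tens (mulHd H a b) (h2 ** h').
have lK : lin K by rewrite /K; lint.
have llt := bil_ltrans H.
transitivity (swd a' (fun b a3 => pairing a3 h1 *: K (lt b (S h3)))); last first.
  exact: (swd_pairr (H := H) (lin_comp lK (llt.1 (S h3)))).
apply: (eq_sw (H := dualH H)) => b a3.
transitivity (swd b (fun a1 a2 => pairing a1 (S h3) *: (pairing a3 h1 *: K a2))).
  by apply: (eq_sw (H := dualH H)) => a1 a2; rewrite pairing_SHd scalerA mulrC.
exact: (swd_pairl (H := H) (lin_scale _ lK)).
Qed.

Lemma mulD_ev d d' : mulD H d d' = ev (fun a h => ev (fun a' h' =>
  sw h (fun u h3 => sw u (fun h1 h2 => tens (mulHd H a (lt (rt a' h1) (S h3))) (h2 ** h')))) d') d.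
Proof.
rewrite /mulD (linext2_ev (mulDpure H)).
by apply: eq_ev => a h; apply: eq_ev => a' h'; rewrite mulDpureE.
Qed.

Lemma bil_mulD : bil (mulD H).
Proof. by split=> y; [exact: lin_linext2l | exact: lin_linext2r]. Qed.

Lemma DeltaD_tens a z : DeltaD H (tens a z) =
  swd a (fun a1 a2 => sw z (fun z1 z2 => tens (tens a2 z1) (tens a1 z2))).
Proof.
transitivity (ev (fun a z => swd a (fun a1 a2 => sw z (fun z1 z2 =>
   tens (tens a2 z1) (tens a1 z2)))) (tens a z)); first by [].
by rewrite ev_tens //; lint.
Qed.

Lemma lin_DeltaD : lin (DeltaD H).
Proof. exact: lin_linext. Qed.

Lemma epsD_tens a z : epsD H (tens a z) = epsHd H a * epsH H z.
Proof.
transitivity (ev (W := F^o) (fun a z => epsHd H a * epsH H z) (tens a z)); first by [].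
by rewrite ev_tens //; lint.
Qed.

Lemma lin_epsD : lin (epsD H : vBB -> F^o).
Proof. exact: (lin_ev (W := F^o) (fun a z => epsHd H a * epsH H z)). Qed.

End Double.

(** * Conjugation by a representation of D(H) in an arbitrary algebra *)

Section VertexAction.
Variables (F : fieldType) (n : nat) (H : hopfData F n).
Hypothesis HH : isHopf H.
Hypothesis SS : forall x, SH H (SH H x) = x.
Local Notation vB := (vec F 'I_n).
Local Notation vBB := (vec F ('I_n * 'I_n)%type).
Local Notation "x ** y" := (mulH H x y) (at level 40, left associativity).
Local Notation "x *d y" := (mulHd H x y) (at level 40, left associativity).
Local Notation S := (SH H).
Local Notation Sd := (SHd H).
Local Notation eps := (epsH H).
Local Notation epsd := (epsHd H).
Local Notation one := (oneH H).
Local Notation oned := (oneHd H).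
Local Notation sw x g := (sw2 (DeltaH H) x g).
Local Notation swd x g := (sw2 (DeltaH (dualH H)) x g).
Local Notation lt := (ltrans H).
Local Notation rt := (rtrans H).

Let HD := dual_isHopf HH.

Variables (A : lmodType F) (mul : A -> A -> A) (oneA : A).
Hypothesis lm : bil mul.
Hypothesis mA : forall X Y Z, mul (mul X Y) Z = mul X (mul Y Z).
Hypothesis m1 : forall X, mul oneA X = X.
Hypothesis mr1 : forall X, mul X oneA = X.
Variables R Q : vB -> A.
Hypothesis lR : lin R.
Hypothesis lQ : lin Q.
Hypothesis R_mul : forall x y, R (x ** y) = mul (R x) (R y).
Hypothesis Q_mul : forall x y, Q (x *d y) = mul (Q x) (Q y).
Hypothesis R_one : R one = oneA.
Hypothesis Q_one : Q oned = oneA.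
Hypothesis RQ : forall h a, mul (R h) (Q a) = sw h (fun h1 u => sw u (fun h2 h3 =>
  mul (Q (lt (rt a h1) (S h3))) (R h2))).

(** The antipode sits on the second leg here and on the first leg in [qact], because the coproduct
    of D(H) reverses the legs of the dual factor. *)
Definition pact z X := sw z (fun z1 z2 => mul (mul (R (S z2)) X) (R z1)).
Definition qact a X := swd a (fun a1 a2 => mul (mul (Q (Sd a1)) X) (Q a2)).

Lemma bil_pact : bil pact.
Proof.
split=> X; first exact: lin_swx (@lin_id _ _).
by apply: lin_swg => z1 z2; exact: lin_comp (lm.1 _) (lm.2 _).
Qed.

Lemma bil_qact : bil qact.
Proof.
split=> X; first exact: lin_swx (@lin_id _ _).
by apply: lin_swg => z1 z2; exact: lin_comp (lm.1 _) (lm.2 _).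
Qed.

Lemma pact_mul x y X : pact (x ** y) X = pact y (pact x X).
Proof.
rewrite /pact (sw_mul HH); last first.
  split=> u; first exact: lin_comp (lm.2 _) lR.
  exact: lin_comp (lm.1 _) (lin_comp (lm.1 _) (lin_comp lR (lin_SH H (@lin_id _ _)))).
rewrite sw_exch; apply: eq_sw => y1 y2.
rewrite (sw_lin _ _ (lm.2 _)) (sw_lin _ _ (lm.1 _)); apply: eq_sw => x1 x2.
by rewrite (S_mul HH) !R_mul !mA.
Qed.

Lemma qact_mul x y X : qact (x *d y) X = qact y (qact x X).
Proof.
rewrite /qact [LHS](sw_mul HD); last first.
  split=> u; last exact: lin_comp (lm.2 _) lQ.
  exact: lin_comp (lm.1 _) (lin_comp (lm.1 _) (lin_comp lQ (lin_SHd H (@lin_id _ _)))).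
rewrite [LHS]sw_exch; apply: (eq_sw (H := dualH H)) => y1 y2.
rewrite (sw_lin _ _ (lm.2 _)) (sw_lin _ _ (lm.1 _)); apply: (eq_sw (H := dualH H)) => x1 x2.
rewrite -[mulH _ x1 y1]/(x1 *d y1) -[mulH _ x2 y2]/(x2 *d y2).
by rewrite (Sd_mul HH) !Q_mul !mA.
Qed.

Lemma pact_one X : pact one X = X.
Proof.
rewrite /pact (sw_one HH); first by rewrite (S_one HH) R_one mr1 m1.
split=> u; first exact: lin_comp (lm.2 _) lR.
exact: lin_comp (lm.1 _) (lin_comp (lm.1 _) (lin_comp lR (lin_SH H (@lin_id _ _)))).
Qed.

Lemma qact_one X : qact oned X = X.
Proof.
rewrite /qact [LHS](sw_one HD).
  by rewrite -[oneH (dualH H)]/oned (Sd_one HH) Q_one mr1 m1.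
split=> u; last exact: lin_comp (lm.2 _) lQ.
exact: lin_comp (lm.1 _) (lin_comp (lm.1 _) (lin_comp lQ (lin_SHd H (@lin_id _ _)))).
Qed.

Lemma pact_unit z : pact z oneA = eps z *: oneA.
Proof.
rewrite /pact -R_one -(sw_Sl_op HH SS z lR); apply: eq_sw => z1 z2.
by rewrite R_one mr1 -R_mul.
Qed.

Lemma qact_unit a : qact a oneA = epsd a *: oneA.
Proof.
rewrite /qact -Q_one -[RHS](sw_Sl HD lQ); apply: (eq_sw (H := dualH H)) => z1 z2.
by rewrite Q_one mr1 -Q_mul.
Qed.

(** Between Y and X stands R(z_(3)) R(S(z_(2))), which cancels by the opposite antipode identity.
    The legs come out in reverse order, as the opposite algebra requires. *)
Lemma pact_prod z Y X : pact z (mul Y X) = sw z (fun z1 z2 => mul (pact z2 Y) (pact z1 X)).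
Proof.
pose K z1 z2 z3 z4 := mul (mul (R (S z4)) (mul Y (mul (R (z3 ** S z2)) X))) (R z1).
transitivity (sw z (fun a b => sw a (fun z1 z2 => sw b (fun z3 z4 => K z1 z2 z3 z4)))); last first.
  apply: eq_sw => a b; rewrite (sw_lin _ _ (lm.2 _)); apply: eq_sw => z1 z2.
  rewrite (sw_lin _ _ (lm.1 _)); apply: eq_sw => z3 z4.
  by rewrite /K R_mul !mA.
rewrite [RHS](sw_coassoc HH z (fun z1 z2 b => sw b (fun z3 z4 => K z1 z2 z3 z4))).
apply: eq_sw => z1 r.
rewrite -[RHS](sw_coassoc HH r (fun z2 z3 z4 => K z1 z2 z3 z4)).
transitivity (sw r (fun w z4 => eps w *: mul (mul (R (S z4)) (mul Y X)) (R z1))).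
  have lg : lin (fun z4 => mul (mul (R (S z4)) (mul Y X)) (R z1)).
    exact: lin_comp (lm.1 _) (lin_comp (lm.1 _) (lin_comp lR (lin_SH H (@lin_id _ _)))).
  by rewrite (sw_counitl HH lg).
apply: eq_sw => w z4.
have lg : lin (fun u => mul (mul (R (S z4)) (mul Y (mul (R u) X))) (R z1)).
  exact: lin_comp (lm.1 _) (lin_comp (lm.2 _) (lin_comp (lm.2 _) (lin_comp (lm.1 _) lR))).
by rewrite (sw_Sr_op HH SS w lg) R_one m1.
Qed.

Lemma qact_prod a Y X : qact a (mul Y X) = swd a (fun a1 a2 => mul (qact a1 Y) (qact a2 X)).
Proof.
pose K z1 z2 z3 z4 := mul (mul (Q (Sd z1)) (mul Y (mul (Q (z2 *d Sd z3)) X))) (Q z4).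
transitivity (swd a (fun a b => swd a (fun z1 z2 => swd b (fun z3 z4 => K z1 z2 z3 z4)))); last first.
  apply: (eq_sw (H := dualH H)) => b c; rewrite (sw_lin _ _ (lm.1 _)).
  apply: (eq_sw (H := dualH H)) => z1 z2.
  rewrite (sw_lin _ _ (lm.2 _)); apply: (eq_sw (H := dualH H)) => z3 z4.
  by rewrite /K Q_mul !mA.
rewrite [RHS](sw_coassoc HD a (fun z1 z2 b => swd b (fun z3 z4 => K z1 z2 z3 z4))).
apply: (eq_sw (H := dualH H)) => z1 r.
rewrite -[RHS](sw_coassoc HD r (fun z2 z3 z4 => K z1 z2 z3 z4)).
transitivity (swd r (fun w z4 => epsH (dualH H) w *: mul (mul (Q (Sd z1)) (mul Y X)) (Q z4))).
  have lg : lin (fun z4 => mul (mul (Q (Sd z1)) (mul Y X)) (Q z4)).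
    exact: lin_comp (lm.2 _) lQ.
  by rewrite (sw_counitl HD lg).
apply: (eq_sw (H := dualH H)) => w z4.
have lg : lin (fun u => mul (mul (Q (Sd z1)) (mul Y (mul (Q u) X))) (Q z4)).
  exact: lin_comp (lm.1 _) (lin_comp (lm.2 _) (lin_comp (lm.2 _) (lin_comp (lm.1 _) lQ))).
transitivity (epsH (dualH H) w *: mul (mul (Q (Sd z1)) (mul Y (mul (Q oned) X))) (Q z4)).
  by rewrite Q_one m1.
exact: (esym (sw_Sr HD (x := w) lg)).
Qed.

(** The cross relation [RQ] with antipodes applied, needed to exchange the factors standing on the
    left of X. *)
Lemma QR a q : mul (Q (Sd a)) (R (S q)) = sw q (fun q1 q' => sw q' (fun q2 q3 =>
  mul (R (S q2)) (Q (Sd (lt (rt a q1) (S q3)))))).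
Proof.
have lG : bil (fun b x => mul (Q b) (R (S x))).
  split=> u; first exact: lin_comp (lm.1 _) lQ.
  exact: lin_comp (lm.2 _) (lin_comp lR (lin_SH H (@lin_id _ _))).
rewrite -[LHS](left_cancel HH SS a q lG).
apply: eq_sw => q1 q'; apply: eq_sw => q2 q3.
have lrt := bil_rtrans H; have llt := bil_ltrans H.
have lg b : bil (fun h1 u => sw u (fun h2 h3 => mul (Q (lt (rt b h1) (S h3))) (R h2))).
  split=> u; last exact: lin_swx (@lin_id _ _).
  apply: lin_swg => h2 h3.
  exact: lin_comp (lm.1 _) (lin_comp lQ (lin_comp (llt.1 _) (lrt.2 _))).
rewrite RQ (sw_S HH _ (lg _)); apply: eq_sw => c d.
rewrite (sw_S HH).
  by apply: eq_sw => e f; rewrite SS.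
split=> u; first exact: lin_comp (lm.2 _) lR.
exact: lin_comp (lm.1 _) (lin_comp lQ (lin_comp (llt.2 _) (lin_SH H (@lin_id _ _)))).
Qed.

Lemma qact_pact a h X : qact a (pact h X) = sw h (fun h1 u => sw u (fun w h3 =>
  pact w (qact (lt (rt a h1) (S h3)) X))).
Proof.
pose G u v x y := mul (mul (mul (R (S y)) (Q (Sd u))) X) (mul (Q v) (R x)).
transitivity (swd a (fun a1 a2 => sw h (fun p q => sw p (fun p1 p' => sw p' (fun p2 p3 =>
    sw q (fun q1 q' => sw q' (fun q2 q3 =>
      G (lt (rt a1 q1) (S q3)) (lt (rt a2 p1) (S p3)) p2 q2))))))).
  apply: (eq_sw (H := dualH H)) => a1 a2; rewrite /pact (sw_lin _ _ (lm.2 _)) (sw_lin _ _ (lm.1 _)).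
  apply: eq_sw => p q.
  transitivity (mul (mul (mul (Q (Sd a1)) (R (S q))) X) (mul (R p) (Q a2))).
    by rewrite !mA.
  rewrite RQ (sw_lin _ _ (lm.2 _)); apply: eq_sw => p1 p'.
  rewrite (sw_lin _ _ (lm.2 _)); apply: eq_sw => p2 p3.
  rewrite QR (sw_lin _ _ (lm.1 _)) (sw_lin _ _ (lm.1 _)); apply: eq_sw => q1 q'.
  by rewrite (sw_lin _ _ (lm.1 _)) (sw_lin _ _ (lm.1 _)); apply: eq_sw => q2 q3.
rewrite (cross_cancel HH SS) /G.
- apply: eq_sw => h1 u; apply: eq_sw => w h3; apply: eq_sw => w1 w2.
  rewrite /qact (sw_lin _ _ (lm.2 _)) (sw_lin _ _ (lm.1 _)).
  by apply: (eq_sw (H := dualH H)) => b1 b2; rewrite !mA.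
- move=> v x y; apply: (lin_comp (lm.1 _)); apply: (lin_comp (lm.1 _)).
  exact: lin_comp (lm.2 _) (lin_comp lQ (lin_SHd H (@lin_id _ _))).
- by move=> u x y; exact: lin_comp (lm.2 _) (lin_comp (lm.1 _) lQ).
move=> u v x; apply: (lin_comp (lm.1 _)); apply: (lin_comp (lm.1 _)).
exact: lin_comp (lm.1 _) (lin_comp lR (lin_SH H (@lin_id _ _))).
Qed.

(** The dual acts before H, since a (x) z is the product of a (x) 1 and 1 (x) z and the action is a
    right action. *)
Definition act1 X (d : vBB) : A := ev (fun a z => pact z (qact a X)) d.

Lemma bil_act1 : bil act1.
Proof.
split=> y; last exact: lin_ev.
rewrite /act1 /ev; apply: lin_bigsum => p; apply: lin_scale.
exact: lin_comp (bil_pact.2 _) (bil_qact.2 _).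
Qed.

Lemma act1_tens X a z : act1 X (tens a z) = pact z (qact a X).
Proof.
apply: ev_tens => u; last exact: bil_pact.1.
exact: lin_comp (bil_pact.2 _) (bil_qact.1 _).
Qed.

Lemma act1_one X : act1 X (oneD H) = X.
Proof. by rewrite act1_tens qact_one pact_one. Qed.

Lemma act1_unit d : act1 oneA d = epsD H d *: oneA.
Proof.
have la := bil_act1; have le := @lin_epsD F n H.
apply: (ev_ext (f := act1 oneA) (g := fun d => epsD H d *: oneA)); first exact: la.2.
  exact: lin_scalel.
move=> a z; rewrite act1_tens qact_unit (linZ _ _ (bil_pact.2 _)) pact_unit.
by rewrite epsD_tens scalerA.
Qed.

Lemma act1_mulD X d d' : act1 X (mulD H d d') = act1 (act1 X d) d'.
Proof.
have la := bil_act1.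
rewrite mulD_ev (ev_lin _ _ (la.2 X)) [RHS](ev_lin _ _ (la.1 d')).
apply: eq_ev => a h; rewrite (ev_lin _ _ (la.2 X)); apply: eq_ev => a' h'.
rewrite qact_pact (sw_lin _ _ (la.2 X)) (sw_lin _ _ (bil_pact.2 _)).
transitivity (sw h (fun h1 r => sw r (fun h2 h3 => pact h' (pact h2 (qact (lt (rt a' h1) (S h3)) (qact a X)))))).
  rewrite -[RHS](sw_coassoc HH h (fun h1 h2 h3 => pact h' (pact h2 (qact (lt (rt a' h1) (S h3)) (qact a X))))).
  apply: eq_sw => u h3; rewrite (sw_lin _ _ (la.2 X)); apply: eq_sw => h1 h2.
  by rewrite act1_tens pact_mul qact_mul.
by apply: eq_sw => h1 r; rewrite (sw_lin _ _ (bil_pact.2 _)).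
Qed.

Lemma act1_prod Y X d : act1 (mul Y X) d =
  ev (fun d1 d2 => mul (act1 Y d2) (act1 X d1)) (DeltaD H d).
Proof.
have la := bil_act1.
have le := lin_ev (fun d1 d2 => mul (act1 Y d2) (act1 X d1)).
apply: (ev_ext (f := act1 (mul Y X)) (g := fun d => ev _ (DeltaD H d))); first exact: la.2.
  exact: lin_comp le (@lin_DeltaD F n H).
move=> a z; rewrite act1_tens qact_prod DeltaD_tens.
rewrite (sw_lin _ _ (bil_pact.2 _)) (sw_lin _ _ le); apply: (eq_sw (H := dualH H)) => a1 a2.
rewrite pact_prod (sw_lin _ _ le); apply: eq_sw => z1 z2.
rewrite ev_tens ?act1_tens // => u.
  exact: lin_comp (lm.2 _) (la.2 _).
exact: lin_comp (lm.1 _) (la.2 _).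
Qed.

End VertexAction.

(** * The action of the tensor power of D(H) *)

Section Commutation.
Variables (F : fieldType) (n : nat) (A : lmodType F) (mul : A -> A -> A).
Hypothesis lm : bil mul.
Hypothesis mA : forall X Y Z, mul (mul X Y) Z = mul X (mul Y Z).
Local Notation vB := (vec F 'I_n).

Definition twosided (K : hopfData F n) (f g : vB -> vB -> A) z X :=
  sw2 (DeltaH K) z (fun z1 z2 => mul (mul (f z1 z2) X) (g z1 z2)).

Lemma twosided_comm K K' f g f' g' z z' X :
  (forall a b c d, mul (f a b) (f' c d) = mul (f' c d) (f a b)) ->
  (forall a b c d, mul (g a b) (g' c d) = mul (g' c d) (g a b)) ->
  twosided K f g z (twosided K' f' g' z' X) = twosided K' f' g' z' (twosided K f g z X).
Proof.
move=> cf cg; rewrite /twosided.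
transitivity (sw2 (DeltaH K) z (fun z1 z2 => sw2 (DeltaH K') z' (fun c d =>
   mul (mul (f z1 z2) (mul (mul (f' c d) X) (g' c d))) (g z1 z2)))).
  by apply: eq_sw => z1 z2; rewrite (sw_lin _ _ (lm.2 _)) (sw_lin _ _ (lm.1 _)).
rewrite sw_exch; apply: eq_sw => c d.
rewrite (sw_lin _ _ (lm.2 _)) (sw_lin _ _ (lm.1 _)); apply: eq_sw => z1 z2.
by rewrite -!mA cf !mA cg.
Qed.

End Commutation.

(** * Multilinear maps and actions of tensor powers *)

Section Multilinear.
Variables (F : fieldType) (V C : finType) (A : lmodType F).
Local Notation TV := (vec F {ffun V -> C}).

(** The universal property of the tensor power, by making one slot after another a basis vector.
    Extensionality of g is a hypothesis because its argument is a plain function. *)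
Lemma multilinear_expand (g : (V -> vec F C) -> A) w :
  (forall w w', w =1 w' -> g w = g w') -> (forall w v, lin (fun x => g (upd w v x))) ->
  \sum_(f : {ffun V -> C}) tpow w f *: g (fun v => bvec F (f v)) = g w.
Proof.
move=> ge gl; pose Phi := linext (fun f : {ffun V -> C} => g (fun v => bvec F (f v))).
have lPhi : lin Phi by apply: lin_linext.
suff h (s : seq V) u : (forall v, v \notin s -> exists c, u v = bvec F c) -> Phi (tpow u) = g u.
  by apply: (h (enum V)) => v; rewrite mem_enum.
elim: s u => [|v s IH] u hu.
  have [f fE] := fin_all_exists (fun v => hu v isT).
  have -> : tpow u = bvec F [ffun v => f v].
    by rewrite -tpow_b; apply: eq_tpow => v; rewrite ffunE.
  by rewrite /Phi linext_b; apply: ge => v; rewrite ffunE fE.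
have uE : u =1 upd u v (u v) by move=> x; rewrite /upd; case: eqP => [->|].
rewrite (eq_tpow uE) (ge _ _ uE).
apply: (eq_on_basis (f := fun x => Phi (tpow (upd u v x))) (g := fun x => g (upd u v x))) => //.
  exact: lin_comp lPhi (lin_tpow _ _).
move=> c; apply: IH => x; rewrite /upd; case: eqP => [_ _|/eqP ne xs]; first by exists c.
by apply: hu; rewrite inE negb_or ne.
Qed.

End Multilinear.

Section TensorAction.
Variables (F : fieldType) (V C : finType) (A : lmodType F).
Local Notation TV := (vec F {ffun V -> C}).
Variable op : V -> vec F C -> A -> A.
Hypothesis lop1 : forall v X, lin (fun d => op v d X).
Hypothesis lop2 : forall v d, lin (op v d).
Hypothesis opC : forall v w d d' X, v != w -> op v d (op w d' X) = op w d' (op v d X).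

(** The factors act in the order of [enum V]; the commutation [opC] lets products in the tensor
    power be regrouped factor by factor. *)
Definition fold (w : V -> vec F C) (s : seq V) X := foldl (fun Y v => op v (w v) Y) X s.

Lemma eq_fold w w' s X : {in s, w =1 w'} -> fold w s X = fold w' s X.
Proof.
elim: s X => //= v s IH X e; rewrite /= e ?inE ?eqxx // IH // => x xs.
by apply: e; rewrite inE xs orbT.
Qed.

Lemma lin_fold w s : lin (fold w s).
Proof.
elim: s => [|v s IH]; first exact: lin_id.
exact: lin_comp IH (lop2 v (w v)).
Qed.

Lemma fold_upd_out w s v x X : v \notin s -> fold (upd w v x) s X = fold w s X.
Proof.
move=> vs; apply: eq_fold => y ys; rewrite /upd; case: eqP => // yv.
by rewrite -yv ys in vs.
Qed.

Lemma lin_fold_upd w s v X : uniq s -> v \in s -> lin (fun x => fold (upd w v x) s X).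
Proof.
elim: s X => // u s IH X /= /andP[us uu]; rewrite inE; have [->|ne] /= := eqVneq v u.
  move=> _; apply: (lin_ext (f := fun x => fold w s (op u x X))).
    by move=> x; rewrite /= [upd w u x u]/upd eqxx fold_upd_out.
  exact: lin_comp (lin_fold w s) (lop1 u X).
move=> vs; apply: (lin_ext (f := fun x => fold (upd w v x) s (op u (w u) X))).
  by move=> x; rewrite /= [upd w v x u]/upd eq_sym (negbTE ne).
exact: IH.
Qed.

Lemma op_fold v d w s X : v \notin s -> op v d (fold w s X) = fold w s (op v d X).
Proof.
elim: s X => //= u s IH X; rewrite inE negb_or => /andP[vu vs].
by rewrite IH // opC.
Qed.

Definition tact X (d : TV) : A :=
  linext (fun f : {ffun V -> C} => fold (fun v => bvec F (f v)) (enum V) X) d.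

Lemma bil_tact : bil tact.
Proof.
split=> d; last exact: lin_linext.
by apply: lin_bigsum => f; apply: lin_scale; apply: lin_fold.
Qed.

Lemma tact_tpow X w : tact X (tpow w) = fold w (enum V) X.
Proof.
apply: (multilinear_expand (g := fun w => fold w (enum V) X)) => [w1 w2 e|w1 v].
  by apply: eq_fold => x _; apply: e.
by apply: lin_fold_upd; rewrite ?enum_uniq ?mem_enum.
Qed.

Lemma tact_b X f : tact X (bvec F f) = fold (fun v => bvec F (f v)) (enum V) X.
Proof. exact: linext_b. Qed.

Section Module.
Variables (m : vec F C -> vec F C -> vec F C) (one : vec F C).
Hypothesis lm : bil m.
Hypothesis op_one : forall v X, op v one X = X.
Hypothesis op_mul : forall v d d' X, op v (m d d') X = op v d' (op v d X).

Lemma fold_one s X : fold (fun=> one) s X = X.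
Proof. by elim: s X => //= v s IH X; rewrite op_one IH. Qed.

Lemma tact_one X : tact X (tone V one) = X.
Proof. by rewrite tact_tpow fold_one. Qed.

Lemma tact_at v X d : tact X (tat one v d) = op v d X.
Proof.
rewrite tact_tpow; have := enum_uniq V; have : v \in enum V by rewrite mem_enum.
elim: (enum V) X => // u s IH X; rewrite inE /= => + /andP[us uu].
have [vu _|ne] /= := eqVneq v u; last by move=> vs; rewrite op_one IH.
rewrite -{}vu in us *.
rewrite -[RHS](fold_one s); apply: eq_fold => x xs.
by case: eqP => // xv; rewrite -xv xs in us.
Qed.

Lemma tact_mul X d d' : tact X (tmul m d d') = tact (tact X d) d'.
Proof.
have la := bil_tact; have lt := @bil_tmul F V C m.
apply: (tpow_ext (f := fun d => tact X (tmul m d d')) (g := fun d => tact (tact X d) d')).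
- exact: lin_comp (la.2 _) (lt.1 _).
- exact: lin_comp (la.1 _) (la.2 _).
move=> w.
apply: (tpow_ext (f := fun d' => tact X (tmul m _ d')) (g := fun d' => tact (tact X _) d')).
- exact: lin_comp (la.2 _) (lt.2 _).
- exact: la.2.
move=> w'; rewrite tmul_tpow // !tact_tpow.
elim: (enum V) (enum_uniq V) X => //= v s IH /andP[vs us] X.
by rewrite IH // op_mul op_fold.
Qed.

End Module.

Section ModuleAlgebra.
Variables (mul : A -> A -> A) (oneA : A).
Variables (D : vec F C -> vec F (C * C)%type) (e : vec F C -> F).
Hypothesis op_unit : forall v d, op v d oneA = e d *: oneA.
Hypothesis op_prod : forall v d Y X,
  op v d (mul Y X) = ev (fun d1 d2 => mul (op v d2 Y) (op v d1 X)) (D d).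

Lemma tact_unit d :
  tact oneA d = (\sum_(f : {ffun V -> C}) d f * \prod_v e (bvec F (f v))) *: oneA.
Proof.
rewrite scaler_suml; apply: eq_bigr => f _; rewrite -scalerA; congr (_ *: _).
rewrite -big_enum; elim: (enum V) => [|v s IH]; first by rewrite big_nil scale1r.
by rewrite big_cons /= op_unit (linZ _ _ (lin_fold _ _)) IH scalerA.
Qed.

(** Distributes a tensor in C (x) C at each vertex over the two factors of a product. It is
    multilinear in u: on coproducts it gives the action on the product, on basis vectors the product
    of two actions. *)
Fixpoint fold2 (u : V -> vec F (C * C)%type) (s : seq V) Y X : A :=
  if s is v :: s' then ev (fun p q => fold2 u s' (op v q Y) (op v p X)) (u v) else mul Y X.

Lemma eq_fold2 u u' s Y X : {in s, u =1 u'} -> fold2 u s Y X = fold2 u' s Y X.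
Proof.
elim: s Y X => //= v s IH Y X h; rewrite h ?inE ?eqxx //.
apply: eq_bigr => p _; rewrite IH // => x xs.
by apply: h; rewrite inE xs orbT.
Qed.

Lemma lin_fold2_upd u s v Y X : uniq s -> v \in s -> lin (fun x => fold2 (upd u v x) s Y X).
Proof.
elim: s Y X => // y s IH Y X /= /andP[ys us]; rewrite inE; have [->|ne] /= := eqVneq v y.
  move=> _; apply: (lin_ext (f := ev (fun p q => fold2 u s (op y q Y) (op y p X)))).
    move=> x; rewrite [upd u y x y]/upd eqxx; apply: eq_bigr => p _; congr (_ *: _).
    apply: eq_fold2 => z zs; rewrite /upd; case: eqP => // zy.
    by rewrite -zy zs in ys.
  exact: lin_ev.
move=> vs.
apply: (lin_ext (f := fun x => ev (fun p q => fold2 (upd u v x) s (op y q Y) (op y p X)) (u y))).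
  by move=> x; rewrite [upd u v x y]/upd eq_sym (negbTE ne).
by apply: lin_bigsum => p; apply: lin_scale; apply: IH.
Qed.

Lemma fold2_b (h : {ffun V -> C * C}) s Y X : fold2 (fun v => bvec F (h v)) s Y X =
  mul (fold (fun v => bvec F (h v).2) s Y) (fold (fun v => bvec F (h v).1) s X).
Proof. by elim: s Y X => //= v s IH Y X; rewrite /ev sum_coord IH. Qed.

Lemma fold2_D w s Y X : fold2 (fun v => D (w v)) s Y X = fold w s (mul Y X).
Proof.
elim: s Y X => //= v s IH Y X; rewrite op_prod (ev_lin _ _ (lin_fold w s)).
by apply: eq_bigr => p _; rewrite IH.
Qed.

Lemma tact_prod X Y f : tact (mul Y X) (bvec F f) =
  \sum_(pq : {ffun V -> C} * {ffun V -> C})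
    (\prod_v D (bvec F (f v)) (pq.1 v, pq.2 v)) *:
      mul (tact Y (bvec F pq.2)) (tact X (bvec F pq.1)).
Proof.
rewrite tact_b -fold2_D.
rewrite -(multilinear_expand (g := fun u => fold2 u (enum V) Y X)); first last.
- by move=> u v; apply: lin_fold2_upd; rewrite ?enum_uniq ?mem_enum.
- by move=> u u' h; apply: eq_fold2 => x _; apply: h.
(* The shuffle identifying the tensor power of C (x) C with two tensor powers of C. *)
pose k (pq : {ffun V -> C} * {ffun V -> C}) := [ffun v => (pq.1 v, pq.2 v)].
pose k' (h : {ffun V -> C * C}) := ([ffun v => (h v).1], [ffun v => (h v).2]).
rewrite (reindex k) /=; last first.
  exists k' => [[p q] _|h _]; last by apply/ffunP=> v; rewrite !ffunE; case: (h v).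
  by congr (_, _); apply/ffunP=> v; rewrite !ffunE.
apply: eq_bigr => pq _; rewrite fold2_b !tact_b tpowE; congr (_ *: mul _ _).
- by apply: eq_bigr => v _; rewrite ffunE.
- by apply: eq_fold => v _; rewrite ffunE.
by apply: eq_fold => v _; rewrite ffunE.
Qed.

End ModuleAlgebra.
End TensorAction.

Section RibbonAction.
Variables (F : fieldType) (n : nat) (H : hopfData F n).
Variables (V E : finType) (G : ribbon V E).
Hypothesis HH : isHopf H.
Hypothesis SS : forall x, SH H (SH H x) = x.
Hypothesis Gcil : ciliated G.
Hypothesis Greg : regular G.
Local Notation vBB := (vec F ('I_n * 'I_n)%type).
Local Notation mE := (@mulHE F n H E).

Let HD := dual_isHopf HH.

Lemma lin_vhol v : lin (vhol H G v). Proof. exact: lin_cprod. Qed.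
Lemma lin_fhol v : lin (fhol H G v). Proof. exact: lin_cprod. Qed.

Lemma vhol_mul v x y : vhol H G v (mulH H x y) = mE (vhol H G v x) (vhol H G v y).
Proof.
apply: (cprod_mul HH SS HH) => [o|o a b|o o' a b|]; last exact: uniq_cord_edges.
- exact: lin_rho.
- exact: rho_mul.
exact: rho_rho_ne.
Qed.

Lemma uniq_rev_face v : uniq (map fst (rev (faceOf G v))).
Proof. by rewrite map_rev rev_uniq; exact: uniq_face_edges. Qed.

Lemma fhol_mul v x y : fhol H G v (mulHd H x y) = mE (fhol H G v x) (fhol H G v y).
Proof.
apply: (cprod_mul HH SS HD) => [o|o a b|o o' a b|]; last exact: uniq_rev_face.
- exact: lin_sig.
- exact: sig_mul.
exact: sig_sig_ne.
Qed.

Lemma vhol_one v : vhol H G v (oneH H) = oneHE H E.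
Proof.
apply: (cprod_one HH SS HH) => o; first exact: lin_rho.
exact: rho_one.
Qed.

Lemma fhol_one v : fhol H G v (oneHd H) = oneHE H E.
Proof.
apply: (cprod_one HH SS HD) => o; first exact: lin_sig.
exact: sig_one.
Qed.

Definition vact v d X := act1 H mE (vhol H G v) (fhol H G v) X d.

(** The edges of each loop are distinct, so its holonomy is a convolution product; linearity then
    groups the formula into the conjugation by the face followed by that by the vertex. *)
Lemma actvE v X d : actv H G v X d = vact v d X.
Proof.
have lm : bil mE := bil_mE H E.
have vE z : hol H (vloop G v) (tens z (oneHd H)) = vhol H G v z.
  rewrite (hol_vertex HH SS); first by rewrite (epsd_one HH) scale1r.
  exact: uniq_cord_edges.
have fE a : hol H (floop G v) (tens (oneH H) a) = fhol H G v a.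
  rewrite (hol_face HH SS); first by rewrite (eps_one HH) scale1r.
  exact: uniq_rev_face.
apply: eq_bigr => p _; congr (_ *: _); rewrite /pact.
transitivity (sw2 (DeltaH H) (bvec F p.2) (fun z1 z2 => sw2 (DeltaHd H) (bvec F p.1) (fun d1 d2 =>
  mE (mE (vhol H G v (SH H z2)) (mE (mE (fhol H G v (SHd H d1)) X) (fhol H G v d2))) (vhol H G v z1)))).
  rewrite [RHS](sw_exch (H' := dualH H)); apply: (eq_sw (H := dualH H)) => d1 d2.
  by apply: eq_sw => z1 z2; rewrite !vE !fE !(mEA HH SS).
apply: eq_sw => z1 z2.
by rewrite /qact [in RHS](sw_lin _ _ (lm.2 _)) (sw_lin _ _ (lm.1 _)).
Qed.

Lemma bil_vact v : bil (vact v).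
Proof.
have [l1 l2] := bil_act1 H (bil_mE H E) (vhol H G v) (fhol H G v).
by split=> x; [exact: l2 | exact: l1].
Qed.

Local Notation pv v := (pact H mE (vhol H G v)).
Local Notation qv v := (qact H mE (fhol H G v)).

Lemma pact_comm v w z z' X : v != w -> pv v z (pv w z' X) = pv w z' (pv v z X).
Proof.
move=> vw; apply: (twosided_comm (bil_mE H E) (mEA HH SS) H H
  (f := fun _ y => vhol H G v (SH H y)) (g := fun x _ => vhol H G v x)
  (f' := fun _ y => vhol H G w (SH H y)) (g' := fun x _ => vhol H G w x)) => a b c d; exact: vhol_comm.
Qed.

Lemma qact_comm v w a a' X : v != w -> qv v a (qv w a' X) = qv w a' (qv v a X).
Proof.
move=> vw.
apply: (twosided_comm (bil_mE H E) (mEA HH SS) (dualH H) (dualH H)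
  (f := fun x _ => fhol H G v (SHd H x)) (g := fun _ y => fhol H G v y)
  (f' := fun x _ => fhol H G w (SHd H x)) (g' := fun _ y => fhol H G w y)) => a1 b c d; exact: fhol_comm.
Qed.

Lemma pact_qact_comm v w z a X : v != w -> pv v z (qv w a X) = qv w a (pv v z X).
Proof.
move=> vw.
apply: (twosided_comm (bil_mE H E) (mEA HH SS) H (dualH H)
  (f := fun _ y => vhol H G v (SH H y)) (g := fun x _ => vhol H G v x)
  (f' := fun x _ => fhol H G w (SHd H x)) (g' := fun _ y => fhol H G w y)) => a1 b c d; exact: vhol_fhol_comm.
Qed.

Lemma vact_comm v w d d' X : v != w -> vact v d (vact w d' X) = vact w d' (vact v d X).
Proof.
move=> vw; have lm : bil mE := bil_mE H E.
have wv : w != v by rewrite eq_sym.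
have l1 u := (bil_vact u).1; have l2 u := (bil_vact u).2.
apply: (ev_ext (f := fun d => vact v d (vact w d' X)) (g := fun d => vact w d' (vact v d X))).
- exact: l1.
- exact: lin_comp (l2 _ _) (l1 _ _).
move=> a z.
apply: (ev_ext (f := fun d' => vact v _ (vact w d' X)) (g := fun d' => vact w d' (vact v _ X))).
- exact: lin_comp (l2 _ _) (l1 _ _).
- exact: l1.
move=> a' z'; rewrite /vact !act1_tens //.
transitivity (pv v z (pv w z' (qv v a (qv w a' X)))).
  exact: congr1 (esym (pact_qact_comm z' a _ wv)).
transitivity (pv w z' (pv v z (qv w a' (qv v a X)))).
  by rewrite (qact_comm a a' X vw); exact: pact_comm.
exact: congr1 (pact_qact_comm z a' _ vw).
Qed.

Lemma vact_one v X : vact v (oneD H) X = X.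
Proof.
apply: (act1_one HH (bil_mE H E) (mE1 HH SS) (mEr1 HH SS)).
- exact: lin_vhol.
- exact: lin_fhol.
- exact: vhol_one.
exact: fhol_one.
Qed.

Lemma vact_mul v d d' X : vact v (mulD H d d') X = vact v d' (vact v d X).
Proof.
apply: (act1_mulD HH SS (bil_mE H E) (mEA HH SS)).
- exact: lin_vhol.
- exact: lin_fhol.
- exact: vhol_mul.
- exact: fhol_mul.
exact: (vhol_fhol HH SS Gcil Greg).
Qed.

Lemma vact_unit v d : vact v d (oneHE H E) = epsD H d *: oneHE H E.
Proof.
apply: (act1_unit HH SS (bil_mE H E) (mEr1 HH SS)).
- exact: lin_vhol.
- exact: lin_fhol.
- exact: vhol_mul.
- exact: fhol_mul.
- exact: vhol_one.
exact: fhol_one.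
Qed.

Lemma vact_prod v d Y X : vact v d (mE Y X) =
  ev (fun d1 d2 => mE (vact v d2 Y) (vact v d1 X)) (DeltaD H d).
Proof.
apply: (act1_prod HH SS (bil_mE H E) (mEA HH SS) (mE1 HH SS)).
- exact: lin_vhol.
- exact: lin_fhol.
- exact: vhol_mul.
- exact: fhol_mul.
- exact: vhol_one.
exact: fhol_one.
Qed.

End RibbonAction.

Theorem mainTheorem10 (F : fieldType) (n : nat) (H : hopfData F n)
  (charF : [pchar F] =i pred0) (HHopf : isHopf H) (Hss : semisimpleH H)
  (V E : finType) (G : ribbon V E) (Gcil : ciliated G) (Greg : regular G) :
  exists act : vec F {ffun E -> ('I_n * 'I_n)%type} ->
               vec F {ffun V -> ('I_n * 'I_n)%type} ->
               vec F {ffun E -> ('I_n * 'I_n)%type},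
  [/\ (* bilinearity *)
      (forall a X Y d, act (a *: X + Y) d = a *: act X d + act Y d) /\
      (forall a X d d', act X (a *: d + d') = a *: act X d + act X d'),
      (* the action of (d)_v is given by the formula *)
      (forall v X d, act X (atV H v d) = actv H G v X d),
      (* right D(H)^{(x)V}-module *)
      (forall X, act X (oneDV H V) = X) /\
      (forall X d d', act X (mulDV H d d') = act (act X d) d') &
      (* module algebra for H(H)^{op (x) E}: (X .op Y) <| d = (X <| d_(1)) .op (Y <| d_(2)),
         where X .op Y = Y . X *)
      (forall X Y d, act (mulHE H Y X) d =
         \sum_pq DeltaDV H d pq *: mulHE H (act Y (bvec F pq.2)) (act X (bvec F pq.1))) /\
      (forall d, act (oneHE H E) d = epsDV H d *: oneHE H E)].
Proof.
have [l hl] := semisimple_integral HHopf Hss.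
have SS := S2_id charF HHopf hl.
have l1 v X := (@bil_vact F n H V E G v).1 X.
have l2 v d := (@bil_vact F n H V E G v).2 d.
have [t1 t2] := bil_tact l2.
exists (tact (vact H G)); split; first split.
- by move=> a X Y d; apply: t1.
- by move=> a X d d'; apply: t2.
- move=> v X d; rewrite actvE //; apply: (tact_at l1 l2) => u Y; exact: vact_one.
- split=> X; first by apply: (tact_one l1 l2) => u Y; exact: vact_one.
  move=> d d'; apply: (tact_mul l1 l2).
  + by move=> *; apply: vact_comm.
  + exact: bil_mulD.
  by move=> *; apply: vact_mul.
split=> [X Y d|d]; last by apply: (tact_unit l2) => *; apply: vact_unit.
(* [tact_prod] computes on basis vectors d only, where the coproduct of the tensor power is a
   product over the vertices. *)
apply: (eq_on_basis (f := tact (vact H G) (mulHE H Y X)) (g := fun d =>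
  \sum_pq DeltaDV H d pq *: mulHE H (tact (vact H G) Y (bvec F pq.2))
                                    (tact (vact H G) X (bvec F pq.1)))); first exact: t2.
  by apply: lin_bigsum => pq; apply: lin_scalel; exact: lin_comp (lin_coord _) (lin_linext _).
move=> f; rewrite (tact_prod l2 (D := DeltaD H)); last by move=> *; apply: vact_prod.
by apply: eq_bigr => pq _; rewrite /DeltaDV linext_b mkvE.
Qed.
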